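(* Let $m\ge 2$, $1\le k_1\le k_2\le\dots\le k_m$, let $\Gamma=S(k_1,\dots,k_m)$ be the $m$-star with these ray lengths, let $\lambda$ be its Perron–Frobenius eigenvalue, let $G$ be the adjacency matrix of a bipartition of $\Gamma$, and put $$\alpha_j=\frac{R_{k_j-1}(\lambda)}{R_{k_j}(\lambda)},\qquad \delta_j=\frac1{R_{k_j}(\lambda)},\qquad j=1,\dots,m.$$ Let $n\in\mathbb N$. There exists a commuting square of multi-matrix algebras of the form $$\begin{array}{ccc} C&\subset_{nG^t}&D\\ \cup_G&&\cup_{G^t}\\ A&\subset_{nG}&B\end{array}$$ if and only if there exist $n\times n$ unitary matrices $u_{ij}\in M_n(\mathbb C)$, $i,j=1,\dots,m$, such that the $mn\times mn$ block matrix whose $(i,i)$ block is $\delta_iu_{ii}$ and whose $(i,j)$ block is $\sqrt{\alpha_i\alpha_j}\,u_{ij}$ for $i\ne j$ is unitary.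
   Context: $S(k_1,\dots,k_m)$ is the tree consisting of a central vertex with $m$ rays attached, the $i$-th ray being a path containing $k_i$ vertices (not counting the central vertex). The Perron–Frobenius eigenvalue of a finite graph is the largest eigenvalue of its adjacency matrix. ''Adjacency matrix $G$ of a bipartition'' means that, with vertices ordered by the bipartition, the adjacency matrix of $\Gamma$ is $\begin{pmatrix} 0 & G \\ G^t & 0 \end{pmatrix}$. The polynomials $R_n$ are defined by $R_0(t)=1$, $R_1(t)=t$, $R_n(t)=tR_{n-1}(t)-R_{n-2}(t)$ for $n\ge2$. A multi-matrix algebra is a finite direct sum of full complex matrix algebras; $X\subset_M Y$ means that $X$ is a unital $*$-subalgebra of $Y$ with inclusion matrix $M$. A square $A\subset B\subset D$, $A\subset C\subset D$ (vertical signs in the diagram: $A\subset_G C$, $B\subset_{G^t}D$) is a commuting square, with respect to a faithful trace on $D$, if the trace-preserving conditional expectations satisfy $E_A=E_BE_C=E_CE_B$. *)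

(* Defs.v *)
(* The complex numbers are R[i], over an abstract R : realType. *)
From HB Require Import structures.
From mathcomp Require Import all_boot all_order all_algebra.
From mathcomp Require Import complex.
From mathcomp Require Import classical_sets reals.

Set Implicit Arguments.
Unset Strict Implicit.
Unset Printing Implicit Defensive.

Import Order.TTheory GRing.Theory Num.Theory.
Local Open Scope ring_scope.
Local Open Scope sesquilinear_scope.
Local Open Scope complex_scope.
Local Open Scope classical_set_scope.

Section Graphs.

(* None is the central vertex; Some (Tagged _ p) with p : 'I_(k j) is the
   vertex of the j-th ray at distance p + 1 from the central vertex. *)
Definition star_vertex (m : nat) (k : 'I_m -> nat) : finType :=
  option {j : 'I_m & 'I_(k j)}.

Definition star_edge (m : nat) (k : 'I_m -> nat) : rel (star_vertex k) :=
  fun x y =>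
    match x, y with
    | None, None => false
    | None, Some q | Some q, None => nat_of_ord (tagged q) == 0%N
    | Some p, Some q =>
        (tag p == tag q) &&
        (((tagged p).+1 == nat_of_ord (tagged q))
         || ((tagged q).+1 == nat_of_ord (tagged p)))
    end.

Definition adjacency_mx (S : nzSemiRingType) (V : finType) (e : rel V) :
    'M[S]_#|V| :=
  \matrix_(x, y) (e (enum_val x) (enum_val y))%:R.

Definition perron_frobenius (R : realType) (V : finType) (e : rel V)
    (lambda : R) : Prop :=
  eigenvalue (adjacency_mx R e) lambda
  /\ forall mu : R, eigenvalue (adjacency_mx R e) mu -> mu <= lambda.

(* sigma lists the vertices, first the r vertices of one class and then the
   s vertices of the other one. *)
Definition bipartition_mx (V : finType) (e : rel V) (r s : nat)
    (G : 'M[nat]_(r, s)) : Prop :=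
  exists sigma : 'I_(r + s) -> V,
    bijective sigma
    /\ \matrix_(x, y) (e (sigma x) (sigma y))%:R = block_mx 0 G G^T 0.

End Graphs.

Section Chebyshev.
Variable R : nzRingType.

Fixpoint Rpoly (n : nat) : {poly R} :=
  match n with
  | 0 => 1
  | n1.+1 => match n1 with
             | 0 => 'X
             | n2.+1 => 'X * Rpoly n1 - Rpoly n2
             end
  end.

End Chebyshev.

Definition star_alpha (R : realType) (m : nat) (k : 'I_m -> nat) (lambda : R)
    (j : 'I_m) : R :=
  (Rpoly R (k j).-1).[lambda] / (Rpoly R (k j)).[lambda].

Definition star_delta (R : realType) (m : nat) (k : 'I_m -> nat) (lambda : R)
    (j : 'I_m) : R :=
  1 / (Rpoly R (k j)).[lambda].

Section MultiMatrixAlgebras.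
Variable R : realType.

(* The direct sum of the full matrix algebras of sizes d i.  The summands are
   nonzero only when every d i is positive, which is required where these
   algebras are used. *)
Definition mmalg (r : nat) (d : 'I_r -> nat) : Type :=
  forall i : 'I_r, 'M[R[i]]_(d i).

Section Operations.
Variables (r : nat) (d : 'I_r -> nat).
Implicit Types x y : mmalg d.

Definition mm0 : mmalg d := fun=> 0.
Definition mm1 : mmalg d := fun=> 1%:M.
Definition mm_add x y : mmalg d := fun i => x i + y i.
Definition mm_scale (c : R[i]) x : mmalg d := fun i => c *: x i.
Definition mm_mul x y : mmalg d := fun i => x i *m y i.
Definition mm_adj x : mmalg d := fun i => (x i) ^t*.

Definition mm_positive x : Prop :=
  forall (i : 'I_r) (v : 'rV[R[i]]_(d i)), 0 <= (v *m x i *m v ^t*) 0 0.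

Definition faithful_trace (tr : mmalg d -> R[i]) : Prop :=
  [/\ (forall x y, tr (mm_add x y) = tr x + tr y),
      (forall c x, tr (mm_scale c x) = c * tr x),
      (forall x y, tr (mm_mul x y) = tr (mm_mul y x)),
      (forall x, 0 <= tr (mm_mul (mm_adj x) x))
    & (forall x, tr (mm_mul (mm_adj x) x) = 0 -> x = mm0)].

Record trace_cond_exp (tr : mmalg d -> R[i]) (S : set (mmalg d))
    (E : mmalg d -> mmalg d) : Prop := {
  cond_exp_add : forall x y, E (mm_add x y) = mm_add (E x) (E y);
  cond_exp_scale : forall c x, E (mm_scale c x) = mm_scale c (E x);
  cond_exp_in : forall x, S (E x);
  cond_exp_id : forall a, S a -> E a = a;
  cond_exp_bimod : forall a x b, S a -> S b ->
    E (mm_mul (mm_mul a x) b) = mm_mul (mm_mul a (E x)) b;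
  cond_exp_pos : forall x, mm_positive x -> mm_positive (E x);
  cond_exp_trace : forall x, tr (E x) = tr x }.

Definition commuting_square (tr : mmalg d -> R[i]) (A B C : set (mmalg d)) :
    Prop :=
  exists EA EB EC : mmalg d -> mmalg d,
    [/\ trace_cond_exp tr A EA, trace_cond_exp tr B EB,
        trace_cond_exp tr C EC
      & forall x, EA x = EB (EC x) /\ EA x = EC (EB x)].

End Operations.

Section Inclusions.
Variables (r s : nat) (a : 'I_r -> nat) (b : 'I_s -> nat).

Record unital_star_hom (phi : mmalg a -> mmalg b) : Prop := {
  hom_one : phi (@mm1 r a) = @mm1 s b;
  hom_add : forall x y, phi (mm_add x y) = mm_add (phi x) (phi y);
  hom_scale : forall c x, phi (mm_scale c x) = mm_scale c (phi x);
  hom_mul : forall x y, phi (mm_mul x y) = mm_mul (phi x) (phi y);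
  hom_adj : forall x, phi (mm_adj x) = mm_adj (phi x) }.

(* M i j is the multiplicity of the i-th summand of the source in the j-th
   summand of the target: up to a unitary, the j-th component of phi x is the
   block diagonal matrix in which each x i is repeated M i j times. *)
Definition inclusion_mx (M : 'M[nat]_(r, s)) (phi : mmalg a -> mmalg b) :
    Prop :=
  forall j : 'I_s,
    exists (e : (\sum_(i < r) \sum_(l < M i j) a i)%N = b j)
           (W : 'M[R[i]]_(b j)),
      W \is unitarymx
      /\ forall x : mmalg a,
           phi x j = W *m castmx (e, e)
                            (\mxdiag_(i < r) \mxdiag_(l < M i j) x i)
                       *m W ^t*.

Definition inclusion (M : 'M[nat]_(r, s)) (phi : mmalg a -> mmalg b) : Prop :=
  [/\ unital_star_hom phi, injective phi & inclusion_mx M phi].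

End Inclusions.

(* The square with A included in B and C by AB and AC, and B and C included in
   D by BD and CD; the algebras A, B, C are identified with their images in
   D, and the compatibility of the inclusions makes the image of A in D
   unambiguous. *)
Definition has_commuting_square (r s : nat) (G : 'M[nat]_(r, s)) (n : nat) :
    Prop :=
  exists (a d : 'I_r -> nat) (b c : 'I_s -> nat)
         (AB : mmalg a -> mmalg b) (AC : mmalg a -> mmalg c)
         (BD : mmalg b -> mmalg d) (CD : mmalg c -> mmalg d)
         (tr : mmalg d -> R[i]),
    [/\ (forall i, 0 < a i)%N /\ (forall i, 0 < d i)%N,
        (forall j, 0 < b j)%N /\ (forall j, 0 < c j)%N,
        inclusion (G *+ n) AB /\ inclusion G AC,
        inclusion G^T BD /\ inclusion (G^T *+ n) CD
      & [/\ (forall x, BD (AB x) = CD (AC x)),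
            faithful_trace tr
          & commuting_square tr (range (BD \o AB)) (range BD) (range CD)]].

Definition star_block_mx (m n : nat) (k : 'I_m -> nat) (lambda : R)
    (u : 'I_m -> 'I_m -> 'M[R[i]]_n) : 'M[R[i]]_(\sum_(i < m) n) :=
  \mxblock_(i < m, j < m)
    (if i == j then (star_delta k lambda i)%:C *: u i i
     else (Num.sqrt (star_alpha k lambda i * star_alpha k lambda j))%:C
            *: u i j).

End MultiMatrixAlgebras.

(* Main.v *)
Require Import Defs.
From HB Require Import structures.
From mathcomp Require Import all_boot all_order all_algebra.
From mathcomp Require Import complex.
From mathcomp Require Import boolp classical_sets reals.
From mathcomp Require Import zify ring lra.

Set Implicit Arguments.
Unset Strict Implicit.
Unset Printing Implicit Defensive.

Import Order.TTheory GRing.Theory Num.Theory.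
Local Open Scope ring_scope.
Local Open Scope sesquilinear_scope.
Local Open Scope complex_scope.

(** An inclusion of multi-matrix algebras is a complete orthonormal
    family of isometries between the summands (isometries, amplify).  In a
    square with A inside B and C, and B and C inside D, the inclusion of A in D
    is decomposed in two ways: along the paths through B and along the paths
    through C.  By Schur's lemma the overlaps of the two families are scalars,
    and they form, for summands i of A and l of D, a unitary with n x n blocks
    W i l j j'.  For fixed j and j' the same matrices, with i and l as block
    indices and rescaled by the weights of the trace, form a second unitary:
    this is what the equality of E_A with the product of E_B and E_C says when
    it is tested on matrix units of B and C (square_connection_col).
    Conversely such a connection W tells how to embed C in D, and the
    conditional expectations can be written down (square_of_connection).

    The trace is not prescribed, but the two unitarity conditions determine
    it.  The blocks are square, so columns are orthogonal as well as rows, and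
    comparing norms shows that the weight vectors of the trace on A and D are
    proportional (markov_ratio); by uniqueness of the Perron-Frobenius vector
    the weights are then those of that vector.  With these weights a
    connection is a biunitary, a notion symmetric in the two classes of the
    bipartition (biunitary_swap), so that the central vertex may be assumed to
    be a row.

    On a star, the blocks W c c j j' at the centre c are indexed by the rays.  For two different rays, c is the only common
    neighbour, so the second condition makes W c c j j' a unitary times
    sqrt (alpha_j alpha_j').  As the sum of the alpha_j is lambda, unitarity of
    the rows and the identity R_q^2 = 1 + R_(q-1) R_(q+1) leave a unitary times
    delta_j on the diagonal (star_of_biunitary).  Conversely, given the block
    matrix, a connection is obtained by propagating u_jj along the ray j with
    explicit real coefficients; away from the centre, the same identity makes
    the conditions hold because certain real 2 x 2 matrices are orthogonal
    (cell_row, cell_col).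

    The quotients make sense because R_q is positive at lambda for q at most
    the length of a ray: an intermediate value argument yields an eigenvalue
    of the star that is at least the largest root of R_(K+1), where K is the
    largest length (star_eigenvalue_top). *)

(** * Adjoints, traces and block rows *)

Section Adjoint.
Variable C : numClosedFieldType.

Lemma adjmxM m n p (A : 'M[C]_(m, n)) (B : 'M[C]_(n, p)) :
  (A *m B)^t* = B^t* *m A^t*.
Proof. by rewrite trmx_mul map_mxM. Qed.

Lemma adjmxD m n (A B : 'M[C]_(m, n)) : (A + B)^t* = A^t* + B^t*.
Proof. by rewrite linearD map_mxD. Qed.

Lemma adjmxZ m n (c : C) (A : 'M[C]_(m, n)) : (c *: A)^t* = c^* *: A^t*.
Proof. by rewrite linearZ map_mxZ. Qed.

Lemma adjmx0 m n : (0 : 'M[C]_(m, n))^t* = 0.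
Proof. by rewrite trmx0 map_mx0. Qed.

Lemma adjmx_scalar n (c : C) : (c%:M : 'M[C]_n)^t* = (c^*)%:M.
Proof. by rewrite tr_scalar_mx map_scalar_mx. Qed.

Lemma adjmx_sum (I : finType) (P : pred I) m n (F : I -> 'M[C]_(m, n)) :
  (\sum_(i | P i) F i)^t* = \sum_(i | P i) (F i)^t*.
Proof. by rewrite linear_sum map_mx_sum. Qed.

Lemma mxtrace_adjM m n (A : 'M[C]_(m, n)) :
  \tr (A *m A^t*) = \sum_i \sum_j `|A i j| ^+ 2.
Proof.
by apply: eq_bigr => i _; rewrite mxE; apply: eq_bigr => j _;
   rewrite !mxE normCK.
Qed.

Lemma mxtrace_adjM_ge0 m n (A : 'M[C]_(m, n)) : 0 <= \tr (A *m A^t*).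
Proof.
by rewrite mxtrace_adjM; do 2![apply: sumr_ge0 => ? _]; rewrite exprn_ge0.
Qed.

Lemma mxtrace_adjM_eq0 m n (A : 'M[C]_(m, n)) : \tr (A *m A^t*) = 0 -> A = 0.
Proof.
move=> /eqP; rewrite mxtrace_adjM psumr_eq0 => [/allP h|i _]; last first.
  by apply: sumr_ge0 => j _; rewrite exprn_ge0.
apply/matrixP => i j; rewrite mxE; have := h i (mem_index_enum _).
rewrite psumr_eq0 => [/allP/(_ j (mem_index_enum _))|? _]; last by rewrite exprn_ge0.
by rewrite sqrf_eq0 normr_eq0 => /eqP.
Qed.

End Adjoint.

(** Turns a sum over a range that depends on the multiplicity into a sum over a
    fixed range, padded with zeros. *)
Lemma big_insub_ord (V : nmodType) (p N : nat) (F : 'I_p -> V) : (p <= N)%N ->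
  \sum_(x < N) oapp F 0 (insub (val x) : option 'I_p) = \sum_(l < p) F l.
Proof.
move=> lepN; pose G m : V := oapp F 0 (insub m : option 'I_p).
rewrite -[LHS]/(\sum_(x < N) G x).
have -> : \sum_(l < p) F l = \sum_(l < p) G l.
  by apply: eq_bigr => l _; rewrite /G valK.
rewrite (big_ord_widen _ G lepN) [RHS]big_mkcond.
by apply: eq_bigr => x _; case: ifP => // h; rewrite /G insubF.
Qed.

Section BlockRows.
Variable C : numClosedFieldType.

Lemma adj_mxrow m p (p_ : 'I_p -> nat) (A : forall i, 'M[C]_(m, p_ i)) :
  (\mxrow_i A i)^t* = \mxcol_i (A i)^t*.
Proof. by apply/matrixP => i j; rewrite !mxE. Qed.

Lemma mul_mxrow_mxdiag_adj m p (p_ : 'I_p -> nat)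
    (A : forall i, 'M[C]_(m, p_ i)) (D : forall i, 'M[C]_(p_ i)) :
  (\mxrow_i A i) *m (\mxdiag_i D i) *m (\mxrow_i A i)^t* =
  \sum_i A i *m D i *m (A i)^t*.
Proof. by rewrite mul_mxrow_mxdiag adj_mxrow mul_mxrow_mxcol. Qed.

Lemma unitarymxKadj n (W : 'M[C]_n) : W \is unitarymx -> W^t* *m W = 1%:M.
Proof. by move=> /unitarymxP/mulmx1C. Qed.

(** Both sides are block matrices; compare their blocks. *)
Lemma mxrow_isometry m p (p_ : 'I_p -> nat) (A : forall i, 'M[C]_(m, p_ i)) :
  (\mxrow_i A i)^t* *m \mxrow_i A i = 1%:M ->
  (forall i, (A i)^t* *m A i = 1%:M) /\
  (forall i j, i != j -> (A i)^t* *m A j = 0).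
Proof.
rewrite adj_mxrow mul_mxcol_mxrow -mxdiagZ /mxdiag => /eq_mxblockP h.
split=> [i|i j /negbTE nij]; rewrite h ?eqxx ?conform_mx_id //.
by rewrite nij.
Qed.

Lemma castmx_unitary n n' (e : n = n') (W0 : 'M[C]_(n', n)) :
  W0 *m W0^t* = 1%:M ->
  exists W : 'M[C]_n', W \is unitarymx /\
    forall A, W *m castmx (e, e) A *m W^t* = W0 *m A *m W0^t*.
Proof.
case: n' / e W0 => W0 W0u; exists W0; split; first exact/unitarymxP.
by move=> A; rewrite castmx_id.
Qed.

End BlockRows.

(** * Inclusions as families of isometries *)

Section Isometries.
Variable R : realType.
Local Notation C := R[i].

(** A homomorphism of multi-matrix algebras is, up to the choice of
    orthonormal bases, x |-> sum V x V^*, where the V i j x map the i-th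
    summand of the source isometrically onto mutually orthogonal subspaces of
    the j-th summand of the target.  The label x counts the copies.  All labels
    range over the same type X and V i j x = 0 when E i j x fails, so that no
    index type depends on a multiplicity. *)
Record isometries (r s : nat) (a : 'I_r -> nat) (b : 'I_s -> nat) (X : finType)
    (E : 'I_r -> 'I_s -> X -> bool)
    (V : forall i j, X -> 'M[C]_(b j, a i)) : Prop := {
  iso_orth : forall i j x y,
    (V i j x)^t* *m V i j y = (E i j x && (x == y))%:R%:M;
  iso_orth0 : forall i i' j x y, i != i' -> (V i j x)^t* *m V i' j y = 0;
  iso_total : forall j, \sum_i \sum_x V i j x *m (V i j x)^t* = 1%:M }.

Definition amplify (r s : nat) (a : 'I_r -> nat) (b : 'I_s -> nat) (X : finType)
    (V : forall i j, X -> 'M[C]_(b j, a i)) (x : mmalg R a) : mmalg R b :=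
  fun j => \sum_i \sum_l V i j l *m x i *m (V i j l)^t*.

Section Multiplicity.
Variables (r s : nat) (a : 'I_r -> nat) (b : 'I_s -> nat).
Variables (E : 'I_r -> 'I_s -> bool) (N : nat).
Local Notation isometries := (@isometries r s a b 'I_N (fun i j _ => E i j)).

Variable M : 'M[nat]_(r, s).
Hypothesis ME : forall i j, M i j = (E i j * N)%N.

(** The isometries are the blocks of columns of the unitary that
    block-diagonalises the inclusion. *)
Lemma inclusion_isometries (phi : mmalg R a -> mmalg R b) : inclusion_mx M phi ->
  exists2 V, isometries V & forall x, phi x = amplify V x.
Proof.
move=> incl.
pose Q n (f : mmalg R a -> 'M[C]_n) j (V : forall i, 'I_N -> 'M[C]_(n, a i)) :=
  [/\ forall i x y, (V i x)^t* *m V i y = (E i j && (x == y))%:R%:M,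
      forall i i' x y, i != i' -> (V i x)^t* *m V i' y = 0,
      \sum_i \sum_x V i x *m (V i x)^t* = 1%:M
    & forall x, f x = \sum_i \sum_l V i l *m x i *m (V i l)^t*].
suff /fin_all_exists [V VP] : forall j, exists V, @Q (b j) (fun x => phi x j) j V.
  exists (fun i j => V j i).
    by split=> [i j x y|i i' j x y ii'|j]; case: (VP j) => // h1 h2 h3 h4; auto.
  by move=> x; apply: functional_extensionality_dep => j; case: (VP j).
move=> j; have [e [W [Wu phiE]]] := incl j.
have leMN i : (M i j <= N)%N by rewrite ME; case: (E i j); rewrite ?mul1n.
pose f x := phi x j.
have fE x : f x = _ := phiE x.
rewrite -/f; clearbody f; clear phi phiE incl.
move: (b j) e W Wu f fE => n e; case: n / e => W Wu f fE.
pose V0 i (l : 'I_(M i j)) := submxrow (submxrow W i) l.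
have WE : W = \mxrow_i \mxrow_l V0 i l.
  by rewrite -[LHS]submxrowK; apply: eq_mxrow => i; rewrite submxrowK.
(* Pad with 0: the range of the label is empty or the whole of 'I_N. *)
pose V i (x : 'I_N) := oapp (V0 i) 0 (insub (val x) : option 'I_(M i j)).
have := unitarymxKadj Wu; rewrite {1 2}WE => /mxrow_isometry[h1 h0].
have {}h1 i l : (V0 i l)^t* *m V0 i l = 1%:M /\
   (forall l', l != l' -> (V0 i l)^t* *m V0 i l' = 0).
  by have /mxrow_isometry[h2 h3] := h1 i; split=> // l'; apply: h3.
have {}h0 i i' : i != i' -> forall l l', (V0 i l)^t* *m V0 i' l' = 0.
  move=> /h0; rewrite adj_mxrow mul_mxcol_mxrow -mxblock0 => /eq_mxblockP h l l'.
  exact: h.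
have ltE i (x : 'I_N) : (x < M i j)%N = E i j.
  by rewrite ME; case: (E i j) => //; rewrite mul1n ltn_ord.
exists V; split=> [i x y|i i' x y ii'||x].
- rewrite /V; case: insubP => [l xM lx|]; last first.
    by rewrite ltE => /negbTE-> /=; rewrite adjmx0 mul0mx raddf0.
  have Eij : E i j by rewrite -(ltE i x).
  case: insubP => [l' yM ly|]; last by rewrite ltE Eij.
  rewrite Eij /= -val_eqE -lx -ly val_eqE; have [->|nll] := eqVneq l l'.
    by rewrite (h1 i l').1.
  by rewrite (h1 i l).2 // raddf0.
- rewrite /V; case: insubP => [l _ _|_] /=; last by rewrite adjmx0 mul0mx.
  by case: insubP => [l' _ _|_] /=; rewrite ?mulmx0 ?h0.
- have /unitarymxP := Wu; rewrite {1 2}WE adj_mxrow mul_mxrow_mxcol => <-.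
  apply: eq_bigr => i _; rewrite adj_mxrow mul_mxrow_mxcol.
  rewrite -(big_insub_ord _ (leMN i)); apply: eq_bigr => x _; rewrite /V.
  by case: insubP => //= _; rewrite mul0mx.
- rewrite fE castmx_id {1 2}WE mul_mxrow_mxdiag_adj.
  apply: eq_bigr => i _; rewrite mul_mxrow_mxdiag_adj.
  rewrite -(big_insub_ord _ (leMN i)); apply: eq_bigr => y _; rewrite /V.
  by case: insubP => //= _; rewrite !mul0mx.
Qed.

Lemma mxtrace_isometry V (VP : isometries V) i j x :
  \tr (V i j x *m (V i j x)^t*) = (E i j * a i)%:R.
Proof.
by rewrite mxtrace_mulC VP.(iso_orth) eqxx andbT mxtrace_scalar -mulrnA.
Qed.

(** Compare the traces of the two sides of iso_total. *)
Lemma isometries_dim V (VP : isometries V) j : (\sum_i M i j * a i = b j)%N.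
Proof.
apply/eqP; rewrite -(eqr_nat C) -(mxtrace1 C (b j)) -(VP.(iso_total) j).
rewrite natr_sum [\tr _]raddf_sum; apply/eqP/eq_bigr => i _.
rewrite raddf_sum; under eq_bigr do rewrite /= mxtrace_isometry //.
by rewrite sumr_const card_ord ME -mulrnA mulnAC.
Qed.

(** Put side by side, the isometries form a matrix with orthonormal rows,
    and it is square by isometries_dim. *)
Lemma isometries_inclusion V (VP : isometries V) (phi : mmalg R a -> mmalg R b) :
  (forall x, phi x = amplify V x) -> inclusion_mx M phi.
Proof.
move=> phiE j.
have e : (\sum_(i < r) \sum_(l < M i j) a i)%N = b j.
  rewrite -(isometries_dim VP j); apply: eq_bigr => i _.
  by rewrite sum_nat_const card_ord.
have leMN i : (M i j <= N)%N by rewrite ME; case: (E i j); rewrite ?mul1n.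
have ltE i (x : 'I_N) : (x < M i j)%N = E i j.
  by rewrite ME; case: (E i j) => //; rewrite mul1n ltn_ord.
pose W0 := \mxrow_i \mxrow_l V i j (widen_ord (leMN i) l).
have sumV (A : forall i, 'M[C]_(a i)) :
    W0 *m (\mxdiag_i \mxdiag_l A i) *m W0^t* =
    \sum_i \sum_x V i j x *m A i *m (V i j x)^t*.
  rewrite mul_mxrow_mxdiag_adj; apply: eq_bigr => i _.
  rewrite mul_mxrow_mxdiag_adj -(big_insub_ord _ (leMN i)).
  apply: eq_bigr => x _; case: insubP => [l _ lx|] /=.
    by have -> : widen_ord (leMN i) l = x by apply: val_inj.
  rewrite ltE => nE; suff -> : V i j x = 0 by rewrite !mul0mx.
  apply: mxtrace_adjM_eq0; rewrite mxtrace_isometry // (negbTE nE) mul0n //.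
have sumV1 := sumV (fun=> 1%:M).
have {}sumV1 : W0 *m W0^t* = 1%:M.
  rewrite -(VP.(iso_total) j).
  transitivity (W0 *m \mxdiag_i \mxdiag_(l < M i j) (1%:M : 'M[C]_(a i)) *m W0^t*).
    under eq_mxdiag do rewrite mxdiagZ.
    by rewrite mxdiagZ mulmx1.
  rewrite sumV1; apply: eq_bigr => i _; apply: eq_bigr => x _.
  by rewrite mulmx1.
have [W [Wu WE]] := castmx_unitary e sumV1.
by exists e, W; split=> // x; rewrite phiE WE sumV.
Qed.
End Multiplicity.
End Isometries.

(** * Amplifications and their conditional expectations *)

Section Amplify.
Variable R : realType.
Local Notation C := R[i].

Lemma mm_ext (r : nat) (d : 'I_r -> nat) (x y : mmalg R d) :
  (forall i, x i = y i) -> x = y.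
Proof. exact: functional_extensionality_dep. Qed.

Section Properties.
Variables (r s : nat) (a : 'I_r -> nat) (b : 'I_s -> nat) (X : finType).
Variable E : 'I_r -> 'I_s -> X -> bool.
Variable V : forall i j, X -> 'M[C]_(b j, a i).
Hypothesis VP : isometries E V.

Lemma isometry_eq0 i j x : ~~ E i j x -> V i j x = 0.
Proof.
move=> nE; apply: mxtrace_adjM_eq0.
by rewrite mxtrace_mulC VP.(iso_orth) (negbTE nE) raddf0 raddf0.
Qed.

(** By orthogonality only the term with the indices i and x survives. *)
Lemma iso_amplify i j x (y : mmalg R a) :
  (V i j x)^t* *m amplify V y j = y i *m (V i j x)^t*.
Proof.
rewrite /amplify mulmx_sumr (bigD1 i) //= [X in _ + X]big1 => [|i' ii']; last first.
  rewrite mulmx_sumr big1 // => z _; rewrite !mulmxA VP.(iso_orth0) ?mul0mx //.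
  by rewrite eq_sym.
rewrite addr0 mulmx_sumr (bigD1 x) //= [X in _ + X]big1 => [|z zx]; last first.
  by rewrite !mulmxA VP.(iso_orth) eq_sym (negbTE zx) andbF raddf0 !mul0mx.
rewrite addr0 !mulmxA VP.(iso_orth) eqxx andbT.
have [_|/isometry_eq0->] := boolP (E i j x); last by rewrite adjmx0 !mulmx0.
by rewrite mul1mx.
Qed.

Lemma amplify_adj y : amplify V (mm_adj y) = mm_adj (amplify V y).
Proof.
apply: mm_ext => j; rewrite /amplify /mm_adj adjmx_sum; apply: eq_bigr => i _.
by rewrite adjmx_sum; apply: eq_bigr => x _; rewrite !adjmxM trmxCK mulmxA.
Qed.

Lemma amplify_iso i j x (y : mmalg R a) :
  amplify V y j *m V i j x = V i j x *m y i.
Proof.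
have := congr1 (fun M => M^t*) (iso_amplify i j x (mm_adj y)).
by rewrite !adjmxM amplify_adj /mm_adj !trmxCK.
Qed.

Lemma amplify1 : amplify V (@mm1 R r a) = @mm1 R s b.
Proof.
apply: mm_ext => j; rewrite /amplify /mm1 -(VP.(iso_total) j).
by do 2![apply: eq_bigr => ? _]; rewrite mulmx1.
Qed.

Lemma amplifyD x y : amplify V (mm_add x y) = mm_add (amplify V x) (amplify V y).
Proof.
apply: mm_ext => j; rewrite /amplify /mm_add -big_split; apply: eq_bigr => i _ /=.
by rewrite -big_split; apply: eq_bigr => z _ /=; rewrite mulmxDr mulmxDl.
Qed.

Lemma amplifyZ c x : amplify V (mm_scale c x) = mm_scale c (amplify V x).
Proof.
apply: mm_ext => j; rewrite /amplify /mm_scale scaler_sumr; apply: eq_bigr => i _ /=.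
by rewrite scaler_sumr; apply: eq_bigr => z _ /=; rewrite -scalemxAr -scalemxAl.
Qed.

Lemma amplifyM x y : amplify V (mm_mul x y) = mm_mul (amplify V x) (amplify V y).
Proof.
apply: mm_ext => j; rewrite /mm_mul [amplify V x j]/amplify mulmx_suml.
apply: eq_bigr => i _; rewrite mulmx_suml; apply: eq_bigr => z _.
by rewrite -!mulmxA iso_amplify.
Qed.

Lemma amplify_hom : unital_star_hom (amplify V).
Proof.
split; [exact: amplify1|exact: amplifyD|exact: amplifyZ|exact: amplifyM|].
exact: amplify_adj.
Qed.

(** x i can be read off from any copy of the i-th summand. *)
Lemma amplify_inj : (forall i, exists j, exists x, E i j x) ->
  injective (amplify V).
Proof.
move=> covered x y xy; apply: mm_ext => i; have [j [z Eijz]] := covered i.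
have h u : u i = (V i j z)^t* *m amplify V u j *m V i j z.
  by rewrite iso_amplify -mulmxA VP.(iso_orth) Eijz eqxx mulmx1.
by rewrite (h x) (h y) xy.
Qed.

Lemma mm_positive_amplify x : mm_positive x -> mm_positive (amplify V x).
Proof.
move=> xP j v; rewrite /amplify mulmx_sumr mulmx_suml summxE sumr_ge0 // => i _.
rewrite mulmx_sumr mulmx_suml summxE sumr_ge0 // => z _.
have := xP i (v *m V i j z).
by rewrite adjmxM !mulmxA.
Qed.

Variable t : 'I_s -> C.
Hypothesis t_gt0 : forall j, 0 < t j.

(** Every trace has this form; w is called its weight vector below. *)
Definition wtrace r0 (d : 'I_r0 -> nat) (w : 'I_r0 -> C) (x : mmalg R d) : C :=
  \sum_i w i * \tr (x i).

(** The weight vector of the restriction of the trace to the image of the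
    source. *)
Definition pull_weight i := \sum_j \sum_x (E i j x)%:R * t j.

(** The average, with the weights of the trace, of the compressions of x to
    the copies of the i-th summand of the source. *)
Definition cond_exp_coef (x : mmalg R b) : mmalg R a :=
  fun i => (pull_weight i)^-1 *:
    \sum_j \sum_z t j *: ((V i j z)^t* *m x j *m V i j z).

Definition cond_exp x := amplify V (cond_exp_coef x).

Hypothesis covered : forall i, exists j, exists x, E i j x.

Lemma pull_weight_gt0 i : 0 < pull_weight i.
Proof.
have [j [x Eijx]] := covered i.
rewrite /pull_weight (bigD1 j) //= (bigD1 x) //= Eijx mul1r.
rewrite -addrA ltr_pwDl ?t_gt0 // addr_ge0 //; repeat (apply: sumr_ge0 => ? _);
  by rewrite mulr_ge0 ?ler0n // ltW.
Qed.

Lemma cond_exp_amplify y : cond_exp (amplify V y) = amplify V y.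
Proof.
congr amplify; apply: mm_ext => i; rewrite /cond_exp_coef.
have -> : \sum_j \sum_z t j *: ((V i j z)^t* *m amplify V y j *m V i j z) =
   pull_weight i *: y i.
  rewrite scaler_suml; apply: eq_bigr => j _; rewrite scaler_suml.
  apply: eq_bigr => z _; rewrite iso_amplify -mulmxA VP.(iso_orth) eqxx andbT.
  by rewrite mul_mx_scalar scalerA mulrC.
by rewrite scalerA mulVf ?scale1r // gt_eqF ?pull_weight_gt0.
Qed.

Lemma wtrace_amplifyM (x : mmalg R a) (y : mmalg R b) :
  wtrace t (mm_mul (amplify V x) y) =
  \sum_i \sum_j \sum_z t j * \tr (x i *m ((V i j z)^t* *m y j *m V i j z)).
Proof.
rewrite exchange_big; apply: eq_bigr => j _; rewrite /mm_mul /amplify mulmx_suml.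
rewrite raddf_sum mulr_sumr; apply: eq_bigr => i _ /=.
rewrite mulmx_suml raddf_sum mulr_sumr; apply: eq_bigr => z _ /=.
by rewrite -!mulmxA mxtrace_mulC !mulmxA.
Qed.

Lemma wtrace_cond_exp x : wtrace t (cond_exp x) = wtrace t x.
Proof.
have mm1r (d : mmalg R b) : mm_mul d (@mm1 R s b) = d.
  by apply: mm_ext => i; rewrite /mm_mul mulmx1.
rewrite -[cond_exp x]mm1r wtrace_amplifyM.
rewrite /wtrace.
have -> : \sum_i t i * \tr (x i) = \sum_i \sum_j \sum_z t j *
    \tr ((V i j z)^t* *m x j *m V i j z).
  rewrite exchange_big; apply: eq_bigr => j _ /=.
  rewrite -[in LHS](mulmx1 (x j)) -(VP.(iso_total) j) mulmx_sumr raddf_sum mulr_sumr.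
  apply: eq_bigr => i _ /=; rewrite mulmx_sumr raddf_sum mulr_sumr.
  by apply: eq_bigr => z _ /=; rewrite mulmxA mxtrace_mulC mulmxA.
apply: eq_bigr => i _.
transitivity (\sum_j \sum_z ((E i j z)%:R * t j) * \tr (cond_exp_coef x i)).
  do 2![apply: eq_bigr => ? _]; rewrite /mm1 mulmx1 VP.(iso_orth) eqxx andbT.
  by rewrite mul_mx_scalar mxtraceZ; ring.
under eq_bigr do rewrite -mulr_suml.
rewrite -mulr_suml -/(pull_weight i) mxtraceZ mulrA divff ?mul1r; last first.
  by rewrite gt_eqF ?pull_weight_gt0.
rewrite raddf_sum; apply: eq_bigr => j _; rewrite raddf_sum; apply: eq_bigr => z _.
by rewrite /= mxtraceZ.
Qed.

Lemma trace_cond_expP : trace_cond_exp (wtrace t) (range (amplify V)) cond_exp.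
Proof.
split=> [x y|c x|x|_ [y _ <-]|_ x _ [y _ <-] [z _ <-]|x xP|x].
- rewrite /cond_exp -amplifyD; congr amplify; apply: mm_ext => i.
  rewrite /mm_add /cond_exp_coef -scalerDr -big_split; congr (_ *: _).
  apply: eq_bigr => j _; rewrite -big_split; apply: eq_bigr => z _ /=.
  by rewrite mulmxDr mulmxDl scalerDr.
- rewrite /cond_exp -amplifyZ; congr amplify; apply: mm_ext => i.
  rewrite /mm_scale /cond_exp_coef scalerA mulrC -scalerA; congr (_ *: _); rewrite scaler_sumr.
  apply: eq_bigr => j _; rewrite scaler_sumr; apply: eq_bigr => z _ /=.
  by rewrite -scalemxAr -scalemxAl !scalerA mulrC.
- by exists (cond_exp_coef x).
- exact: cond_exp_amplify.
- rewrite /cond_exp -!amplifyM; congr amplify; apply: mm_ext => i.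
  rewrite /mm_mul /cond_exp_coef -scalemxAr -scalemxAl; congr (_ *: _).
  rewrite [in RHS]mulmx_sumr [in RHS]mulmx_suml; apply: eq_bigr => j _.
  rewrite [in RHS]mulmx_sumr [in RHS]mulmx_suml; apply: eq_bigr => u _.
  rewrite -scalemxAr -scalemxAl; congr (_ *: _).
  by rewrite !mulmxA iso_amplify -!mulmxA amplify_iso.
- apply: mm_positive_amplify => i v; rewrite /cond_exp_coef.
  rewrite -scalemxAr -scalemxAl mxE mulr_ge0 //.
    by rewrite invr_ge0 ltW ?pull_weight_gt0.
  rewrite mulmx_sumr mulmx_suml summxE sumr_ge0 // => j _.
  rewrite mulmx_sumr mulmx_suml summxE sumr_ge0 // => z _.
  rewrite -scalemxAr -scalemxAl mxE mulr_ge0 //; first exact: ltW.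
  have := xP j (v *m (V i j z)^t*).
  by rewrite adjmxM trmxCK !mulmxA.
- exact: wtrace_cond_exp.
Qed.

End Properties.
End Amplify.

(** * Towers of two inclusions *)

Section Composition.
Variable R : realType.
Local Notation C := R[i].
Variables (r s q : nat) (a : 'I_r -> nat) (b : 'I_s -> nat) (d : 'I_q -> nat).
Variables (X Y : finType).
Variables (E : 'I_r -> 'I_s -> X -> bool) (F : 'I_s -> 'I_q -> Y -> bool).
Variables (V : forall i j, X -> 'M[C]_(b j, a i)).
Variables (W : forall j l, Y -> 'M[C]_(d l, b j)).
Hypothesis VP : isometries E V.
Hypothesis WP : isometries F W.

(** The labels of a composite inclusion are paths: the middle summand and one
    label for each step. *)
Definition comp_isometries i l (p : 'I_s * X * Y) : 'M[C]_(d l, a i) :=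
  W p.1.1 l p.2 *m V i p.1.1 p.1.2.

Definition comp_label i l (p : 'I_s * X * Y) : bool :=
  E i p.1.1 p.1.2 && F p.1.1 l p.2.

Lemma big_triple (T : nmodType) (f : 'I_s -> X -> Y -> T) :
  \sum_(p : 'I_s * X * Y) f p.1.1 p.1.2 p.2 = \sum_j \sum_x \sum_y f j x y.
Proof.
rewrite -(pair_big xpredT xpredT (fun p y => f p.1 p.2 y)) /=.
by rewrite -(pair_big xpredT xpredT (fun j x => \sum_y f j x y)).
Qed.

Lemma comp_isometriesP : isometries comp_label comp_isometries.
Proof.
split=> [i l [[j x] y] [[j' x'] y']|i i' l [[j x] y] [[j' x'] y'] ii'|l].
- rewrite /comp_isometries /comp_label /= adjmxM mulmxA -[_ *m W j' l y']mulmxA.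
  have [jj'|jj'] := eqVneq j j'; last first.
    rewrite WP.(iso_orth0) // mulmx0 mul0mx.
    by rewrite -[_ == _]/((j == j') && _ && _) (negbTE jj') andbF raddf0.
  subst j'; rewrite WP.(iso_orth) mul_mx_scalar -scalemxAl VP.(iso_orth).
  rewrite scale_scalar_mx -natrM mulnb.
  rewrite -[(_, _, _) == _]/((j == j) && (x == x') && (y == y')) eqxx andTb.
  by congr ((nat_of_bool _)%:R%:M); do 2!case: eqP; rewrite ?andbT ?andbF // andbC.
- rewrite /comp_isometries /= adjmxM mulmxA -[_ *m W j' l y']mulmxA.
  have [jj'|jj'] := eqVneq j j'; last by rewrite WP.(iso_orth0) // mulmx0 mul0mx.
  subst j'; rewrite WP.(iso_orth) mul_mx_scalar -scalemxAl.
  by rewrite VP.(iso_orth0) // scaler0.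
- rewrite -(WP.(iso_total) l).
  under eq_bigr do rewrite (big_triple (fun j x y =>
     W j l y *m V _ j x *m (W j l y *m V _ j x)^t*)).
  rewrite exchange_big; apply: eq_bigr => j _ /=.
  transitivity (\sum_i \sum_y \sum_x
     W j l y *m V i j x *m (W j l y *m V i j x)^t*).
    by apply: eq_bigr => i _; rewrite exchange_big.
  rewrite exchange_big; apply: eq_bigr => y _ /=.
  rewrite -[X in X *m _](mulmx1 (W j l y)) -(VP.(iso_total) j).
  rewrite mulmx_sumr mulmx_suml; apply: eq_bigr => i _.
  rewrite mulmx_sumr mulmx_suml; apply: eq_bigr => x _.
  by rewrite adjmxM !mulmxA.
Qed.

Lemma amplify_comp x : amplify W (amplify V x) = amplify comp_isometries x.
Proof.
apply: mm_ext => l; rewrite {1 3}/amplify.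
under [RHS]eq_bigr do rewrite (big_triple (fun j z y =>
     W j l y *m V _ j z *m x _ *m (W j l y *m V _ j z)^t*)).
rewrite [RHS]exchange_big; apply: eq_bigr => j _ /=.
transitivity (\sum_i \sum_y \sum_z
     W j l y *m V i j z *m x i *m (W j l y *m V i j z)^t*); last first.
  by apply: eq_bigr => i _; rewrite exchange_big.
rewrite [RHS]exchange_big; apply: eq_bigr => y _ /=.
rewrite /amplify mulmx_sumr mulmx_suml. apply: eq_bigr => i _.
rewrite mulmx_sumr mulmx_suml; apply: eq_bigr => z _.
by rewrite adjmxM !mulmxA.
Qed.

Lemma pull_weight_comp (t : 'I_q -> C) i :
  pull_weight comp_label t i = pull_weight E (pull_weight F t) i.
Proof.
rewrite /pull_weight.
under eq_bigr do rewrite (big_triple (fun j x y => (E i j x && F j _ y)%:R * t _)).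
rewrite exchange_big; apply: eq_bigr => j _ /=.
rewrite exchange_big; apply: eq_bigr => x _ /=.
rewrite mulr_sumr; apply: eq_bigr => l _; rewrite mulr_sumr; apply: eq_bigr => y _.
by rewrite -mulnb natrM mulrA.
Qed.

(** The middle weights cancel against the normalisation of the first
    averaging. *)
Lemma cond_exp_coef_comp (t : 'I_q -> C) (x : mmalg R d) :
  (forall j, pull_weight F t j != 0) ->
  cond_exp_coef comp_label comp_isometries t x =
  cond_exp_coef E V (pull_weight F t) (cond_exp_coef F W t x).
Proof.
move=> pw0; apply: mm_ext => i; rewrite /cond_exp_coef pull_weight_comp; congr (_ *: _).
under eq_bigr do rewrite (big_triple (fun j z y =>
  t _ *: ((W j _ y *m V i j z)^t* *m x _ *m (W j _ y *m V i j z)))).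
rewrite exchange_big; apply: eq_bigr => j _ /=.
rewrite exchange_big; apply: eq_bigr => z _ /=.
rewrite -scalemxAr -scalemxAl scalerA divff // scale1r.
rewrite mulmx_sumr mulmx_suml; apply: eq_bigr => l _.
rewrite mulmx_sumr mulmx_suml; apply: eq_bigr => y _.
by rewrite -scalemxAr -scalemxAl adjmxM !mulmxA.
Qed.

End Composition.

(** * Faithful traces *)

Section Traces.
Variable R : realType.
Local Notation C := R[i].
Variables (r : nat) (d : 'I_r -> nat).
Hypothesis d_gt0 : forall i, (0 < d i)%N.
Implicit Types x y : mmalg R d.

(** The indices p and q are natural numbers, so that one formula makes sense
    in all the summands. *)
Definition mm_unit (i : 'I_r) (p q : nat) : mmalg R d := fun j =>
  \matrix_(u, v) [&& j == i, val u == p & val v == q]%:R.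

Lemma mm_unitM i p q q' p' : (q < d i)%N ->
  mm_mul (mm_unit i p q) (mm_unit i q' p') = mm_scale (q == q')%:R (mm_unit i p p').
Proof.
move=> ltq; apply: mm_ext => j; apply/matrixP => u v; rewrite !mxE.
have [ji|ji] := eqVneq j i; last first.
  by rewrite mulr0 big1 // => w _; rewrite !mxE (negbTE ji) mul0r.
subst j; rewrite (bigD1 (Ordinal ltq)) //= big1 ?addr0; last first.
  move=> w wq; rewrite !mxE eqxx /= [val w == q](negbTE wq) andbF mul0r //.
by rewrite !mxE !eqxx /= andbT -!natrM !mulnb; congr ((nat_of_bool _)%:R);
  do 3!case: (_ == _).
Qed.

Lemma mm_unit_adj i p q : mm_adj (mm_unit i p q) = mm_unit i q p.
Proof.
apply: mm_ext => j; apply/matrixP => u v; rewrite !mxE conjC_nat.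
by congr ((nat_of_bool _)%:R); do 3!case: (_ == _).
Qed.

Lemma trace_sum (tr : mmalg R d -> C) :
  (forall x y, tr (mm_add x y) = tr x + tr y) ->
  (forall c x, tr (mm_scale c x) = c * tr x) ->
  forall (I : Type) (l : seq I) (F : I -> mmalg R d),
  tr (fun k => \sum_(i <- l) F i k) = \sum_(i <- l) tr (F i).
Proof.
move=> trD trZ I l F; elim: l => [|i l IH].
  rewrite big_nil -[RHS](mul0r (tr (@mm0 R r d))) -trZ; congr tr.
  by apply: mm_ext => k; rewrite big_nil /mm_scale /= scale0r.
by rewrite big_cons -IH -trD; congr tr; apply: mm_ext => k; rewrite big_cons.
Qed.

(** In each summand the trace vanishes on off-diagonal matrix units, as
    these are commutators, and takes one value on all the diagonal ones. *)
Lemma faithful_trace_weights (tr : mmalg R d -> C) : faithful_trace tr ->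
  exists2 t : 'I_r -> R, (forall i, 0 < t i) &
    forall x, tr x = wtrace (fun i => (t i)%:C) x.
Proof.
case=> trD trZ trC tr_ge0 tr_eq0.
pose t i := tr (mm_unit i 0 0).
have t_gt0 i : 0 < t i.
  have tE : t i = tr (mm_mul (mm_adj (mm_unit i 0 0)) (mm_unit i 0 0)).
    rewrite mm_unit_adj mm_unitM // eqxx /t; congr tr; apply: mm_ext => k.
    by rewrite /mm_scale scale1r.
  rewrite lt_def tE tr_ge0 andbT; apply/eqP => /tr_eq0.
  move=> /(congr1 (fun x : mmalg R d => x i (Ordinal (d_gt0 i)) (Ordinal (d_gt0 i)))).
  by rewrite !mxE !eqxx => /eqP; rewrite oner_eq0.
have tC i : t i = (complex.Re (t i))%:C by rewrite RRe_real // gtr0_real.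
exists (fun i => complex.Re (t i)) => [i|x].
  by have := t_gt0 i; rewrite {1}tC ltcR.
under [RHS]eq_bigr do rewrite -tC.
have tr_unit i (p q : 'I_(d i)) : tr (mm_unit i p q) = (p == q)%:R * t i.
  have -> : mm_unit i p q = mm_mul (mm_unit i p 0) (mm_unit i 0 q).
    by rewrite mm_unitM //; apply: mm_ext => k; rewrite /mm_scale scale1r.
  by rewrite trC mm_unitM // trZ eq_sym.
have -> : tr x = tr (fun k => \sum_i \sum_p \sum_q (mm_scale (x i p q) (mm_unit i p q)) k).
  congr tr; apply: mm_ext => k.
  rewrite (bigD1 k) //= [X in _ + X]big1 => [|i ik]; last first.
    rewrite big1 // => p _; rewrite big1 // => q _; apply/matrixP => u' v'.
    by rewrite !mxE eq_sym (negbTE ik) mulr0.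
  rewrite addr0 [LHS]matrix_sum_delta; do 2![apply: eq_bigr => ? _].
  by congr (_ *: _); apply/matrixP => u v; rewrite !mxE eqxx.
rewrite (trace_sum trD trZ); apply: eq_bigr => i _.
rewrite (trace_sum trD trZ).
transitivity (\sum_p t i * x i p p).
  apply: eq_bigr => p _; rewrite (trace_sum trD trZ) (bigD1 p) //= big1.
    by rewrite addr0 trZ tr_unit eqxx mul1r mulrC.
  by move=> q qp; rewrite trZ tr_unit eq_sym (negbTE qp) mul0r mulr0.
by rewrite -mulr_sumr.
Qed.

Variable t : 'I_r -> C.
Hypothesis t_gt0 : forall i, 0 < t i.

Lemma wtraceD x y : wtrace t (mm_add x y) = wtrace t x + wtrace t y.
Proof.
by rewrite /wtrace -big_split; apply: eq_bigr => i _; rewrite /= mxtraceD mulrDr.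
Qed.

Lemma wtraceZ c x : wtrace t (mm_scale c x) = c * wtrace t x.
Proof.
by rewrite /wtrace mulr_sumr; apply: eq_bigr => i _; rewrite mxtraceZ mulrCA.
Qed.

Lemma wtraceC x y : wtrace t (mm_mul x y) = wtrace t (mm_mul y x).
Proof. by apply: eq_bigr => i _; rewrite mxtrace_mulC. Qed.

Lemma mxtrace_adjMl_ge0 m n (A : 'M[C]_(m, n)) : 0 <= \tr (A^t* *m A).
Proof. by rewrite mxtrace_mulC mxtrace_adjM_ge0. Qed.

Lemma wtrace_eq0 x : wtrace t (mm_mul (mm_adj x) x) = 0 -> x = @mm0 R r d.
Proof.
move=> /eqP; rewrite psumr_eq0 => [/allP h|i _]; last first.
  by rewrite mulr_ge0 ?mxtrace_adjMl_ge0 // ltW.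
apply: mm_ext => i; have := h i (mem_index_enum _); rewrite mulf_eq0 gt_eqF //=.
by rewrite mxtrace_mulC => /eqP/mxtrace_adjM_eq0.
Qed.

Lemma wtrace_faithful : faithful_trace (wtrace (d := d) t).
Proof.
split; [exact: wtraceD|exact: wtraceZ|exact: wtraceC| |exact: wtrace_eq0].
by move=> x; apply: sumr_ge0 => i _; rewrite mulr_ge0 ?mxtrace_adjMl_ge0 // ltW.
Qed.

End Traces.

Section ConditionalExpectations.
Variable R : realType.
Local Notation C := R[i].
Variables (r : nat) (d : 'I_r -> nat) (t : 'I_r -> C).
Hypothesis t_gt0 : forall i, 0 < t i.
Implicit Types x y : mmalg R d.
Local Notation tr := (wtrace (d := d) t).
Local Notation "1" := (@mm1 R r d).

Lemma mm_mul1 x : mm_mul x 1 = x.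
Proof. by apply: mm_ext => i; rewrite /mm_mul mulmx1. Qed.

(** A conditional expectation is determined by its traces against its range;
    this identity is how the conditional expectations of an arbitrary
    commuting square are accessed. *)
Lemma trace_cond_expM S E x y : trace_cond_exp tr S E -> S 1 -> S x ->
  tr (mm_mul x (E y)) = tr (mm_mul x y).
Proof.
move=> EP S1 Sx; have := EP.(cond_exp_bimod) y Sx S1.
by rewrite !mm_mul1 => <-; rewrite EP.(cond_exp_trace).
Qed.

Lemma cond_exp_selfadj S E x y : trace_cond_exp tr S E -> S 1 ->
  tr (mm_mul (E x) y) = tr (mm_mul x (E y)).
Proof.
move=> EP S1; have inS z := EP.(cond_exp_in) z.
by rewrite -(trace_cond_expM _ EP) // wtraceC (trace_cond_expM _ EP) // wtraceC.
Qed.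

Lemma wtrace_nondegenerate x y :
  (forall z, tr (mm_mul z x) = tr (mm_mul z y)) -> x = y.
Proof.
move=> h; pose w := mm_add x (mm_scale (-1) y).
have /wtrace_eq0 : tr (mm_mul (mm_adj w) w) = 0.
  have -> : mm_mul (mm_adj w) w =
    mm_add (mm_mul (mm_adj w) x) (mm_scale (-1) (mm_mul (mm_adj w) y)).
    by apply: mm_ext => i; rewrite /mm_mul /w /mm_add /mm_scale mulmxDr scalemxAr.
  by rewrite wtraceD wtraceZ h mulN1r subrr.
move=> /(_ t_gt0) w0; apply: mm_ext => i; have := congr1 (fun v : mmalg R d => v i) w0.
by rewrite /w /mm_add /mm_scale /mm0 scaleN1r => /eqP; rewrite subr_eq0 => /eqP.
Qed.

(** The three maps are self-adjoint for the inner product of the trace, so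
    taking adjoints reverses the product. *)
Lemma cond_exp_commute A B D EA EB ED :
  trace_cond_exp tr A EA -> trace_cond_exp tr B EB -> trace_cond_exp tr D ED ->
  A 1 -> B 1 -> D 1 ->
  (forall x, EA x = EB (ED x)) -> forall x, EA x = ED (EB x).
Proof.
move=> EAP EBP EDP A1 B1 D1 h x; apply: wtrace_nondegenerate => z.
rewrite -(cond_exp_selfadj _ _ EAP) // h (cond_exp_selfadj _ _ EBP) //.
by rewrite (cond_exp_selfadj _ _ EDP).
Qed.

End ConditionalExpectations.

(** * Overlaps of two decompositions of one homomorphism *)

Section Intertwiners.
Variable R : realType.
Local Notation C := R[i].

Lemma comm_delta_scalar n (M : 'M[C]_n) :
  (forall p q, delta_mx p q *m M = M *m delta_mx p q) -> M = (\tr M / n%:R)%:M.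
Proof.
move=> comm.
have Mpq p q : M p q = (M p p) *+ (p == q).
  have := congr1 (fun N : 'M_n => N p q) (comm p p).
  rewrite !mxE (bigD1 p) //= big1 ?addr0; last first.
    by move=> k kp; rewrite !mxE eqxx /= (negbTE kp) mul0r.
  rewrite (bigD1 p) //= big1 ?addr0; last first.
    by move=> k kp; rewrite !mxE (negbTE kp) mulr0.
  rewrite !mxE !eqxx /= mul1r => ->; rewrite eq_sym.
  by case: eqP => _; rewrite ?mulr1 ?mulr0.
have Mpp p q : M p p = M q q.
  have := congr1 (fun N : 'M_n => N p q) (comm p q).
  rewrite !mxE (bigD1 q) //= big1 ?addr0; last first.
    by move=> k kp; rewrite !mxE (negbTE kp) andbF mul0r.
  rewrite (bigD1 p) //= big1 ?addr0; last first.
    by move=> k kp; rewrite !mxE (negbTE kp) mulr0.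
  by rewrite !mxE !eqxx /= mul1r mulr1 => ->.
apply/matrixP => p q; rewrite Mpq [RHS]mxE; congr (_ *+ _).
rewrite /mxtrace; under eq_bigr do rewrite (Mpp _ p).
rewrite sumr_const card_ord -[M p p *+ n]mulr_natr mulfK // pnatr_eq0.
by case: n p {M comm Mpq Mpp q} => // -[].
Qed.

Variables (r s : nat) (a : 'I_r -> nat) (d : 'I_s -> nat) (X Y : finType).
Variables (E : 'I_r -> 'I_s -> X -> bool) (F : 'I_r -> 'I_s -> Y -> bool).
Variables (P : forall i j, X -> 'M[C]_(d j, a i)).
Variables (Q : forall i j, Y -> 'M[C]_(d j, a i)).
Hypotheses (PP : isometries E P) (QP : isometries F Q).
Hypothesis PQ : forall x : mmalg R a, amplify P x = amplify Q x.
Hypothesis a_gt0 : forall i, (0 < a i)%N.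

(** The normalised trace extracts the scalar of overlapE. *)
Definition overlap i l x y : C := \tr ((P i l x)^t* *m Q i l y) / (a i)%:R.

Lemma intertwine i i' l x y (z : mmalg R a) :
  z i *m ((P i l x)^t* *m Q i' l y) = ((P i l x)^t* *m Q i' l y) *m z i'.
Proof.
by rewrite mulmxA -(iso_amplify PP) PQ -!mulmxA (amplify_iso QP).
Qed.

Lemma overlap0 i i' l x y : i != i' -> (P i l x)^t* *m Q i' l y = 0.
Proof.
move=> ii'; have := intertwine i i' l x y (fun k => (k == i)%:R%:M).
by rewrite eqxx mul1mx eq_sym (negbTE ii') raddf0 mulmx0.
Qed.

(** Both families decompose the same homomorphism, so the product commutes
    with the full matrix algebra of the i-th summand. *)
Lemma overlapE i l x y : (P i l x)^t* *m Q i l y = (overlap i l x y)%:M.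
Proof.
apply: comm_delta_scalar => p q.
have := intertwine i i l x y (mm_unit R a i p q).
have -> // : mm_unit R a i p q i = delta_mx p q.
by apply/matrixP => u v; rewrite !mxE eqxx.
Qed.

Lemma overlapEC i l x y : (Q i l y)^t* *m P i l x = ((overlap i l x y)^*)%:M.
Proof. by rewrite -adjmx_scalar -overlapE adjmxM trmxCK. Qed.

Lemma overlap_supp i l x y : overlap i l x y != 0 -> E i l x && F i l y.
Proof.
apply: contraNT; rewrite negb_and => /orP[] h; rewrite /overlap.
  by rewrite (isometry_eq0 PP h) adjmx0 mul0mx raddf0 mul0r.
by rewrite (isometry_eq0 QP h) mulmx0 raddf0 mul0r.
Qed.

Lemma scalar_inj i : injective (@scalar_mx C (a i)).
Proof.
move=> u v /(congr1 (fun M : 'M_(a i) => M (Ordinal (a_gt0 i)) (Ordinal (a_gt0 i)))).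
by rewrite !mxE eqxx.
Qed.

(** Insert the resolution of the identity given by Q between P^* and P. *)
Lemma overlap_unitary i l x x' :
  \sum_y overlap i l x y * (overlap i l x' y)^* = (E i l x && (x == x'))%:R.
Proof.
apply: (@scalar_inj i); rewrite -(PP.(iso_orth)) raddf_sum.
rewrite -[(P i l x)^t*](mulmx1) -(QP.(iso_total) l).
rewrite mulmx_sumr mulmx_suml (bigD1 i) //= [X in _ = _ + X]big1 => [|i' ii']; last first.
  rewrite mulmx_sumr mulmx_suml big1 // => y _.
  by rewrite !mulmxA overlap0 ?mul0mx // eq_sym.
rewrite addr0 mulmx_sumr mulmx_suml; apply: eq_bigr => y _.
by rewrite mulmxA overlapE -mulmxA overlapEC -scalar_mxM.
Qed.

End Intertwiners.

(** * From a commuting square to a connection *)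

(** W i l j j' is the n x n matrix of the overlaps between the paths
    i - j - l through B and the paths i - j' - l through C, where i, l index
    the summands of A and D, and j, j' those of B and C.  conn_row says that,
    for fixed i and l, these overlaps form a unitary change of basis.  In
    conn_col the roles are exchanged: j and j' are fixed while i and l vary;
    this is the commuting square condition, which involves the weight vectors
    of the trace on the four algebras. *)
Record connection (R : realType) (n : nat) (I J : finType) (e : I -> J -> bool)
    (tA : I -> R) (tB tC : J -> R) (tD : I -> R)
    (W : I -> I -> J -> J -> 'M[R[i]]_n) : Prop := {
  conn_supp : forall i l j j', W i l j j' != 0 ->
    [&& e i j, e l j, e i j' & e l j'];
  conn_row : forall i l j j1,
    \sum_j' W i l j j' *m (W i l j1 j')^t* = [&& j == j1, e i j & e l j]%:R%:M;
  conn_col : forall j j' i i1,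
    \sum_l (tD l)%:C *: (W i l j j' *m (W i1 l j j')^t*) =
    ([&& i == i1, e i j & e i j']%:R * (tB j * tC j' / tA i)%:C)%:M }.

(** Trace of a product of two corners, once the two inner products of paths
    have been replaced by scalars. *)
Lemma mxtrace_scalar_cycle (C : comNzRingType) (m p q : nat) (A : 'M[C]_(m, p))
    (g : 'M_(p, q)) (B : 'M_(q, m)) (B' : 'M_(m, q)) (g' : 'M_(q, p))
    (A' : 'M_(p, m)) (u v : C) :
  B *m B' = u%:M -> A' *m A = v%:M ->
  \tr (A *m g *m B *m (B' *m g' *m A')) = u * (v * \tr (g *m g')).
Proof.
move=> BB AA; rewrite mulmxA mxtrace_mulC !mulmxA AA -!mulmxA [B *m _]mulmxA BB.
by rewrite mul_scalar_mx mul_scalar_mx -scalemxAr !mxtraceZ; ring.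
Qed.

Lemma mxtrace_rot (C : comNzRingType) (m p q : nat) (A : 'M[C]_(m, p))
    (g : 'M_(p, q)) (z : 'M_q) (B : 'M_(q, m)) :
  \tr (A *m g *m (z *m B)) = \tr (g *m z *m (B *m A)).
Proof. by rewrite -mulmxA mxtrace_mulC !mulmxA. Qed.

Lemma mxtrace_delta (C : comNzRingType) n (p : 'I_n) :
  \tr (delta_mx p p : 'M[C]_n) = 1.
Proof.
rewrite /mxtrace (bigD1 p) //= big1 ?addr0 ?mxE ?eqxx // => q qp.
by rewrite mxE (negbTE qp).
Qed.

Lemma indicator_sum_gt0 (R : realType) (I : finType) (P : pred I) (t : I -> R) :
  (forall i, 0 < t i) -> (exists i, P i) -> 0 < \sum_i (P i)%:R * t i.
Proof.
move=> t_gt0 [x Px]; rewrite (bigD1 x) //= Px mul1r ltr_wpDr // sumr_ge0 // => i _.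
by rewrite mulr_ge0 ?ler0n // ltW.
Qed.

Lemma realC_sum (R : realType) (I : finType) (F : I -> R) :
  (\sum_i F i)%:C = \sum_i (F i)%:C.
Proof. by rewrite rmorph_sum. Qed.

Lemma realC_frac (R : realType) (u v w : R) :
  (u * v / w)%:C = u%:C * v%:C / w%:C.
Proof. by rewrite !rmorphM fmorphV. Qed.

Lemma multiplicities (r s n : nat) (e : 'I_r -> 'I_s -> bool)
    (G : 'M[nat]_(r, s)) : (forall i j, G i j = e i j) ->
  [/\ forall i j, (G *+ n) i j = (e i j * n)%N,
      forall i j, G i j = (e i j * 1)%N,
      forall j i, G^T j i = (e i j * 1)%N
    & forall j i, (G^T *+ n) j i = (e i j * n)%N].
Proof.
move=> GE; have nE (p q : nat) : (p *+ q = p * q)%N.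
  by elim: q => [|q IH]; rewrite ?muln0 // mulrS IH mulnS.
by split=> x y; rewrite ?mulmxnE ?mxE GE ?nE ?muln1.
Qed.

Section SquareToConnection.
Variable R : realType.
Local Notation C := R[i].
Variables (r s n : nat) (e : 'I_r -> 'I_s -> bool).
Variables (a d : 'I_r -> nat) (b c : 'I_s -> nat).
Hypothesis a_gt0 : forall i, (0 < a i)%N.
Variables (VAB : forall i j, 'I_n -> 'M[C]_(b j, a i)).
Variables (VAC : forall i j, 'I_1 -> 'M[C]_(c j, a i)).
Variables (VBD : forall j l, 'I_1 -> 'M[C]_(d l, b j)).
Variables (VCD : forall j l, 'I_n -> 'M[C]_(d l, c j)).
Hypothesis VABP : isometries (fun i j _ => e i j) VAB.
Hypothesis VACP : isometries (fun i j _ => e i j) VAC.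
Hypothesis VBDP : isometries (fun j l _ => e l j) VBD.
Hypothesis VCDP : isometries (fun j l _ => e l j) VCD.
Let P := comp_isometries VAB VBD.
Let Q := comp_isometries VAC VCD.
Hypothesis PQ : forall x : mmalg R a, amplify P x = amplify Q x.
Let PP := comp_isometriesP VABP VBDP : isometries _ P.
Let QP := comp_isometriesP VACP VCDP : isometries _ Q.

Definition square_connection i l j j' : 'M[C]_n :=
  \matrix_(x, y) overlap P Q i l (j, x, ord0) (j', ord0, y).
Local Notation W := square_connection.

Lemma square_connection_supp i l j j' :
  W i l j j' != 0 -> [&& e i j, e l j, e i j' & e l j'].
Proof.
apply: contraNT => nE; apply/eqP/matrixP => x y; rewrite !mxE.
apply/eqP; apply: contraNT nE => /(overlap_supp PP QP).
by rewrite /comp_label /= -andbA.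
Qed.

Lemma square_connection_row i l j j1 :
  \sum_j' W i l j j' *m (W i l j1 j')^t* = [&& j == j1, e i j & e l j]%:R%:M.
Proof.
apply/matrixP => x x'; rewrite summxE.
under eq_bigr => j' _ do [rewrite mxE; under eq_bigr do rewrite !mxE].
transitivity (\sum_(p : 'I_s * 'I_1 * 'I_n) overlap P Q i l (j, x, ord0) p *
    (overlap P Q i l (j1, x', ord0) p)^*).
  pose f j' o y := overlap P Q i l (j, x, ord0) (j', o, y) *
    (overlap P Q i l (j1, x', ord0) (j', o, y))^*.
  rewrite [RHS](eq_bigr (fun p => f p.1.1 p.1.2 p.2)) => [|[[]]//].
  by rewrite big_triple; apply: eq_bigr => j' _; rewrite big_ord1.
rewrite (overlap_unitary PP QP PQ) // mxE /comp_label /=.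
rewrite -[(_, _, _) == _]/((j == j1) && (x == x') && true).
by case: (j == j1); case: (x == x'); case: (e i j); case: (e l j).
Qed.

Variables (t : 'I_r -> R) (EA EB EC : mmalg R d -> mmalg R d).
Hypothesis t_gt0 : forall i, 0 < t i.
Let tr := wtrace (d := d) (fun i => (t i)%:C).
Hypothesis EAP : trace_cond_exp tr (range (amplify P)) EA.
Hypothesis EBP : trace_cond_exp tr (range (amplify VBD)) EB.
Hypothesis ECP : trace_cond_exp tr (range (amplify VCD)) EC.

Hypothesis EABC : forall x, EA x = EB (EC x).
Hypothesis nbr_col : forall j, exists i, e i j.

(** On C the map EC is the identity, hence EA = EB there.  Only this
    consequence of the commuting square condition is needed. *)
Lemma cond_exp_square x y :
  tr (mm_mul (amplify VBD x) (amplify VCD y)) =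
  tr (mm_mul (amplify VBD x) (EA (amplify VCD y))).
Proof.
have B1 : range (amplify VBD) (@mm1 R r d).
  by exists (@mm1 R s b) => //; rewrite (amplify1 VBDP).
have Bx : range (amplify VBD) (amplify VBD x) by exists x.
rewrite EABC ECP.(cond_exp_id); last by exists y.
by rewrite /tr (trace_cond_expM _ EBP).
Qed.

(** Generalised matrix units of B, and of C just below: they map the copy of
    the i'-th summand of A labelled x' to the copy of the i-th one labelled
    x. *)
Definition cornerB i i' j x x' (g : 'M[C]_(a i, a i')) : mmalg R b :=
  fun j1 => (j1 == j)%:R *: (VAB i j1 x *m g *m (VAB i' j1 x')^t*).

Definition cornerC i i' j (g : 'M[C]_(a i, a i')) : mmalg R c :=
  fun j1 => (j1 == j)%:R *: (VAC i j1 ord0 *m g *m (VAC i' j1 ord0)^t*).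

Lemma amplify_cornerB i i' j x x' g l :
  amplify VBD (cornerB j x x' g) l =
  P i l (j, x, ord0) *m g *m (P i' l (j, x', ord0))^t*.
Proof.
rewrite /amplify (bigD1 j) //= [X in _ + X]big1 ?addr0 => [|j1 jj1].
  by rewrite big_ord1 /cornerB eqxx scale1r /P /comp_isometries /= adjmxM !mulmxA.
rewrite big1 // => o _.
by rewrite /cornerB (negbTE jj1) scale0r mulmx0 mul0mx.
Qed.

Lemma amplify_cornerC i i' j g l :
  amplify VCD (cornerC j g) l =
  \sum_y Q i l (j, ord0, y) *m g *m (Q i' l (j, ord0, y))^t*.
Proof.
rewrite /amplify (bigD1 j) //= [X in _ + X]big1 ?addr0 => [|j1 jj1].
  apply: eq_bigr => y _.
  by rewrite /cornerC eqxx scale1r /Q /comp_isometries /= adjmxM !mulmxA.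
rewrite big1 // => o _.
by rewrite /cornerC (negbTE jj1) scale0r mulmx0 mul0mx.
Qed.

(** This trace sees both the element of B and the element of C through paths,
    so it only depends on the overlaps. *)
Lemma trace_corners i i' j j' x x' (g : 'M[C]_(a i, a i')) g' :
  tr (mm_mul (amplify VBD (cornerB j x x' g)) (amplify VCD (cornerC j' g'))) =
  (\sum_l (t l)%:C *: (W i' l j j' *m (W i l j j')^t*)) x' x * \tr (g *m g').
Proof.
rewrite /tr /wtrace summxE mulr_suml; apply: eq_bigr => l _.
rewrite mxE -mulrA; congr (_ * _).
rewrite /mm_mul amplify_cornerB amplify_cornerC mulmx_sumr raddf_sum mxE mulr_suml.
apply: eq_bigr => y _ /=; rewrite !mxE.
rewrite -mulrA.
exact: mxtrace_scalar_cycle (overlapE PP QP PQ _ _ _ _) (overlapEC PP QP PQ _ _ _ _).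
Qed.

Lemma trace_cornerB_amplify i i' j x x' (g : 'M[C]_(a i, a i')) z :
  tr (mm_mul (amplify VBD (cornerB j x x' g)) (amplify P z)) =
  \sum_l (t l)%:C * \tr (g *m z i' *m ((P i' l (j, x', ord0))^t* *m P i l (j, x, ord0))).
Proof.
rewrite /tr /wtrace; apply: eq_bigr => l _; rewrite /mm_mul amplify_cornerB.
congr (_ * _); rewrite -(mulmxA _ _ (amplify P z l)) (iso_amplify PP).
exact: mxtrace_rot.
Qed.

Let tB j := \sum_l (e l j)%:R * t l.
Let tC j := n%:R * tB j.
Let tA i := \sum_j (e i j)%:R * tC j.

Let tA_gt0 i j : (0 < n)%N -> e i j -> 0 < tA i.
Proof.
move=> n_gt0 eij; apply: indicator_sum_gt0; last by exists j.
by move=> j1; rewrite mulr_gt0 ?ltr0n // indicator_sum_gt0.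
Qed.

Lemma trace_cornerC_amplify i j (z : mmalg R a) :
  tr (mm_mul (amplify VCD (cornerC j (1%:M : 'M[C]_(a i)))) (amplify P z)) =
  (e i j)%:R * (tC j)%:C * \tr (z i).
Proof.
rewrite /tr /wtrace /tC /tB mulr_sumr realC_sum.
(* A trace unfolds to a sum: hide it before distributing. *)
have [tz tzE] : exists tz, tz = \tr (z i) by eexists.
rewrite -tzE [in RHS]mulr_sumr mulr_suml.
apply: eq_bigr => l _; rewrite /mm_mul amplify_cornerC PQ mulmx_suml raddf_sum /=.
transitivity ((t l)%:C * \sum_(y < n) ((e i j && e l j)%:R * tz)).
  congr (_ * _); apply: eq_bigr => y _; rewrite mulmx1 -(mulmxA _ _ (amplify Q z l)).
  rewrite (iso_amplify QP) mxtrace_mulC -(mulmxA (z i)) QP.(iso_orth).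
  by rewrite eqxx andbT mul_mx_scalar mxtraceZ tzE.
rewrite sumr_const card_ord -mulr_natl !rmorphM !rmorph_nat -mulnb natrM.
ring.
Qed.

Lemma trace_amplify_amplify (w z : mmalg R a) :
  tr (mm_mul (amplify P w) (amplify P z)) = \sum_i (tA i)%:C * \tr (w i *m z i).
Proof.
rewrite /tr (wtrace_amplifyM P); apply: eq_bigr => i _.
transitivity (\sum_l \sum_p (t l)%:C * ((comp_label (fun i j (_ : 'I_n) => e i j)
    (fun j l (_ : 'I_1) => e l j) i l p)%:R * \tr (w i *m z i))).
  do 2![apply: eq_bigr => ? _].
  rewrite (iso_amplify PP) -(mulmxA (z i)) PP.(iso_orth) eqxx andbT.
  by rewrite mul_mx_scalar -scalemxAr mxtraceZ.
transitivity (\sum_l \sum_j \sum_(x < n) (t l)%:C * ((e i j && e l j)%:R * \tr (w i *m z i))).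
  apply: eq_bigr => l _.
  rewrite (big_triple (fun j (x : 'I_n) (y : 'I_1) =>
    (t l)%:C * ((e i j && e l j)%:R * \tr (w i *m z i)))).
  by do 2![apply: eq_bigr => ? _]; rewrite big_ord1.
have [tz tzE] : exists tz, tz = \tr (w i *m z i) by eexists.
rewrite -tzE exchange_big /tA realC_sum mulr_suml; apply: eq_bigr => j _ /=.
rewrite /tC /tB !mulr_sumr realC_sum mulr_suml; apply: eq_bigr => l _ /=.
rewrite sumr_const card_ord -mulr_natl !rmorphM !rmorph_nat -mulnb natrM.
ring.
Qed.

(** Test cond_exp_square on corners.  When i != i' the right-hand side
    vanishes, because EA takes its values in A.  When i = i' it only involves
    the trace of the i-th component of the value of EA, which is found by
    testing EA against the i-th central projection w of A. *)
Lemma square_connection_col j j' i i' :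
  \sum_l (t l)%:C *: (W i l j j' *m (W i' l j j')^t*) =
  ([&& i == i', e i j & e i j']%:R * (tB j * tC j' / tA i)%:C)%:M.
Proof.
apply/matrixP => x x'.
have [ii'|ii'] := eqVneq i i'; last first.
  rewrite mxE mul0r mul0rn.
  have := trace_corners j j' x' x (delta_mx (Ordinal (a_gt0 i')) (Ordinal (a_gt0 i)))
    (delta_mx (Ordinal (a_gt0 i)) (Ordinal (a_gt0 i'))).
  rewrite mul_delta_mx mxtrace_delta mulr1 => <-.
  rewrite cond_exp_square; set y := amplify VCD _.
  have [z _ <-] := EAP.(cond_exp_in) y.
  rewrite trace_cornerB_amplify big1 // => l _.
  by rewrite PP.(iso_orth0) // mulmx0 raddf0 mulr0.
subst i'.
have := trace_corners j j' x' x (1%:M : 'M_(a i)) 1%:M.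
rewrite cond_exp_square; set y := amplify VCD _.
have [z _ zE] := EAP.(cond_exp_in) y; rewrite -zE trace_cornerB_amplify.
pose w : mmalg R a := fun k => (k == i)%:R%:M.
have A1 : range (amplify P) (@mm1 R r d).
  by exists (@mm1 R r a) => //; rewrite (amplify1 PP).
have Aw : range (amplify P) (amplify P w) by exists w.
have := trace_cond_expM y EAP A1 Aw; rewrite -zE => zy.
have {zy} : (tA i)%:C * \tr (z i) = (e i j')%:R * (tC j')%:C * (a i)%:R.
  have := trace_amplify_amplify w z; rewrite /tr zy wtraceC -/tr trace_cornerC_amplify.
  rewrite (bigD1 i) //= big1 ?addr0 => [|k ki]; last first.
    by rewrite /w (negbTE ki) raddf0 mul0mx raddf0 mulr0.
  by rewrite /w eqxx mxtrace1 mul1mx => <-.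
have -> : \sum_l (t l)%:C * \tr (1%:M *m z i *m
    ((P i l (j, x, ord0))^t* *m P i l (j, x', ord0))) =
    (x == x')%:R * (e i j)%:R * (tB j)%:C * \tr (z i).
  have [tz tzE] : exists tz, tz = \tr (z i) by eexists.
  rewrite -tzE /tB realC_sum mulr_sumr mulr_suml; apply: eq_bigr => l _ /=.
  rewrite PP.(iso_orth) mul1mx mul_mx_scalar mxtraceZ -tzE /comp_label /=.
  rewrite -[(_, _, _) == _]/((j == j) && (x == x') && true) eqxx andbT /=.
  by rewrite -!mulnb !natrM rmorphM rmorph_nat; ring.
rewrite mul1mx mxtrace1 => trz trE.
have a_neq0 : (a i)%:R != 0 :> C by rewrite pnatr_eq0 -lt0n.
apply: (mulIf a_neq0); rewrite -trE mxE andTb.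
case: (x == x'); last by rewrite /= !mulr0n !mul0r.
have [eij|_] := boolP (e i j); last by rewrite /= !(mulr0n, mulr0, mul0r, mul0rn).
have n_gt0 : (0 < n)%N := leq_ltn_trans (leq0n x) (ltn_ord x).
have tA_neq0 : (tA i)%:C != 0 by rewrite gt_eqF // ltcR (tA_gt0 n_gt0 eij).
apply: (mulfI tA_neq0); rewrite !mulr1n !mul1r mulrCA trz realC_frac.
by field.
Qed.

Lemma square_connectionP : connection e tA tB tC t square_connection.
Proof.
split; [exact: square_connection_supp|exact: square_connection_row|].
exact: square_connection_col.
Qed.

End SquareToConnection.

Section ExtractConnection.
Variable R : realType.

(** The weights on B of a trace with weights t on D. *)
Definition edge_sum (r s : nat) (e : 'I_r -> 'I_s -> bool) (t : 'I_r -> R) j :=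
  \sum_l (e l j)%:R * t l.

(** The weights on B, C and A are those of the restrictions of the trace,
    computed from the inclusion matrices G^T, nG^T and G. *)
Lemma connection_of_square (r s n : nat) (e : 'I_r -> 'I_s -> bool)
    (G : 'M[nat]_(r, s)) :
  (forall i j, G i j = e i j) -> (forall j, exists i, e i j) ->
  has_commuting_square R G n ->
  exists (t : 'I_r -> R) W, (forall i, 0 < t i) /\
    connection e (fun i => \sum_j (e i j)%:R * (n%:R * edge_sum e t j))
      (edge_sum e t) (fun j => n%:R * edge_sum e t j) t (W : _ -> _ -> _ -> _ -> 'M_n).
Proof.
move=> GE nbr_col [a [d [b [c [AB [AC [BD [CD [tr [[a_gt0 d_gt0] _ [iAB iAC] [iBD iCD]]]]]]]]]]].
case=> comm tr_faithful [EA [EB [EC [EAP EBP ECP EE]]]].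
have [t t_gt0 trE] := faithful_trace_weights d_gt0 tr_faithful.
have {trE tr_faithful} trE : tr = wtrace (fun i => (t i)%:C) by apply/funext.
subst tr.
have [GnE G1E GTE GTnE] := multiplicities n GE.
have [_ _ /(inclusion_isometries GnE)[VAB VABP ABE]] := iAB.
have [_ _ /(inclusion_isometries G1E)[VAC VACP ACE]] := iAC.
have [_ _ /(inclusion_isometries GTE)[VBD VBDP BDE]] := iBD.
have [_ _ /(inclusion_isometries GTnE)[VCD VCDP CDE]] := iCD.
have PQ x : amplify (comp_isometries VAB VBD) x = amplify (comp_isometries VAC VCD) x.
  by rewrite -!amplify_comp -ABE -BDE -ACE -CDE.
have fA : BD \o AB = amplify (comp_isometries VAB VBD).
  by apply/funext => x; rewrite /= -amplify_comp -ABE -BDE.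
have fB : BD = amplify VBD by apply/funext => x.
have fC : CD = amplify VCD by apply/funext => x.
rewrite fA in EAP; rewrite fB in EBP; rewrite fC in ECP.
exists t, (square_connection VAB VAC VBD VCD); split=> //.
apply: square_connectionP EAP EBP ECP _ nbr_col => // x.
by case: (EE x).
Qed.
End ExtractConnection.

(** * Unitary and partially unitary block matrices *)

Section BlockUnitary.
Variable C : numClosedFieldType.
Variables (p n : nat).
Implicit Types Y : 'I_p -> 'I_p -> 'M[C]_n.

Lemma mxblock_unitaryP Y : (\mxblock_(i, j) Y i j \is unitarymx) <->
  (forall i j, \sum_k Y i k *m (Y j k)^t* = (i == j)%:R%:M).
Proof.
have adjY : (\mxblock_(i, j) Y i j)^t* = \mxblock_(i, j) (Y j i)^t*.
  by apply/matrixP => i j; rewrite !mxE.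
have oneE : 1%:M = \mxblock_(i < p, j < p) ((i == j)%:R%:M : 'M[C]_n).
  rewrite -(mxdiagZ 1) /mxdiag; apply/eq_mxblockP => i j.
  by case: (i == j); rewrite ?conform_mx_id // raddf0.
split=> [/unitarymxP|h].
  by rewrite adjY mul_mxblock oneE => /eq_mxblockP.
apply/unitarymxP; rewrite adjY mul_mxblock oneE; apply/eq_mxblockP => i j.
exact: h.
Qed.

Lemma block_unitary_adj Y :
  (forall i j, \sum_k Y i k *m (Y j k)^t* = (i == j)%:R%:M) ->
  forall i j, \sum_k (Y k i)^t* *m Y k j = (i == j)%:R%:M.
Proof.
move=> /mxblock_unitaryP; rewrite -trmxC_unitary.
have -> : (\mxblock_(i, j) Y i j)^t* = \mxblock_(i, j) (Y j i)^t*.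
  by apply/matrixP => i j; rewrite !mxE.
move=> /mxblock_unitaryP h i j; rewrite -h.
by apply: eq_bigr => k _; rewrite trmxCK.
Qed.

(** Adding the identity on the complement of S makes Y unitary, and the
    adjoint of a square unitary is also a left inverse. *)
Lemma partial_unitary_adj Y (S : pred 'I_p) :
  (forall i j, Y i j != 0 -> S i && S j) ->
  (forall i j, \sum_k Y i k *m (Y j k)^t* = ((i == j) && S i)%:R%:M) ->
  forall i j, \sum_k (Y k i)^t* *m Y k j = ((i == j) && S i)%:R%:M.
Proof.
move=> supp rows.
have Y0 i j : ~~ (S i && S j) -> Y i j = 0.
  by move=> nS; apply/eqP; apply: contraNT nS; apply: supp.
pose D i j : 'M[C]_n := ((i == j) && ~~ S i)%:R%:M.
have Dadj i j : (D i j)^t* = D j i.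
  rewrite /D adjmx_scalar conjC_nat eq_sym; congr (_%:R%:M).
  by case: eqVneq => [->|].
have DD i j : \sum_k D i k *m D k j = D i j.
  rewrite (bigD1 i) //= big1 ?addr0 => [|k ki]; last first.
    by rewrite /D [i == k]eq_sym (negbTE ki) raddf0 mul0mx.
  rewrite /D eqxx -scalar_mxM -natrM mulnb.
  by congr (_%:R%:M); case: eqP => [->|]; case: (S _).
have YD i j k : Y i k *m D k j = 0.
  rewrite /D; case: eqVneq => [->|_]; last by rewrite raddf0 mulmx0.
  have [Sj|nSj] := boolP (S j); first by rewrite raddf0 mulmx0.
  by rewrite Y0 ?mul0mx // negb_and nSj orbT.
have DY i j k : D i k *m Y k j = 0.
  rewrite /D; case: eqVneq => [->|_]; last by rewrite raddf0 mul0mx.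
  have [Sk|nSk] := boolP (S k); first by rewrite raddf0 mul0mx.
  by rewrite Y0 ?mulmx0 // negb_and nSk.
have sumDS i j : ((i == j) && S i)%:R%:M + D i j = (i == j)%:R%:M :> 'M[C]_n.
  by rewrite /D; case: (i == j); case: (S i); rewrite ?raddf0 ?addr0 ?add0r.
pose Z i j := Y i j + D i j.
have ZZ : forall i j, \sum_k Z i k *m (Z j k)^t* = (i == j)%:R%:M.
  move=> i j; rewrite -sumDS -rows -DD -big_split; apply: eq_bigr => k _ /=.
  rewrite /Z adjmxD mulmxDl !mulmxDr Dadj YD addr0; congr (_ + _).
  by rewrite -[Y j k]trmxCK trmxCK -Dadj -adjmxM YD adjmx0 add0r.
have /block_unitary_adj := ZZ => ZZ' i j.
have := ZZ' i j; rewrite -(sumDS i j) -[in X in _ = X -> _]DD => h.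
apply: (addIr (\sum_k D i k *m D k j)); rewrite -h -big_split.
apply: eq_bigr => k _ /=.
rewrite /Z adjmxD mulmxDl !mulmxDr Dadj DY add0r; congr (_ + _).
by rewrite -[D k j]Dadj -adjmxM DY adjmx0 addr0.
Qed.
End BlockUnitary.

(** * From a connection to a commuting square *)

(** The sum only depends on the orthonormal family P through its span. *)
Lemma change_frame (C : numClosedFieldType) (I J : finType) (E : pred I) m k
    (w : I -> J -> C) (P : I -> 'M[C]_(m, k)) (z : 'M_k) :
  (forall p p1, \sum_q w p q * (w p1 q)^* = (E p && (p == p1))%:R) ->
  (forall p, ~~ E p -> P p = 0) ->
  \sum_q (\sum_p w p q *: P p) *m z *m (\sum_p w p q *: P p)^t* =
  \sum_p P p *m z *m (P p)^t*.
Proof.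
move=> wE P0.
transitivity (\sum_p \sum_p1 (\sum_q w p q * (w p1 q)^*) *: (P p *m z *m (P p1)^t*)).
  under [RHS]eq_bigr do under eq_bigr do rewrite scaler_suml.
  under [RHS]eq_bigr do rewrite exchange_big.
  rewrite [RHS]exchange_big; apply: eq_bigr => q _ /=.
  rewrite adjmx_sum !mulmx_suml; apply: eq_bigr => p _.
  rewrite mulmx_sumr; apply: eq_bigr => p1 _.
  by rewrite adjmxZ -scalemxAr -!scalemxAl scalerA mulrC.
apply: eq_bigr => p _; rewrite (bigD1 p) //= [X in _ + X]big1 => [|p1 pp1]; last first.
  by rewrite wE eq_sym (negbTE pp1) andbF scale0r.
rewrite addr0 wE eqxx andbT; have [_|/P0->] := boolP (E p); first by rewrite scale1r.
by rewrite !mul0mx scaler0.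
Qed.

Lemma mulmx_regroup (C : pzSemiRingType) m p q m' p' (A : 'M[C]_(m, p))
    (B : 'M_(p, q)) (y : 'M_q) (B' : 'M_(q, p')) (A' : 'M_(p', m')) :
  A *m (B *m y *m B') *m A' = A *m B *m y *m (B' *m A').
Proof. by rewrite !mulmxA. Qed.

Section ConnectionToSquare.
Variable R : realType.
Local Notation C := R[i].

(** The block diagonal inclusion. *)
Lemma standard_isometries (r s : nat) (a : 'I_r -> nat)
    (E : 'I_r -> 'I_s -> bool) (N : nat) :
  exists (b : 'I_s -> nat) (V : forall i j, 'I_N -> 'M[C]_(b j, a i)),
    isometries (fun i j _ => E i j) V.
Proof.
pose M : 'M[nat]_(r, s) := \matrix_(i, j) (E i j * N)%N.
pose b j := (\sum_(i < r) \sum_(l < M i j) a i)%N.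
pose phi (x : mmalg R a) : mmalg R b := fun j => \mxdiag_i \mxdiag_(l < M i j) x i.
have ME i j : M i j = (E i j * N)%N by rewrite mxE.
have [|V VP _] := inclusion_isometries ME (phi := phi); last by exists b, V.
move=> j; exists erefl, 1%:M; split; last first.
  by move=> x; rewrite castmx_id mul1mx adjmx_scalar conjC1 mulmx1.
by apply/unitarymxP; rewrite adjmx_scalar conjC1 mulmx1.
Qed.

Variables (r s n : nat) (e : 'I_r -> 'I_s -> bool).
Variables (a d : 'I_r -> nat) (b c : 'I_s -> nat).
Variables (VAB : forall i j, 'I_n -> 'M[C]_(b j, a i)).
Variables (VAC : forall i j, 'I_1 -> 'M[C]_(c j, a i)).
Variables (VBD : forall j l, 'I_1 -> 'M[C]_(d l, b j)).
Hypothesis VABP : isometries (fun i j _ => e i j) VAB.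
Hypothesis VACP : isometries (fun i j _ => e i j) VAC.
Hypothesis VBDP : isometries (fun j l _ => e l j) VBD.
Variables (tA : 'I_r -> R) (tB tC : 'I_s -> R) (t : 'I_r -> R).
Variable W : 'I_r -> 'I_r -> 'I_s -> 'I_s -> 'M[C]_n.
Hypothesis WP : connection e tA tB tC t W.

Definition pathB i l j x : 'M[C]_(d l, a i) := VBD j l ord0 *m VAB i j x.
Local Notation P := pathB.

(** The paths through C are not given: they are defined by their coordinates
    W in the basis of the paths through B. *)
Definition pathC i l j' y : 'M[C]_(d l, a i) :=
  \sum_(p : 'I_s * 'I_n) W i l p.1 j' p.2 y *: P i l p.1 p.2.
Local Notation Q := pathC.

(** An isometry from C to D is known as soon as its composites with the
    isometries from A to C are, and these have to be the paths pathC. *)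
Definition isoCD j' l (y : 'I_n) : 'M[C]_(d l, c j') :=
  \sum_i Q i l j' y *m (VAC i j' ord0)^t*.
Local Notation VCD := isoCD.

Lemma W_eq0 i l j j' : ~~ [&& e i j, e l j, e i j' & e l j'] -> W i l j j' = 0.
Proof. by move=> h; apply/eqP; apply: contraNT h; apply: WP.(conn_supp). Qed.

Lemma pathB_orth i l j x j1 x1 :
  (P i l j x)^t* *m P i l j1 x1 = [&& j == j1, x == x1, e i j & e l j]%:R%:M.
Proof.
have := (comp_isometriesP VABP VBDP).(iso_orth) i l (j, x, ord0) (j1, x1, ord0).
rewrite /comp_isometries /comp_label /= => ->.
rewrite -[(_, _, _) == _]/((j == j1) && (x == x1) && true).
by case: (j == j1); case: (x == x1); case: (e i j); case: (e l j).
Qed.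

Lemma pathB_orth0 i i1 l j x j1 x1 : i != i1 ->
  (P i l j x)^t* *m P i1 l j1 x1 = 0.
Proof.
exact: (comp_isometriesP VABP VBDP).(iso_orth0) i i1 l (j, x, ord0) (j1, x1, ord0).
Qed.

Lemma pathB_total l (z : mmalg R a) :
  \sum_i \sum_j \sum_x P i l j x *m z i *m (P i l j x)^t* =
  amplify VBD (amplify VAB z) l.
Proof.
rewrite amplify_comp; apply: eq_bigr => i _.
rewrite (big_triple (fun j x y =>
  VBD j l y *m VAB i j x *m z i *m (VBD j l y *m VAB i j x)^t*)).
by do 2![apply: eq_bigr => ? _]; rewrite big_ord1.
Qed.

Lemma pathB_pathC i l j x j' y :
  (P i l j x)^t* *m Q i l j' y = (W i l j j' x y)%:M.
Proof.
rewrite /pathC mulmx_sumr (bigD1 (j, x)) //= [X in _ + X]big1; last first.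
  move=> [j1 x1]; rewrite eq_sym => /negbTE h; rewrite -scalemxAr pathB_orth andbA.
  by rewrite -[(j == j1) && (x == x1)]/((j, x) == (j1, x1)) h raddf0 scaler0.
rewrite addr0 -scalemxAr pathB_orth !eqxx /= scale_scalar_mx.
have [_|h] := boolP (e i j && e l j); first by rewrite mulr1.
rewrite mulr0 W_eq0 ?mxE //.
by apply: contraNN h => /and4P[-> ->].
Qed.

Lemma pathB_pathC0 i i1 l j x j' y : i != i1 -> (P i l j x)^t* *m Q i1 l j' y = 0.
Proof.
move=> ii1; rewrite /pathC mulmx_sumr big1 // => p _.
by rewrite -scalemxAr pathB_orth0 // scaler0.
Qed.

Lemma conn_row_adj i l j' j1 :
  \sum_j (W i l j j')^t* *m W i l j j1 = [&& j' == j1, e i j' & e l j']%:R%:M.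
Proof.
apply: (partial_unitary_adj (S := fun j => e i j && e l j)) => [j k|j k].
  by move=> /(WP.(conn_supp)) /and4P[-> -> -> ->].
exact: WP.(conn_row).
Qed.

Lemma pathC_orth i l j y j1 y1 :
  (Q i l j y)^t* *m Q i l j1 y1 = [&& j == j1, y == y1, e i j & e l j]%:R%:M.
Proof.
transitivity (((\sum_k (W i l k j)^t* *m W i l k j1) y y1)%:M : 'M[C]_(a i)).
  rewrite summxE.
  under [in RHS]eq_bigr do rewrite mxE.
  rewrite pair_big [RHS]raddf_sum {1}/pathC adjmx_sum (mulmx_suml (R := C)).
  apply: eq_bigr => p _ /=.
  by rewrite adjmxZ -scalemxAl pathB_pathC scale_scalar_mx !mxE.
rewrite conn_row_adj mxE; congr (_%:M).
by case: (j == j1); case: (y == y1); case: (e i j); case: (e l j).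
Qed.

Lemma pathC_orth0 i i1 l j y j1 y1 : i != i1 -> (Q i l j y)^t* *m Q i1 l j1 y1 = 0.
Proof.
move=> ii1; rewrite {1}/pathC adjmx_sum (mulmx_suml (R := C)) big1 // => p _.
by rewrite adjmxZ -scalemxAl pathB_pathC0 // scaler0.
Qed.

(** Unitarity of W: the paths through C form another orthonormal frame of the
    same space. *)
Lemma pathC_total l (z : mmalg R a) :
  \sum_i \sum_j \sum_y Q i l j y *m z i *m (Q i l j y)^t* =
  amplify VBD (amplify VAB z) l.
Proof.
rewrite -pathB_total; apply: eq_bigr => i _; rewrite !pair_big /=.
apply: (change_frame (E := fun p => e i p.1 && e l p.1)) => [p p1|p h].
  have := congr1 (fun M : 'M_n => M p.2 p1.2) (WP.(conn_row) i l p.1 p1.1).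
  rewrite summxE; under eq_bigr do rewrite mxE.
  rewrite pair_big /= => h; rewrite -[RHS]/((_ && _)%:R : C).
  transitivity (([&& p.1 == p1.1, e i p.1 & e l p.1]%:R%:M : 'M[C]_n) p.2 p1.2).
    by rewrite -h; apply: eq_bigr => q _; rewrite !mxE.
  rewrite mxE -[p == p1]/((p.1 == p1.1) && (p.2 == p1.2)).
  by case: (p.1 == p1.1); case: (p.2 == p1.2); case: (e i _); case: (e l _).
apply: mxtrace_adjM_eq0; rewrite mxtrace_mulC pathB_orth.
by rewrite (negbTE h) !andbF !raddf0.
Qed.

Lemma pathC_eq0 i l j y : ~~ (e i j && e l j) -> Q i l j y = 0.
Proof.
move=> h; apply: mxtrace_adjM_eq0; rewrite mxtrace_mulC pathC_orth.
by rewrite (negbTE h) !andbF !raddf0.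
Qed.

Lemma VAC_eq0 i j : ~~ e i j -> VAC i j ord0 = 0.
Proof. exact: (isometry_eq0 VACP). Qed.

Lemma isoCD_AC i l j y : VCD j l y *m VAC i j ord0 = Q i l j y.
Proof.
rewrite /isoCD mulmx_suml (bigD1 i) //= [X in _ + X]big1 => [|i1 ii1]; last first.
  by rewrite -mulmxA VACP.(iso_orth0) ?mulmx0.
rewrite addr0 -mulmxA VACP.(iso_orth) eqxx andbT.
have [_|h] := boolP (e i j); first by rewrite mulmx1.
by rewrite pathC_eq0 ?mul0mx // negb_and h.
Qed.

Lemma pathB_isoCD i l j x j' y :
  (P i l j x)^t* *m VCD j' l y = W i l j j' x y *: (VAC i j' ord0)^t*.
Proof.
rewrite /isoCD mulmx_sumr (bigD1 i) //= [X in _ + X]big1 => [|i1 ii1]; last first.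
  by rewrite mulmxA pathB_pathC0 ?mul0mx // eq_sym.
by rewrite addr0 mulmxA pathB_pathC mul_scalar_mx.
Qed.

Lemma isoCDP : isometries (fun j l _ => e l j) VCD.
Proof.
have adjV j l y : (VCD j l y)^t* = \sum_i VAC i j ord0 *m (Q i l j y)^t*.
  rewrite /isoCD adjmx_sum; apply: eq_bigr => i _.
  by rewrite adjmxM trmxCK.
have VV j j1 l y y1 : (VCD j l y)^t* *m VCD j1 l y1 =
    \sum_i [&& j == j1, y == y1, e i j & e l j]%:R *:
      (VAC i j ord0 *m (VAC i j1 ord0)^t*).
  rewrite adjV mulmx_suml; apply: eq_bigr => i _.
  rewrite /isoCD mulmx_sumr (bigD1 i) //= [X in _ + X]big1 => [|i1 ii1]; last first.
    by rewrite mulmxA -(mulmxA (VAC _ _ _)) pathC_orth0 ?mulmx0 ?mul0mx // eq_sym.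
  rewrite addr0 mulmxA -(mulmxA (VAC _ _ _)) pathC_orth mul_mx_scalar.
  by rewrite -scalemxAl.
split=> [j l y y1|j j1 l y y1 jj1|l].
- rewrite VV eqxx /=.
  have [/andP[elj /eqP->]|h] := boolP (e l j && (y == y1)); last first.
    rewrite big1 ?raddf0 // => i _; move: h; rewrite negb_and.
    by case: (y == y1); rewrite /= ?orbF ?scale0r // => /negbTE->; rewrite andbF scale0r.
  rewrite -(VACP.(iso_total) j); apply: eq_bigr => i _; rewrite big_ord1 eqxx elj andbT.
  by have [_|/VAC_eq0->] := boolP (e i j); rewrite ?scale1r // mul0mx scaler0.
- by rewrite VV (negbTE jj1) big1 // => i _; rewrite scale0r.
- have := pathC_total l (@mm1 R r a); rewrite (amplify1 VABP) (amplify1 VBDP) /mm1 => <-.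
  rewrite [RHS]exchange_big; apply: eq_bigr => j _ /=.
  rewrite [RHS]exchange_big; apply: eq_bigr => y _ /=.
  rewrite adjV mulmx_sumr; apply: eq_bigr => i _.
  by rewrite mulmxA isoCD_AC mulmx1.
Qed.

Lemma amplify_paths (z : mmalg R a) :
  amplify (comp_isometries VAC VCD) z = amplify (comp_isometries VAB VBD) z.
Proof.
rewrite -[RHS]amplify_comp; apply: mm_ext => l; rewrite -pathC_total.
apply: eq_bigr => i _.
pose f j (o : 'I_1) y := VCD j l y *m VAC i j o *m z i *m (VCD j l y *m VAC i j o)^t*.
rewrite (big_triple f); apply: eq_bigr => j _; rewrite big_ord1.
by apply: eq_bigr => y _; rewrite /f isoCD_AC.
Qed.

Hypothesis t_gt0 : forall i, 0 < t i.
Hypothesis tBE : forall j, tB j = \sum_l (e l j)%:R * t l.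
Hypothesis tCE : forall j, tC j = n%:R * tB j.
Hypothesis tAE : forall i, tA i = \sum_j (e i j)%:R * tC j.
Hypothesis n_gt0 : (0 < n)%N.
Hypothesis nbr_row : forall i, exists j, e i j.
Hypothesis nbr_col : forall j, exists i, e i j.

Let tB_gt0 j : 0 < tB j.
Proof. by rewrite tBE indicator_sum_gt0. Qed.

Let tC_gt0 j : 0 < tC j.
Proof. by rewrite tCE mulr_gt0 ?ltr0n ?tB_gt0. Qed.

Let tA_gt0 i : 0 < tA i.
Proof. by rewrite tAE indicator_sum_gt0. Qed.

Let tt i := (t i)%:C.
Let tt_gt0 i : 0 < tt i.
Proof. by rewrite ltcR. Qed.

Lemma pull_weightBD j : pull_weight (fun j l (_ : 'I_1) => e l j) tt j = (tB j)%:C.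
Proof.
rewrite tBE realC_sum; apply: eq_bigr => l _.
by rewrite big_ord1 rmorphM rmorph_nat.
Qed.

Lemma pull_weightCD j : pull_weight (fun j l (_ : 'I_n) => e l j) tt j = (tC j)%:C.
Proof.
rewrite tCE tBE mulr_sumr realC_sum; apply: eq_bigr => l _.
by rewrite sumr_const card_ord -[LHS]mulr_natl !rmorphM !rmorph_nat.
Qed.

Lemma pull_weightAC i :
  pull_weight (fun i j (_ : 'I_1) => e i j) (fun j => (tC j)%:C) i = (tA i)%:C.
Proof.
rewrite tAE realC_sum; apply: eq_bigr => l _.
by rewrite big_ord1 rmorphM rmorph_nat.
Qed.

(** A matrix is the sum of its corners, by the resolution of the identity. *)
Lemma amplify_corners j (M : 'M[C]_(b j)) (g : mmalg R a) :
  (forall i i' x x', i != i' -> (VAB i j x)^t* *m M *m VAB i' j x' = 0) ->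
  (forall i x x', (VAB i j x)^t* *m M *m VAB i j x' = (e i j && (x == x'))%:R *: g i) ->
  M = amplify VAB g j.
Proof.
move=> M0 Mg; rewrite -[LHS]mul1mx -[LHS]mulmx1 -(VABP.(iso_total) j).
rewrite !mulmx_suml; apply: eq_bigr => i _; rewrite !mulmx_suml; apply: eq_bigr => x _.
rewrite mulmx_sumr (bigD1 i) //= [X in _ + X]big1 => [|i' ii']; last first.
  rewrite mulmx_sumr big1 // => x' _.
  by rewrite mulmxA -!(mulmxA (VAB i j x)) M0 ?mul0mx ?mulmx0 // eq_sym.
rewrite addr0 mulmx_sumr (bigD1 x) //= [X in _ + X]big1 => [|x' xx']; last first.
  rewrite mulmxA -!(mulmxA (VAB i j x)) Mg eq_sym (negbTE xx') andbF scale0r.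
  by rewrite mul0mx mulmx0.
rewrite addr0 mulmxA -!(mulmxA (VAB i j x)) Mg eqxx andbT.
have [_|h] := boolP (e i j); first by rewrite scale1r !mulmxA.
by rewrite (isometry_eq0 VABP h) !mul0mx.
Qed.

(** EB maps C into A.  Compressed to two copies labelled x and x', the
    left-hand side contains the sum over l of conn_col. *)
Lemma cond_exp_square_eq (y : mmalg R c) :
  cond_exp_coef (fun j l (_ : 'I_1) => e l j) VBD tt (amplify VCD y) =
  amplify VAB (cond_exp_coef (fun i j (_ : 'I_1) => e i j) VAC (fun j => (tC j)%:C) y).
Proof.
apply: mm_ext => j.
have corner i i' x x' :
  (VAB i j x)^t* *m cond_exp_coef (fun j l (_ : 'I_1) => e l j) VBD tt (amplify VCD y) j
     *m VAB i' j x' =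
  ([&& i == i', x == x' & e i j]%:R * ((tA i)%:C)^-1) *:
    \sum_j' (tC j')%:C *: ((VAC i j' ord0)^t* *m y j' *m VAC i' j' ord0).
  rewrite /cond_exp_coef pull_weightBD -scalemxAr -scalemxAl.
  have cornerl l : (VAB i j x)^t* *m (\sum_(o < 1) tt l *:
      ((VBD j l o)^t* *m amplify VCD y l *m VBD j l o)) *m VAB i' j x' =
      \sum_j' tt l *: ((W i l j j' *m (W i' l j j')^t*) x x' *:
        ((VAC i j' ord0)^t* *m y j' *m VAC i' j' ord0)).
    rewrite big_ord1 -scalemxAr -scalemxAl -scaler_sumr; congr (_ *: _).
    transitivity ((P i l j x)^t* *m amplify VCD y l *m P i' l j x').
      by rewrite /pathB adjmxM !mulmxA.
    rewrite /amplify mulmx_sumr mulmx_suml; apply: eq_bigr => j' _.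
    rewrite mulmx_sumr mulmx_suml mxE scaler_suml; apply: eq_bigr => y1 _.
    rewrite mulmx_regroup pathB_isoCD.
    have -> : (VCD j' l y1)^t* *m P i' l j x' = (W i' l j j' x' y1)^* *: VAC i' j' ord0.
      by rewrite -[P _ _ _ _]trmxCK -adjmxM pathB_isoCD adjmxZ trmxCK.
    by rewrite -scalemxAr -!scalemxAl scalerA !mxE mulrC.
  rewrite mulmx_sumr mulmx_suml; under eq_bigr do rewrite cornerl.
  rewrite exchange_big !scaler_sumr; apply: eq_bigr => j' _ /=.
  under eq_bigr do rewrite scalerA.
  rewrite -scaler_suml scalerA [RHS]scalerA.
  have -> : \sum_l tt l * (W i l j j' *m (W i' l j j')^t*) x x' =
      ([&& i == i', e i j & e i j']%:R * (tB j * tC j' / tA i)%:C) *+ (x == x').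
    have := congr1 (fun M : 'M_n => M x x') (WP.(conn_col) j j' i i').
    rewrite summxE [in RHS]mxE => <-; by apply: eq_bigr => l _; rewrite [in RHS]mxE.
  have [eij'|/VAC_eq0->] := boolP (e i j'); last by rewrite adjmx0 !mul0mx !scaler0.
  congr (_ *: _); rewrite realC_frac.
  have tB0 : (tB j)%:C != 0 by rewrite gt_eqF // ltcR tB_gt0.
  have tA0 : (tA i)%:C != 0 by rewrite gt_eqF // ltcR tA_gt0.
  case: (i == i'); case: (x == x'); case: (e i j); rewrite /= ?mulr1n ?mulr0n;
    rewrite ?mul0r ?mulr0 //.
  by field; rewrite tB0 tA0.
apply: amplify_corners => [i i' x x' /negbTE ii'|i x x'].
  by rewrite corner ii' mul0r scale0r.
rewrite corner eqxx /= -scalerA; congr (_ *: _); first by rewrite andbC.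
rewrite /cond_exp_coef pull_weightAC; congr (_ *: _); apply: eq_bigr => j' _.
by rewrite big_ord1.
Qed.

Lemma isometries_dim_gt0 (q u N : nat) (p : 'I_q -> nat) (v : 'I_u -> nat)
    (M : 'M[nat]_(q, u)) (E : 'I_q -> 'I_u -> bool)
    (V : forall i j, 'I_N -> 'M[C]_(v j, p i)) :
  (forall i j, M i j = E i j * N)%N -> (0 < N)%N ->
  isometries (fun i j _ => E i j) V ->
  (forall i, 0 < p i)%N -> (forall j, exists i, E i j) -> forall j, (0 < v j)%N.
Proof.
move=> ME N0 VP p0 cov j; rewrite -(isometries_dim ME VP j); have [i Eij] := cov j.
by rewrite (bigD1 i) //= ME Eij mul1n addn_gt0 muln_gt0 N0 p0.
Qed.

Lemma amplify_inclusion (q u N : nat) (p : 'I_q -> nat) (v : 'I_u -> nat)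
    (M : 'M[nat]_(q, u)) (E : 'I_q -> 'I_u -> bool)
    (V : forall i j, 'I_N -> 'M[C]_(v j, p i)) :
  (forall i j, M i j = E i j * N)%N ->
  isometries (fun i j _ => E i j) V ->
  (forall i, exists j, exists x : 'I_N, E i j) -> inclusion M (amplify V).
Proof.
move=> ME VP cov; split; [exact: amplify_hom VP|exact: amplify_inj VP cov|].
exact: isometries_inclusion ME _ VP _ _.
Qed.

(** EA = EB EC follows from cond_exp_square_eq, since the expectation onto A
    factors through C; EA = EC EB then follows by taking adjoints. *)
Lemma square_of_isometries : (forall i, 0 < a i)%N ->
  forall G : 'M[nat]_(r, s), (forall i j, G i j = e i j) ->
  has_commuting_square R G n.
Proof.
move=> a_gt0 G GE.
have n0 : 'I_n := Ordinal n_gt0.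
have [GnE G1E GTE GTnE] := multiplicities n GE.
have VCDP := isoCDP.
have cov1 i : exists j, exists x : 'I_n, e i j.
  by have [j] := nbr_row i; exists j, n0.
have cov2 i : exists j, exists x : 'I_1, e i j.
  by have [j] := nbr_row i; exists j, ord0.
have cov3 j : exists i, exists x : 'I_1, e i j.
  by have [l] := nbr_col j; exists l, ord0.
have cov4 j : exists i, exists x : 'I_n, e i j.
  by have [l] := nbr_col j; exists l, n0.
have b_gt0 := isometries_dim_gt0 GnE n_gt0 VABP a_gt0 nbr_col.
have c_gt0 := isometries_dim_gt0 G1E (ltn0Sn 0) VACP a_gt0 nbr_col.
have d_gt0 := isometries_dim_gt0 GTE (ltn0Sn 0) VBDP b_gt0 nbr_row.
exists a, d, b, c, (amplify VAB), (amplify VAC), (amplify VBD), (amplify VCD), (wtrace tt).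
split=> //.
- by split; [exact: amplify_inclusion GnE VABP _|exact: amplify_inclusion G1E VACP _].
- by split; [exact: amplify_inclusion GTE VBDP _|exact: amplify_inclusion GTnE VCDP _].
split=> [x||].
- by rewrite !amplify_comp amplify_paths.
- exact: wtrace_faithful.
have EBP : trace_cond_exp (wtrace tt) (range (amplify VBD)) _ :=
  trace_cond_expP VBDP tt_gt0 cov3.
have ECP : trace_cond_exp (wtrace tt) (range (amplify VCD)) _ :=
  trace_cond_expP VCDP tt_gt0 cov4.
have cov24 i : exists l, exists p : 'I_s * 'I_1 * 'I_n,
    comp_label (fun i j _ => e i j) (fun j l _ => e l j) i l p.
  have [j eij] := nbr_row i; exists i, (j, ord0, n0).
  by rewrite /comp_label /= eij.
have EAP := trace_cond_expP (comp_isometriesP VACP VCDP) tt_gt0 cov24.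
have fA : amplify VBD \o amplify VAB = amplify (comp_isometries VAC VCD).
  by apply/funext => x; rewrite /= amplify_comp amplify_paths.
rewrite fA; do 3!eexists; split; [exact: EAP|exact: EBP|exact: ECP|].
suff EE x : cond_exp (comp_label (fun i j _ => e i j) (fun j l _ => e l j))
    (comp_isometries VAC VCD) tt x =
   cond_exp (fun j l _ => e l j) VBD tt (cond_exp (fun j l _ => e l j) VCD tt x).
  move=> x; split; first exact: EE.
  apply: (cond_exp_commute tt_gt0 EAP EBP ECP _ _ _ EE).
  - by exists (@mm1 R r a); rewrite ?(amplify1 (comp_isometriesP VACP VCDP)).
  - by exists (@mm1 R s b); rewrite ?(amplify1 VBDP).
  - by exists (@mm1 R s c); rewrite ?(amplify1 VCDP).
(* Both sides become amplifications along the paths through C; compare the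
   coefficients. *)
rewrite [RHS]/cond_exp {2}/cond_exp cond_exp_square_eq amplify_comp -amplify_paths.
congr amplify; rewrite cond_exp_coef_comp => [|j]; last by rewrite pull_weightCD gt_eqF // ltcR.
by congr (cond_exp_coef _ _ _ _); apply/funext => j; rewrite pull_weightCD.
Qed.

End ConnectionToSquare.

Section ExistsSquare.
Variable R : realType.

Lemma square_of_connection (r s n : nat) (e : 'I_r -> 'I_s -> bool)
    (G : 'M[nat]_(r, s)) (t : 'I_r -> R) W :
  (forall i j, G i j = e i j) -> (0 < n)%N ->
  (forall i, exists j, e i j) -> (forall j, exists i, e i j) ->
  (forall i, 0 < t i) ->
  connection e (fun i => \sum_j (e i j)%:R * (n%:R * edge_sum e t j))
      (edge_sum e t) (fun j => n%:R * edge_sum e t j) t (W : _ -> _ -> _ -> _ -> 'M_n) ->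
  has_commuting_square R G n.
Proof.
move=> GE n_gt0 nbr_row nbr_col t_gt0 WP.
have [b [VAB VABP]] := standard_isometries R (fun=> 1%N) e n.
have [c [VAC VACP]] := standard_isometries R (fun=> 1%N) e 1.
have [d [VBD VBDP]] := standard_isometries R b (fun j i => e i j) 1.
exact: (square_of_isometries VABP VACP VBDP WP).
Qed.

End ExistsSquare.

(** * Biunitary connections and the Markov property *)

Section Biunitary.
Variable R : realType.
Local Notation C := R[i].

(** With Perron-Frobenius weights the two unitarity conditions become
    symmetric under the exchange of rows and columns. *)
Definition biunitary (n r s : nat) (e : 'I_r -> 'I_s -> bool) (phi : 'I_r -> R)
    (chi : 'I_s -> R) (W : 'I_r -> 'I_r -> 'I_s -> 'I_s -> 'M[C]_n) :=
  connection e phi chi chi phi W.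

Record perron_pair (r s : nat) (e : 'I_r -> 'I_s -> bool) (lambda : R)
    (phi : 'I_r -> R) (chi : 'I_s -> R) : Prop := {
  perron_gt0 : 0 < lambda;
  perron_row_gt0 : forall i, 0 < phi i;
  perron_col_gt0 : forall j, 0 < chi j;
  perron_row : forall i, lambda * phi i = \sum_j (e i j)%:R * chi j;
  perron_col : forall j, lambda * chi j = \sum_i (e i j)%:R * phi i }.

Lemma adj_realZ n (c : R) (A : 'M[C]_n) : (c%:C *: A)^t* = c%:C *: A^t*.
Proof. by rewrite adjmxZ conj_Creal // complex_real. Qed.

Lemma realCM (u v : R) : (u * v)%:C = u%:C * v%:C.
Proof. exact: rmorphM. Qed.

Lemma sqrt_ratioM (a b p c : R) : 0 <= a -> 0 <= b -> 0 <= p -> 0 <= c ->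
  Num.sqrt (a * p / c) * Num.sqrt (b * p / c) = Num.sqrt (a * b) * (p / c).
Proof.
move=> a0 b0 p0 c0; rewrite -sqrtrM ?divr_ge0 ?mulr_ge0 //.
rewrite (_ : a * p / c * (b * p / c) = a * b * (p / c) ^+ 2); last by ring.
by rewrite sqrtrM ?mulr_ge0 // sqrtr_sqr ger0_norm // divr_ge0.
Qed.

Section Swap.
Variables (n r s : nat) (e : 'I_r -> 'I_s -> bool).
Variables (phi : 'I_r -> R) (chi : 'I_s -> R).
Hypothesis phi_gt0 : forall i, 0 < phi i.
Hypothesis chi_gt0 : forall j, 0 < chi j.

(** The factor is the square root of the ratio of the weights on the two
    sides of conn_col; it turns conn_col into conn_row and conversely. *)
Lemma biunitary_swap (W : 'I_r -> 'I_r -> 'I_s -> 'I_s -> 'M[C]_n) :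
  biunitary e phi chi W ->
  biunitary (fun j i => e i j) chi phi (fun j j' i l =>
    (Num.sqrt (phi i * phi l / (chi j * chi j')))%:C *: W i l j j').
Proof.
move=> WP; split=> [j j' i l|j j' i i1|i l j j1].
- by rewrite scaler_eq0 negb_or => /andP[_ /(WP.(conn_supp))] /and4P[-> -> -> ->].
- have h l : (Num.sqrt (phi i * phi l / (chi j * chi j')))%:C *: W i l j j' *m
     ((Num.sqrt (phi i1 * phi l / (chi j * chi j')))%:C *: W i1 l j j')^t* =
     (Num.sqrt (phi i * phi i1) / (chi j * chi j'))%:C *:
       ((phi l)%:C *: (W i l j j' *m (W i1 l j j')^t*)).
    rewrite adj_realZ -scalemxAr -scalemxAl !scalerA -!rmorphM; congr (_%:C *: _).
    rewrite [LHS]mulrC sqrt_ratioM ?mulr_ge0 ?(ltW (phi_gt0 _)) ?(ltW (chi_gt0 _)) //.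
    by rewrite mulrA mulrAC.
  under eq_bigr do rewrite h.
  rewrite -scaler_sumr WP.(conn_col); have [<-|_] := eqVneq i i1; last first.
    by rewrite mul0r raddf0 scaler0.
  rewrite scale_scalar_mx -expr2 sqrtr_sqr gtr0_norm // mulrCA -rmorphM.
  congr (_%:M).
  rewrite (_ : _ / _ * _ = 1); first by rewrite mulr1.
  by field; rewrite !gt_eqF.
- have h j' : (chi j')%:C *: ((Num.sqrt (phi i * phi l / (chi j * chi j')))%:C *: W i l j j' *m
     ((Num.sqrt (phi i * phi l / (chi j1 * chi j')))%:C *: W i l j1 j')^t*) =
     (phi i * phi l / Num.sqrt (chi j * chi j1))%:C *: (W i l j j' *m (W i l j1 j')^t*).
    rewrite adj_realZ -scalemxAr -scalemxAl !scalerA -!rmorphM; congr (_%:C *: _).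
    have pp : 0 <= phi i * phi l by rewrite mulr_ge0 ?(ltW (phi_gt0 _)).
    have cc k : 0 <= chi k / chi j' by rewrite divr_ge0 ?(ltW (chi_gt0 _)).
    have E k : phi i * phi l / (chi k * chi j') = (chi k)^-1 * (phi i * phi l) / chi j'.
      by field; rewrite !gt_eqF.
    transitivity (chi j' * (Num.sqrt (phi i * phi l / (chi j * chi j')) *
      Num.sqrt (phi i * phi l / (chi j1 * chi j')))); first by ring.
    rewrite !E sqrt_ratioM ?invr_ge0 ?(ltW (chi_gt0 _)) // -invfM sqrtrV; last first.
      by rewrite mulr_ge0 ?(ltW (chi_gt0 _)).
    field; rewrite !gt_eqF // sqrtr_gt0 mulr_gt0 //.
  under eq_bigr do rewrite h.
  rewrite -scaler_sumr WP.(conn_row); have [<-|_] := eqVneq j j1; last first.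
    by rewrite mul0r raddf0 scaler0.
  rewrite scale_scalar_mx -expr2 sqrtr_sqr gtr0_norm // mulrC.
  by [].
Qed.
End Swap.

Section Square.
Variables (n r s : nat) (e : 'I_r -> 'I_s -> bool) (G : 'M[nat]_(r, s)).
Hypothesis GE : forall i j, G i j = e i j.
Hypothesis n_gt0 : (0 < n)%N.
Hypothesis nbr_row : forall i, exists j, e i j.
Hypothesis nbr_col : forall j, exists i, e i j.

(** Take the trace on D with weights phi; its restrictions have the weights
    lambda chi, n lambda chi and n lambda^2 phi. *)
Lemma square_of_biunitary lambda phi chi (W : _ -> _ -> _ -> _ -> 'M[C]_n) :
  perron_pair e lambda phi chi -> biunitary e phi chi W ->
  has_commuting_square R G n.
Proof.
move=> pf WP; have [l0 p0 c0 prow pcol] := pf.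
apply: (square_of_connection (t := phi) (W := W) GE) => //.
have tBE j : edge_sum e phi j = lambda * chi j by rewrite pcol.
have tAE i : \sum_j (e i j)%:R * (n%:R * edge_sum e phi j) =
    n%:R * lambda ^+ 2 * phi i.
  rewrite expr2 -!mulrA prow !mulr_sumr; apply: eq_bigr => j _.
  by rewrite tBE; ring.
split=> [||j j' i i1]; [exact: WP.(conn_supp)|exact: WP.(conn_row)|].
rewrite WP.(conn_col) tAE !tBE; congr ((_ * (_%:C))%:M).
by field; rewrite !gt_eqF // ltr0n.
Qed.

Section Markov.
Variables (tA : 'I_r -> R) (tB tC : 'I_s -> R) (t : 'I_r -> R).
Variable W : 'I_r -> 'I_r -> 'I_s -> 'I_s -> 'M[C]_n.
Hypothesis WP : connection e tA tB tC t W.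
Hypotheses (t_gt0 : forall i, 0 < t i) (tA_gt0 : forall i, 0 < tA i).
Hypotheses (tB_gt0 : forall j, 0 < tB j) (tC_gt0 : forall j, 0 < tC j).

(** After rescaling, W is a partially unitary block matrix in i and l. *)
Lemma conn_col_adj j j' l l1 :
  \sum_i (tA i)%:C *: ((W i l j j')^t* *m W i l1 j j') =
  ([&& l == l1, e l j & e l j']%:R * (tB j * tC j' / t l)%:C)%:M.
Proof.
pose c := tB j * tC j'.
have c_gt0 : 0 < c by rewrite mulr_gt0.
pose Y i k := (Num.sqrt (tA i * t k / c))%:C *: W i k j j'.
have YP : forall i k, \sum_k0 (Y k0 i)^t* *m Y k0 k =
    ((i == k) && (e i j && e i j'))%:R%:M.
  apply: (partial_unitary_adj (S := fun i => e i j && e i j')) => i k.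
    by rewrite scaler_eq0 negb_or => /andP[_ /(WP.(conn_supp))] /and4P[-> -> -> ->].
  have h l0 : Y i l0 *m (Y k l0)^t* = (Num.sqrt (tA i * tA k) / c)%:C *:
     ((t l0)%:C *: (W i l0 j j' *m (W k l0 j j')^t*)).
    rewrite adj_realZ -scalemxAr -scalemxAl !scalerA -!rmorphM; congr (_%:C *: _).
    by rewrite [LHS]mulrC sqrt_ratioM ?(ltW _) // mulrA mulrAC.
  under eq_bigr do rewrite h.
  rewrite -scaler_sumr WP.(conn_col); have [<-|_] := eqVneq i k; last first.
    by rewrite mul0r raddf0 scaler0.
  rewrite scale_scalar_mx -expr2 sqrtr_sqr gtr0_norm // mulrCA -rmorphM.
  congr (_%:M).
  rewrite (_ : _ / _ * _ = 1); first by rewrite mulr1.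
  by rewrite /c; field; rewrite !gt_eqF.
have := YP l l1.
have h i : (Y i l)^t* *m Y i l1 = (Num.sqrt (t l * t l1) / c)%:C *:
    ((tA i)%:C *: ((W i l j j')^t* *m W i l1 j j')).
  rewrite adj_realZ -scalemxAr -scalemxAl !scalerA -!rmorphM; congr (_%:C *: _).
  rewrite ![tA i * _]mulrC [LHS]mulrC sqrt_ratioM ?(ltW _) //.
  by rewrite mulrA mulrAC.
under eq_bigr do rewrite h.
rewrite -scaler_sumr => hh.
have s0 : (Num.sqrt (t l * t l1) / c)%:C != 0.
  by rewrite gt_eqF // ltcR divr_gt0 // sqrtr_gt0 mulr_gt0.
apply: (scalerI s0); rewrite {}hh scale_scalar_mx; congr (_%:M).
have [<-|_] := eqVneq l l1; last by rewrite mul0r mulr0.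
rewrite -expr2 sqrtr_sqr gtr0_norm // mulrCA -rmorphM.
have -> : t l / c * (tB j * tC j' / t l) = 1.
  by rewrite /c; field; rewrite !gt_eqF.
by rewrite mulr1.
Qed.

Hypothesis tCE : forall j, tC j = n%:R * tB j.
Hypothesis tAE : forall i, tA i = \sum_j (e i j)%:R * tC j.

(** Evaluate the sum over i and k of tA i times the squared norm of
    W i l k j in two ways: summing first over k with the columns of conn_row,
    or first over i with those of conn_col. *)
Lemma markov_ratio l j : e l j ->
  \sum_i (e i j)%:R * tA i = tB j * (tA l / t l).
Proof.
move=> elj; pose N i k := \tr ((W i l k j)^t* *m W i l k j).
have n0 : n%:R != 0 :> R by rewrite pnatr_eq0 -lt0n.
have cols k : \sum_i (tA i)%:C * N i k =
    ((e l k)%:R * (tB k * tC j / t l) * n%:R)%:C.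
  transitivity (\tr (\sum_i (tA i)%:C *: ((W i l k j)^t* *m W i l k j))).
    by rewrite [RHS]raddf_sum; apply: eq_bigr => i _; rewrite /= mxtraceZ.
  rewrite conn_col_adj eqxx elj andbT /= mxtrace_scalar -[LHS]mulr_natr.
  by rewrite !rmorphM !rmorph_nat.
have rows i : \sum_k N i k = ((e i j)%:R * n%:R)%:C.
  transitivity (\tr (\sum_k (W i l k j)^t* *m W i l k j)).
    by rewrite [RHS]raddf_sum.
  rewrite (conn_row_adj WP) eqxx elj andbT /= mxtrace_scalar -[LHS]mulr_natr.
  by rewrite !rmorphM !rmorph_nat.
have : (\sum_i tA i * ((e i j)%:R * n%:R))%:C =
       (\sum_k ((e l k)%:R * (tB k * tC j / t l) * n%:R))%:C.
  rewrite !realC_sum; under eq_bigr do rewrite realCM -rows.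
  under [RHS]eq_bigr do rewrite -cols.
  rewrite exchange_big; apply: eq_bigr => i _ /=.
  by rewrite mulr_sumr.
move=> /complexI h; apply: (mulIf n0).
transitivity (\sum_i tA i * ((e i j)%:R * n%:R)).
  by rewrite mulr_suml; apply: eq_bigr => i _; ring.
rewrite h tAE !mulr_suml mulr_sumr mulr_suml; apply: eq_bigr => k _.
by rewrite !tCE; field; rewrite gt_eqF.
Qed.

End Markov.

Hypothesis connected : forall (f : 'I_r -> R) (g : 'I_s -> R),
  (forall i j, e i j -> f i = g j) -> forall i i', f i = f i'.
Variable i0 : 'I_r.

(** By markov_ratio the quotient tA / t takes the same value at the two ends
    of any path of length two, so that tA = mu t by connectedness.  Hence the
    weights on D and B, suitably scaled, form a positive eigenvector for the
    eigenvalue sqrt (mu / n). *)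
Lemma biunitary_of_square : has_commuting_square R G n ->
  exists lambda phi chi (W : _ -> _ -> _ -> _ -> 'M[C]_n),
    perron_pair e lambda phi chi /\ biunitary e phi chi W.
Proof.
move=> /(connection_of_square GE nbr_col)[t [W [t_gt0]]].
set tB := edge_sum e t; set tC := fun j => n%:R * tB j.
set tA := fun i => \sum_j (e i j)%:R * tC j => WP.
have tB_gt0 j : 0 < tB j by apply: indicator_sum_gt0.
have tC_gt0 j : 0 < tC j by rewrite mulr_gt0 ?ltr0n.
have tA_gt0 i : 0 < tA i by apply: indicator_sum_gt0.
pose mu := tA i0 / t i0.
have mu_gt0 : 0 < mu by rewrite divr_gt0.
have tAmu i : tA i = mu * t i.
  have <- : tA i / t i = mu; last by rewrite divfK // gt_eqF.
  apply: (connected (f := fun i => tA i / t i)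
     (g := fun j => (\sum_i (e i j)%:R * tA i) / tB j)) => l j elj.
  by rewrite (markov_ratio WP _ _ _ _ _ _ elj) // [RHS]mulrC mulKf // gt_eqF.
(* The square of the adjacency matrix multiplies t by mu / n, because the
   weights on A are n times the image of t under that square. *)
pose lambda := Num.sqrt (mu / n%:R).
have l_gt0 : 0 < lambda by rewrite sqrtr_gt0 divr_gt0 ?ltr0n.
have l2 : lambda ^+ 2 = mu / n%:R by rewrite sqr_sqrtr // divr_ge0 ?ler0n // ltW.
have tA2 i : tA i = n%:R * lambda ^+ 2 * t i.
  by rewrite tAmu l2 mulrCA divff ?mulr1 // pnatr_eq0 -lt0n.
exists lambda, (fun i => lambda * t i), tB, W; split.
  split=> // [i|i|j]; first by rewrite mulr_gt0.
    apply: (mulfI (x := n%:R)); first by rewrite pnatr_eq0 -lt0n.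
    transitivity (tA i); first by rewrite tA2; ring.
    by rewrite mulr_sumr; apply: eq_bigr => j _; rewrite /tC mulrCA.
  by rewrite mulr_sumr; apply: eq_bigr => i _; rewrite mulrCA.
split=> [||j j' i i']; [exact: WP.(conn_supp)|exact: WP.(conn_row)|].
under eq_bigr do rewrite realCM -scalerA.
rewrite -scaler_sumr WP.(conn_col) scale_scalar_mx mulrCA -rmorphM tA2.
congr ((_ * (_%:C))%:M); rewrite /tC; field.
by rewrite !gt_eqF // ltr0n.
Qed.

End Square.
End Biunitary.

(** * Values of the polynomials R_n *)

Section ChebyshevValues.
Variable R : realType.
Local Notation r q t := ((Rpoly R q).[t]).

Lemma Rpoly0 t : r 0 t = 1.
Proof. by rewrite hornerC. Qed.

Lemma Rpoly1 t : r 1 t = t.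
Proof. by rewrite hornerX. Qed.

Lemma RpolySS q t : r q.+2 t = t * r q.+1 t - r q t.
Proof. by rewrite [Rpoly R q.+2]/= !hornerE. Qed.

Lemma Rpoly_det q t : r q.+1 t ^+ 2 = 1 + r q t * r q.+2 t.
Proof.
elim: q => [|q IH]; first by rewrite RpolySS Rpoly0 Rpoly1; ring.
rewrite [r q.+3 t]RpolySS.
rewrite (_ : _ + _ = r q.+2 t * (t * r q.+1 t) + 1 - r q.+1 t ^+ 2); last by ring.
by rewrite IH RpolySS; ring.
Qed.

Lemma Rpoly_at2 q : r q 2 = q.+1%:R.
Proof.
suff [] : r q 2 = q.+1%:R /\ r q.+1 2 = q.+2%:R by [].
elim: q => [|q [IH1 IH2]]; first by rewrite Rpoly0 Rpoly1.
by split=> //; rewrite RpolySS IH1 IH2 -!natr1; ring.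
Qed.

(** The second inequality says that the quotient of R_(q+1) by R_q increases
    from s to t; carried along the induction, it keeps R_(q+1) positive at
    t. *)
Lemma Rpoly_gt0_lt N s t : s < t -> (forall q, (q <= N)%N -> 0 < r q s) ->
  forall q, (q <= N)%N ->
  0 < r q t /\ r q t * r q.+1 s < r q.+1 t * r q s.
Proof.
move=> st s_gt0; elim=> [_|q IH qN].
  by rewrite !Rpoly0 !Rpoly1 mul1r mulr1; split.
have [rq_gt0 rlt] := IH (ltnW qN).
have rq1_gt0 : 0 < r q.+1 t.
  have := s_gt0 q (ltnW qN) => sq.
  by rewrite -(pmulr_lgt0 _ sq); apply: lt_trans rlt; rewrite mulr_gt0 // s_gt0.
split=> //; rewrite !RpolySS.
have := mulr_gt0 rq1_gt0 (s_gt0 _ qN) => pp.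
have : 0 < (t - s) * (r q.+1 t * r q.+1 s) by rewrite mulr_gt0 ?subr_gt0.
nra.
Qed.

Lemma Rpoly_gt0_le N s t : s <= t -> (forall q, (q <= N)%N -> 0 < r q s) ->
  forall q, (q <= N)%N -> 0 < r q t.
Proof.
rewrite le_eqVlt => /orP[/eqP<- //|st] s0 q qN.
by have [] := Rpoly_gt0_lt st s0 qN.
Qed.

(** At the root t found for K, the recursion gives R_(K+2) = - R_K < 0, while
    R_(K+2) is positive at 2: the next root lies in between, and R_(K+1) is
    positive there because its quotient by R_K has increased from 0. *)
Lemma Rpoly_top_root K : exists2 t, t <= 2 &
  r K.+1 t = 0 /\ forall q, (q <= K)%N -> 0 < r q t.
Proof.
elim: K => [|K [t t2 [rt0 rt_gt0]]].
  exists 0 => //; split=> [|q]; first by rewrite Rpoly1.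
  by rewrite leqn0 => /eqP->; rewrite Rpoly0.
have rneg : r K.+2 t < 0 by rewrite RpolySS rt0 mulr0 sub0r oppr_lt0 rt_gt0.
have [|x /andP[tx x2] /rootP xr] := @poly_ivt _ (Rpoly R K.+2) t 2 t2.
  by rewrite (ltW rneg) Rpoly_at2 ler0n.
have {}tx : t < x.
  by rewrite lt_neqAle tx andbT; apply/eqP => xt; move: rneg; rewrite xt xr ltxx.
exists x => //; split=> // q; rewrite leq_eqVlt => /orP[/eqP->|].
  have [_] := Rpoly_gt0_lt tx rt_gt0 (leqnn K).
  by rewrite rt0 mulr0 pmulr_lgt0 // rt_gt0.
by rewrite ltnS => /(Rpoly_gt0_lt tx rt_gt0)[].
Qed.

Lemma Rpoly_incr t q : 2 <= t -> 0 < r q t /\ r q t <= r q.+1 t.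
Proof.
move=> t2; elim: q => [|q [IH1 IH2]].
  by rewrite Rpoly0 Rpoly1; split=> //; lra.
split; first exact: lt_le_trans IH2.
rewrite RpolySS; nra.
Qed.

End ChebyshevValues.

(** * Geometry of the star *)

Section StarGeometry.
Variables (m : nat) (k : 'I_m -> nat).
Hypothesis k_gt0 : forall j, (0 < k j)%N.
Local Notation V := (star_vertex k).
Local Notation e := (@star_edge m k).

(** The distance 0 gives the central vertex on every ray, so that the
    recursions along a ray need no special case at its origin. *)
Definition ray_vertex (a : 'I_m) (q : nat) : V :=
  if q is p.+1 then omap (Tagged (fun j => 'I_(k j))) (insub p : option 'I_(k a))
  else None.

Arguments ray_vertex : simpl never.

Definition dist (x : V) : nat := if x is Some p then (tagged p).+1 else 0.

Local Notation pt := ray_vertex.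

Lemma ray_vertexS a p (lt : (p < k a)%N) : pt a p.+1 = Some (Tagged _ (Ordinal lt)).
Proof. by rewrite /ray_vertex insubT. Qed.

Lemma star_vertexP x : x = None \/ exists a p, (p < k a)%N /\ x = pt a p.+1.
Proof.
case: x => [[a o]|]; last by left.
right; exists a, o; split=> //; rewrite (ray_vertexS (ltn_ord o)).
by congr (Some (Tagged _ _)); apply: val_inj.
Qed.

Lemma dist_ray_vertex a q : (q <= k a)%N -> dist (pt a q) = q.
Proof. by case: q => // q lt; rewrite (ray_vertexS lt). Qed.

Lemma ray_vertex_neq a p : (p.+2 <= k a)%N -> pt a p.+2 != pt a p.
Proof.
move=> lp; apply/eqP => /(congr1 dist); rewrite !dist_ray_vertex //.
  by move/eqP; rewrite gtn_eqF.
by rewrite ltnW // ltnW.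
Qed.

Definition ray (x : V) : option 'I_m := omap (fun p => tag p) x.

Lemma ray_ray_vertex a p : (p < k a)%N -> ray (pt a p.+1) = Some a.
Proof. by move=> lp; rewrite (ray_vertexS lp). Qed.

Lemma ray_vertex_inj a b p q : (p < k a)%N -> (q < k b)%N ->
  pt a p.+1 = pt b q.+1 -> a = b /\ p = q.
Proof.
move=> lp lq eqp; have := congr1 dist eqp; rewrite !dist_ray_vertex // => -[<-].
by have := congr1 ray eqp; rewrite !ray_ray_vertex // => -[].
Qed.

Lemma star_edge_sym x y : e x y = e y x.
Proof. by case: x => [p|]; case: y => [q|] //=; rewrite eq_sym orbC. Qed.

Lemma star_edge_centre a p : (p < k a)%N -> e None (pt a p.+1) = (p == 0)%N.
Proof. by move=> lp; rewrite (ray_vertexS lp). Qed.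

Lemma star_edge_ray a b p q : (p < k a)%N -> (q < k b)%N ->
  e (pt a p.+1) (pt b q.+1) = (a == b) && ((p.+1 == q) || (q.+1 == p)).
Proof. by move=> lp lq; rewrite (ray_vertexS lp) (ray_vertexS lq). Qed.

Lemma star_edge_next a q : (q < k a)%N -> e (pt a q) (pt a q.+1).
Proof.
case: q => [|q] lq; first by rewrite star_edge_centre.
by rewrite star_edge_ray ?(ltnW lq) // !eqxx.
Qed.

Lemma star_nbr_centre y : e None y -> exists a, y = pt a 1.
Proof.
have [->//|[a [p [lp ->]]]] := star_vertexP y.
by rewrite star_edge_centre // => /eqP->; exists a.
Qed.

Lemma star_nbr a p y : (p < k a)%N -> e (pt a p.+1) y ->
  y = pt a p \/ ((p.+1 < k a)%N /\ y = pt a p.+2).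
Proof.
move=> lp; have [->|[b [q [lq ->]]]] := star_vertexP y.
  by rewrite star_edge_sym star_edge_centre // => /eqP->; left.
rewrite star_edge_ray // => /andP[/eqP ab]; subst b.
by case/orP => /eqP pq; subst; [right|left].
Qed.

Definition parent (x : V) : V :=
  if x is Some p then pt (tag p) (tagged p) else None.

Lemma parent_ray_vertex a p : (p < k a)%N -> parent (pt a p.+1) = pt a p.
Proof. by move=> lp; rewrite (ray_vertexS lp). Qed.

Lemma star_edge_parent x y : e x y ->
  (dist y = (dist x).+1 /\ x = parent y) \/ (dist x = (dist y).+1 /\ y = parent x).
Proof.
have [->|[a [p [lp ->]]]] := star_vertexP x.
  by case/star_nbr_centre => a ->; left; rewrite parent_ray_vertex ?dist_ray_vertex.
case/(star_nbr lp) => [->|[lp1 ->]].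
  by right; rewrite parent_ray_vertex // !dist_ray_vertex // ltnW.
by left; rewrite parent_ray_vertex // !dist_ray_vertex.
Qed.

(** Along a 4-cycle, orient each edge towards the centre.  Either some vertex
    has its two neighbours as parents, and they coincide, or the orientation
    turns around the cycle, which the distance to the centre forbids. *)
Lemma star_no_square x y z w : e x z -> e y z -> e x w -> e y w ->
  x != y -> z = w.
Proof.
move=> /star_edge_parent xz /star_edge_parent yz /star_edge_parent xw.
move=> /star_edge_parent yw /eqP xy.
case: xz yz xw yw => -[d1 p1] [] [d2 p2] [] [d3 p3] [] [d4 p4];
  by [rewrite p1 p3|rewrite p2 p4|case: xy; rewrite p1 p2|case: xy; rewrite p3 p4|lia].
Qed.

Section Sums.
Variable T : nmodType.

Lemma star_sum_centre (f : V -> T) : (forall y, ~~ e None y -> f y = 0) ->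
  \sum_y f y = \sum_a f (pt a 1).
Proof.
move=> f0; rewrite (bigID (e None)) /= [X in _ + X]big1 ?addr0 => [|y /f0//].
rewrite (reindex_omap (fun a => pt a 1) ray) => [|y]; last first.
  by case/star_nbr_centre => a ->; rewrite ray_ray_vertex.
apply: eq_bigl => a; rewrite ray_ray_vertex // eqxx andbT.
exact: (star_edge_centre (k_gt0 a)).
Qed.

Lemma star_sum_ray a p (f : V -> T) : (p < k a)%N ->
  (forall y, ~~ e (pt a p.+1) y -> f y = 0) ->
  \sum_y f y = f (pt a p) + (if (p.+1 < k a)%N then f (pt a p.+2) else 0).
Proof.
move=> lp f0; rewrite (bigD1 (pt a p)) //=; congr (_ + _); case: ifP => lp1.
  rewrite (bigD1 (pt a p.+2)) /=; last first.
    by apply/eqP => /(congr1 dist); rewrite !dist_ray_vertex ?(ltnW lp) //; lia.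
  rewrite big1 ?addr0 // => y /andP[y1 y2]; apply: f0; apply/negP => /(star_nbr lp).
  by case=> [yE|[_ yE]]; move: y1 y2; rewrite yE eqxx.
rewrite big1 // => y y1; apply: f0; apply/negP => /(star_nbr lp).
by case=> [yE|[]]; [rewrite yE eqxx in y1|rewrite lp1].
Qed.
End Sums.

End StarGeometry.

Arguments ray_vertex : simpl never.
Arguments dist {m k} x.
Arguments ray {m k} x.
Arguments parent {m k} x.

(** * The Perron-Frobenius vector of the star *)

Section Eigenfunctions.
Variable R : realType.

Definition eigenfunction (V : finType) (e : rel V) (mu : R) (g : V -> R) : Prop :=
  forall x, mu * g x = \sum_y (e x y)%:R * g y.

Lemma eigenvalueE (V : finType) (e : rel V) (mu : R) : symmetric e ->
  eigenvalue (adjacency_mx R e) mu <->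
  exists2 g, eigenfunction e mu g & exists x, g x != 0.
Proof.
move=> e_sym; split=> [/eigenvalueP[v vA v0]|[g gA [x gx0]]].
  exists (fun x => v 0 (enum_rank x)) => [x|].
    have := congr1 (fun u : 'rV_#|V| => u 0 (enum_rank x)) vA.
    rewrite !mxE => <-; rewrite (reindex (@enum_val V predT)) /=; last first.
      exact/onW_bij/enum_val_bij.
    by apply: eq_bigr => y _; rewrite !mxE enum_rankK enum_valK e_sym mulrC.
  apply/existsP; apply: contraNT v0; rewrite negb_exists => /forallP v0.
  apply/eqP/rowP => y; rewrite mxE; apply/eqP.
  by have := v0 (enum_val y); rewrite negbK enum_valK.
apply/eigenvalueP; exists (\row_y g (enum_val y)); last first.
  apply: contraNneq gx0 => /rowP/(_ (enum_rank x)).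
  by rewrite !mxE enum_rankK => ->.
apply/rowP => y; rewrite !mxE gA (reindex (@enum_val V predT)) /=; last first.
  exact/onW_bij/enum_val_bij.
by apply: eq_bigr => x' _; rewrite !mxE e_sym mulrC.
Qed.

(** Pair the two functions using the symmetry of the adjacency matrix. *)
Lemma positive_eigenfunction_uniq (V : finType) (e : rel V) (mu nu : R) g h :
  symmetric e -> eigenfunction e mu g -> eigenfunction e nu h ->
  (forall x, 0 < g x) -> (forall x, 0 < h x) -> V -> mu = nu.
Proof.
move=> e_sym gA hA g0 h0 x0; pose S := \sum_x g x * h x.
have S0 : S != 0.
  rewrite gt_eqF // /S (bigD1 x0) //= ltr_wpDr ?mulr_gt0 //.
  by rewrite sumr_ge0 // => x _; rewrite mulr_ge0 ?ltW.
apply: (mulIf S0); rewrite /S !mulr_sumr.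
transitivity (\sum_x \sum_y (e x y)%:R * g y * h x).
  by apply: eq_bigr => x _; rewrite mulrA gA mulr_suml.
rewrite exchange_big; apply: eq_bigr => x _ /=.
rewrite mulrCA hA mulr_sumr; apply: eq_bigr => y _.
by rewrite e_sym; ring.
Qed.

Variables (m : nat) (k : 'I_m -> nat).
Hypothesis k_gt0 : forall j, (0 < k j)%N.
Local Notation e := (@star_edge m k).
Local Notation pt := (@ray_vertex m k).
Local Notation r q t := ((Rpoly R q).[t]).

Lemma star_eigen_centre mu g : eigenfunction e mu g ->
  mu * g None = \sum_a g (pt a 1).
Proof.
move=> gA; rewrite gA star_sum_centre // => [|y /negbTE->]; last by rewrite mul0r.
by apply: eq_bigr => a _; rewrite star_edge_centre // mul1r.
Qed.

Lemma star_eigen_ray mu g a p : eigenfunction e mu g -> (p < k a)%N ->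
  mu * g (pt a p.+1) = g (pt a p) + (if (p.+1 < k a)%N then g (pt a p.+2) else 0).
Proof.
move=> gA lp; rewrite gA (star_sum_ray lp) => [|y /negbTE->]; last first.
  by rewrite mul0r.
rewrite star_edge_sym star_edge_next // mul1r; congr (_ + _).
by case: ifP => // lp1; rewrite star_edge_next // mul1r.
Qed.

(** Read from the end of the ray, the eigenvalue equation is the recursion
    that defines the R_n. *)
Lemma star_eigen_end mu g a q : eigenfunction e mu g -> (q <= k a)%N ->
  g (pt a (k a - q)) = r q mu * g (pt a (k a)).
Proof.
move=> gA; have ka := k_gt0 a.
suff H p : ((p <= k a)%N -> g (pt a (k a - p)) = r p mu * g (pt a (k a))) /\
   ((p.+1 <= k a)%N -> g (pt a (k a - p.+1)) = r p.+1 mu * g (pt a (k a))).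
  by move=> qk; have [H1 _] := H q; apply: H1.
elim: p => [|p [IH1 IH2]].
  split=> [_|_]; first by rewrite Rpoly0 mul1r subn0.
  have lk : ((k a).-1 < k a)%N by rewrite prednK.
  have := star_eigen_ray gA lk; rewrite prednK // ltnn addr0 Rpoly1 => ->.
  by rewrite subn1.
split=> // lp; have lp' : (k a - p.+2 < k a)%N by lia.
have := star_eigen_ray gA lp'.
have -> : (k a - p.+2).+1 = (k a - p.+1)%N by lia.
have -> : (k a - p.+1).+1 = (k a - p)%N by lia.
rewrite IH2 ?(ltnW lp) // RpolySS.
rewrite leq_subr.
rewrite IH1 => [h|]; last by lia.
by rewrite mulrBl -mulrA h addrK.
Qed.

(** The Perron-Frobenius vector, normalised at the centre, when mu is the
    largest eigenvalue. *)
Definition star_weight (mu : R) (x : star_vertex k) : R :=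
  if x is Some p then r (k (tag p) - (tagged p).+1) mu / r (k (tag p)) mu else 1.

Local Notation alpha mu a := (star_alpha k mu a).

Lemma star_weight_ray mu a q : (forall a, r (k a) mu != 0) -> (q <= k a)%N ->
  star_weight mu (pt a q) = r (k a - q) mu / r (k a) mu.
Proof.
move=> r0; case: q => [|q] lq; first by rewrite subn0 divff.
by rewrite (ray_vertexS lq).
Qed.

Lemma star_eigen_alpha mu g : (forall a, r (k a) mu != 0) ->
  eigenfunction e mu g -> forall a, g (pt a 1) = alpha mu a * g None.
Proof.
move=> r0 gA a; have ka := k_gt0 a.
have := star_eigen_end (a := a) gA (leqnn _); rewrite subnn => h0.
have := star_eigen_end (a := a) gA (leq_pred _).
rewrite (_ : (k a - (k a).-1)%N = 1%N) => [->|]; last by lia.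
rewrite -[g None]/(g (pt a 0)) h0 /star_alpha mulrA divfK //.
Qed.

(** The eigenfunction does not vanish at the centre: otherwise it vanishes at
    the end of each ray, hence everywhere.  The equation at the centre then
    reads as stated. *)
Lemma star_alpha_sum mu g : (forall a, r (k a) mu != 0) ->
  eigenfunction e mu g -> (exists x, g x != 0) -> \sum_a alpha mu a = mu.
Proof.
move=> r0 gA [x gx0]; have g0 : g None != 0.
  apply: contraNneq gx0 => g0; have [->|[a [p [lp ->]]]] := star_vertexP x.
    by rewrite g0.
  have h0 := star_eigen_end (a := a) gA (leqnn _).
  have ge : g (pt a (k a)) = 0.
    move: h0; rewrite subnn -[pt a 0]/None g0 => /esym/eqP.
    by rewrite mulf_eq0 (negbTE (r0 a)) => /eqP.
  have -> : p.+1 = (k a - (k a - p.+1))%N by lia.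
  by rewrite (star_eigen_end gA) ?ge ?mulr0 // leq_subr.
apply: (mulIf g0); rewrite (star_eigen_centre gA) mulr_suml.
by apply: eq_bigr => a _; rewrite (star_eigen_alpha r0 gA).
Qed.

Lemma star_weight_eigen mu : (forall a, r (k a) mu != 0) ->
  \sum_a alpha mu a = mu -> eigenfunction e mu (star_weight mu).
Proof.
move=> r0 sum_alpha x; have [->|[a [p [lp ->]]]] := star_vertexP x.
  rewrite star_sum_centre // => [|y /negbTE->]; last by rewrite mul0r.
  rewrite mulr1 -{1}sum_alpha; apply: eq_bigr => a _.
  by rewrite star_edge_centre // mul1r star_weight_ray // subn1.
rewrite (star_sum_ray lp) => [|y /negbTE->]; last by rewrite mul0r.
rewrite star_edge_sym star_edge_next // mul1r.
rewrite (star_weight_ray r0 lp) (star_weight_ray r0 (ltnW lp)).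
have -> : (k a - p)%N = (k a - p.+1).+1 by lia.
have -> : (if (p.+1 < k a)%N then (e (pt a p.+1) (pt a p.+2))%:R *
    star_weight mu (pt a p.+2) else 0) =
    if (k a - p.+1)%N is q.+1 then r q mu / r (k a) mu else 0.
  case: ifP => lp1.
    have -> : (k a - p.+1)%N = (k a - p.+2).+1 by lia.
    by rewrite star_edge_next // mul1r star_weight_ray.
  by have -> : (k a - p.+1)%N = 0%N by lia.
case: (k a - p.+1)%N => [|q]; first by rewrite Rpoly0 Rpoly1 addr0; ring.
by rewrite RpolySS -mulrDl subrK mulrA.
Qed.

Lemma star_symmetric : symmetric e.
Proof. exact: star_edge_sym. Qed.

Hypothesis m_ge2 : (2 <= m)%N.

(** Let K be the largest ray length and t1 the root of R_(K+1) given by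
    Rpoly_top_root; to the right of t1 all the R_q with q <= K are positive.
    The difference t - sum_a alpha_a(t) is nonpositive at t1, where the term
    of a longest ray already equals t1, and nonnegative at m, where all the m
    terms are at most 1.  Its numerator h is a polynomial, so it vanishes in
    between. *)
Lemma star_eigenvalue_top : exists2 mu : R,
  (forall a q, (q <= k a)%N -> 0 < r q mu) & \sum_a alpha mu a = mu.
Proof.
have a1 : 'I_m := Ordinal (ltnW m_ge2).
pose a0 := [arg max_(a > a1) k a].
have kmax a : (k a <= k a0)%N by rewrite /a0; case: arg_maxnP => // i _; apply.
have [t1 t12 [rt1 rt1_gt0]] := Rpoly_top_root R (k a0).
have pos t : t1 <= t -> forall a q, (q <= k a)%N -> 0 < r q t.
  move=> t1t a q qk; apply: (Rpoly_gt0_le t1t rt1_gt0).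
  exact: leq_trans (kmax a).
have posk t : t1 <= t -> forall a, 0 < r (k a) t by move=> tt a; apply: (pos _ tt a).
pose h : {poly R} := 'X * \prod_a Rpoly R (k a) -
   \sum_a Rpoly R (k a).-1 * \prod_(b | b != a) Rpoly R (k b).
have hE t : t1 <= t -> h.[t] = (\prod_a r (k a) t) * (t - \sum_a alpha t a).
  move=> t1t; rewrite /h !hornerE horner_prod horner_sum mulrBr [t * _]mulrC.
  congr (_ - _); rewrite mulr_sumr; apply: eq_bigr => a _.
  rewrite hornerM horner_prod [in RHS](bigD1 a) //= /star_alpha.
  by field; rewrite gt_eqF // posk.
have prod_gt0 t : t1 <= t -> 0 < \prod_a r (k a) t.
  by move=> t1t; apply: prodr_gt0 => a _; apply: posk.
have m2 : (2 : R) <= m%:R by rewrite ler_nat.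
have t1m : t1 <= m%:R := le_trans t12 m2.
have [|mu /andP[t1mu _] /rootP] := @poly_ivt _ h t1 m%:R t1m.
  rewrite !hE // pmulr_rle0 ?prod_gt0 // pmulr_rge0 ?prod_gt0 // subr_le0 subr_ge0.
  apply/andP; split.
    rewrite (bigD1 a0) //= ler_wpDr //.
    + apply: sumr_ge0 => a _; rewrite divr_ge0 ?ltW ?posk //.
      by rewrite (pos _ (lexx _) a) // leq_pred.
    + rewrite /star_alpha ler_pdivlMr ?posk //.
      move: rt1; have := k_gt0 a0; case: (k a0) => // K _.
      by rewrite RpolySS /= => /eqP; rewrite subr_eq0 => /eqP->.
  rewrite -[X in _ <= X%:R]card_ord -sumr_const; apply: ler_sum => a _.
  rewrite /star_alpha ler_pdivrMr ?posk // mul1r.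
  have := k_gt0 a; case: (k a) => // K _; exact: (Rpoly_incr K m2).2.
rewrite hE // => /eqP; rewrite mulf_eq0 gt_eqF ?prod_gt0 //= subr_eq0 => /eqP muE.
by exists mu => //; apply: pos.
Qed.

Variable lambda : R.
Hypothesis hlambda : perron_frobenius e lambda.

(** The eigenvalue of star_eigenvalue_top is at most lambda, and positivity
    of the R_q persists to the right. *)
Lemma Rpoly_perron_gt0 a q : (q <= k a)%N -> 0 < r q lambda.
Proof.
have [mu mu_gt0 sum_mu] := star_eigenvalue_top.
have muk b : r (k b) mu != 0 by rewrite gt_eqF ?(mu_gt0 b).
have mul : mu <= lambda.
  apply: hlambda.2; apply/(eigenvalueE _ star_symmetric).
  exists (star_weight mu); first exact: star_weight_eigen.
  by exists None; rewrite oner_eq0.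
exact: Rpoly_gt0_le mul (mu_gt0 a) q.
Qed.

Lemma Rpoly_perron_neq0 a : r (k a) lambda != 0.
Proof. by rewrite gt_eqF ?(Rpoly_perron_gt0 (leqnn _)). Qed.

Lemma perron_alpha_sum : \sum_a alpha lambda a = lambda.
Proof.
have [g gA g0] := (eigenvalueE _ star_symmetric).1 hlambda.1.
exact: star_alpha_sum Rpoly_perron_neq0 gA g0.
Qed.

Lemma perron_weight_eigen : eigenfunction e lambda (star_weight lambda).
Proof. exact: star_weight_eigen Rpoly_perron_neq0 perron_alpha_sum. Qed.

Lemma perron_weight_gt0 x : 0 < star_weight lambda x.
Proof.
have [->|[a [p [lp ->]]]] := star_vertexP x; first exact: ltr01.
rewrite star_weight_ray ?divr_gt0 //; try exact: Rpoly_perron_neq0.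
- exact: Rpoly_perron_gt0 (leq_subr _ _).
- exact: Rpoly_perron_gt0 (leqnn _).
Qed.

Lemma perron_alpha_gt0 a : 0 < alpha lambda a.
Proof.
by rewrite divr_gt0 ?(Rpoly_perron_gt0 (leqnn _)) ?(Rpoly_perron_gt0 (leq_pred _)).
Qed.

End Eigenfunctions.

(** * The connection that extends a block matrix along the rays *)

Section StarCells.
Variable R : realType.
Local Notation C := R[i].
Variables (m : nat) (k : 'I_m -> nat) (lambda : R).
Hypothesis k_gt0 : forall j, (0 < k j)%N.
Local Notation V := (star_vertex k).
Local Notation e := (@star_edge m k).
Local Notation pt := (@ray_vertex m k).
Local Notation rv q := ((Rpoly R q).[lambda]).
Hypothesis r_gt0 : forall a q, (q <= k a)%N -> 0 < rv q.
Local Notation omega := (@star_weight R m k lambda).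
Variables (n : nat) (u : 'I_m -> 'I_m -> 'M[C]_n).
Hypothesis u_unitary : forall a b, u a b \is unitarymx.

(** Columns are at odd distance from the centre, hence on a ray. *)
Definition cell_unitary (z w : V) : 'M[C]_n :=
  match z, w with Some p, Some q => u (tag p) (tag q) | _, _ => 0 end.

(** A closed walk x - z - y - w - x in a tree has x = y or z = w.  Around a
    vertex inside a ray the walks with x = y give the 2 x 2 matrix with rows
    (- c, t) and (t, c), where c = 1 / R_q, q is the distance from x to the end
    of the ray and c^2 + t^2 = 1; the sign makes its rows orthogonal. *)
Definition cell_coef (x y z w : V) : R :=
  if x != y then 1
  else if z != w then Num.sqrt (omega z * omega w) / omega x
  else (if (dist x < dist z)%N then 1 else -1) /
       rv ((if z is Some p then k (tag p) else 0%N) - dist x).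

(** The connection: along the whole ray a it is u a a times a scalar, and at
    the centre it is the given block matrix. *)
Definition cell (x y z w : V) : 'M[C]_n :=
  if [&& e x z, e y z, e x w & e y w]
  then (cell_coef x y z w)%:C *: cell_unitary z w else 0.

Lemma cell_unitary_ray a b p q : (p < k a)%N -> (q < k b)%N ->
  cell_unitary (pt a p.+1) (pt b q.+1) = u a b.
Proof. by move=> lp lq; rewrite (ray_vertexS lp) (ray_vertexS lq). Qed.

Lemma odd_dist_ray (z : V) : odd (dist z) -> exists a p, (p < k a)%N /\ z = pt a p.+1.
Proof. by have [->|//] := star_vertexP z. Qed.

Lemma cell_unitary_unitary (z w : V) : odd (dist z) -> odd (dist w) ->
  cell_unitary z w *m (cell_unitary z w)^t* = 1%:M.
Proof.
move=> /odd_dist_ray[a [p [lp ->]]] /odd_dist_ray[b [q [lq ->]]].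
by rewrite cell_unitary_ray //; apply/unitarymxP.
Qed.

Lemma cellE x y z w : e x z -> e y z -> e x w -> e y w ->
  cell x y z w = (cell_coef x y z w)%:C *: cell_unitary z w.
Proof. by rewrite /cell => -> -> -> ->. Qed.

Lemma cell0 x y z w : ~~ [&& e x z, e y z, e x w & e y w] -> cell x y z w = 0.
Proof. by rewrite /cell => /negbTE->. Qed.

Lemma omega_ray a q : (q <= k a)%N -> omega (pt a q) = rv (k a - q) / rv (k a).
Proof. by apply: star_weight_ray => b; rewrite gt_eqF ?(r_gt0 (leqnn _)). Qed.

Lemma omega_gt0 x : 0 < omega x.
Proof.
have [->|[a [p [lp ->]]]] := star_vertexP x; first exact: ltr01.
by rewrite omega_ray // divr_gt0 ?(r_gt0 (leq_subr _ _)) ?(r_gt0 (leqnn _)).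
Qed.

Lemma scaled_unitaryM (c d : R) (U : 'M[C]_n) : U *m U^t* = 1%:M ->
  (c%:C *: U) *m (d%:C *: U)^t* = (c * d)%:C%:M.
Proof.
move=> Uu; rewrite adj_realZ -scalemxAr -scalemxAl Uu scalerA realCM.
by rewrite mulrC scale_scalar_mx mulr1.
Qed.

Lemma cell_unitary_same a q : (q < k a)%N ->
  cell_unitary (pt a q.+1) (pt a q.+1) = u a a.
Proof. by move=> lq; rewrite cell_unitary_ray. Qed.

Lemma cell_up a q : (q < k a)%N ->
  cell (pt a q) (pt a q) (pt a q.+1) (pt a q.+1) = (1 / rv (k a - q))%:C *: u a a.
Proof.
move=> lq; rewrite cellE ?star_edge_next // cell_unitary_same //.
rewrite /cell_coef !eqxx /= !dist_ray_vertex ?(ltnW lq) // leqnn.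
by rewrite (ray_vertexS lq).
Qed.

Lemma cell_down a q : (q.+1 < k a)%N ->
  cell (pt a q.+2) (pt a q.+2) (pt a q.+1) (pt a q.+1) =
  (- 1 / rv (k a - q.+2))%:C *: u a a.
Proof.
move=> lq; have lq' := ltnW lq.
rewrite cellE 1?star_edge_sym ?star_edge_next // cell_unitary_same //.
rewrite /cell_coef !eqxx /= !dist_ray_vertex // ltnNge leqnSn /=.
by rewrite (ray_vertexS lq').
Qed.

Lemma cell_turn x z w : e x z -> e x w -> z != w ->
  cell x x z w = (Num.sqrt (omega z * omega w) / omega x)%:C *: cell_unitary z w.
Proof. by move=> xz xw zw; rewrite cellE // /cell_coef eqxx zw. Qed.

Lemma cell_cross x y z : e x z -> e y z -> x != y ->
  cell x y z z = (1 : R)%:C *: cell_unitary z z.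
Proof. by move=> xz yz xy; rewrite cellE // /cell_coef xy. Qed.

Lemma cell_centre a b : cell None None (pt a 1) (pt b 1) =
  if a == b then (star_delta k lambda a)%:C *: u a a
  else (Num.sqrt (star_alpha k lambda a * star_alpha k lambda b))%:C *: u a b.
Proof.
case: eqVneq => [<-|ab].
  by rewrite -[None]/(pt a 0) cell_up // subn0.
rewrite cell_turn ?star_edge_centre //; last first.
  by apply: contra ab => /eqP/(ray_vertex_inj (k_gt0 a) (k_gt0 b))[->].
by rewrite !omega_ray // divr1 !subn1 cell_unitary_ray.
Qed.

(** For z <> w there is one cell, a unitary up to its weight.  For z = w,
    inserting the weights, the claim is a 2 x 2 identity that follows from
    Rpoly_det. *)
Lemma cell_col x x1 z w : odd (dist z) -> odd (dist w) ->
  \sum_y (omega y)%:C *: (cell x y z w *m (cell x1 y z w)^t*) =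
  ([&& x == x1, e x z & e x w]%:R * (omega z * omega w / omega x)%:C)%:M.
Proof.
move=> oz ow.
have Uu := cell_unitary_unitary oz ow.
have [/andP[xz xw]|nx] := boolP (e x z && e x w); last first.
  rewrite andbF mul0r raddf0 big1 // => y _; rewrite cell0 ?mul0mx ?scaler0 //.
  by apply: contra nx => /and4P[-> _ -> _].
rewrite andbT.
have [/andP[x1z x1w]|nx1] := boolP (e x1 z && e x1 w); last first.
  have -> : x == x1 = false by apply: contraNF nx1 => /eqP <-; rewrite xz xw.
  rewrite mul0r raddf0 big1 // => y _.
  rewrite [cell x1 y z w]cell0 ?adjmx0 ?mulmx0 ?scaler0 //.
  by apply: contra nx1 => /and4P[-> _ -> _].
have [zw|zw] := eqVneq z w; last first.
  have only y y' : e y z -> e y w -> e y' z -> e y' w -> y = y'.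
    move=> yz yw yz' yw'; apply/eqP; apply: contraNT zw => yy'.
    by apply/eqP; apply: star_no_square yz yz' yw yw' yy'.
  have {x1z x1w} <- : x = x1 by apply: only.
  rewrite eqxx mul1r (bigD1 x) //= big1 ?addr0 => [|y yx]; last first.
    rewrite cell0 ?mul0mx ?scaler0 //; apply: contra yx => /and4P[_ yz _ yw].
    by apply/eqP; apply: only.
  rewrite cell_turn // scaled_unitaryM // scale_scalar_mx -realCM; congr (_%:C%:M).
  rewrite mulrACA -expr2 sqr_sqrtr ?mulr_ge0 ?(ltW (omega_gt0 _)) //.
  by field; rewrite gt_eqF ?omega_gt0.
subst w; have [a [q [lq zE]]] := odd_dist_ray oz.
subst z; rewrite cell_unitary_same // in Uu.
rewrite (star_sum_ray lq) => [|y]; last first.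
  rewrite star_edge_sym => ny; rewrite cell0 ?mul0mx ?scaler0 //.
  by rewrite (negbTE ny) !andbF.
have r0 p : (p <= k a)%N -> rv p != 0 by move=> pk; rewrite gt_eqF ?(r_gt0 pk).
have rka := r0 _ (leqnn (k a)).
pose D := (k a - q.+1)%N.
have kD : (k a - q)%N = D.+1 by rewrite /D; lia.
have rD1 : rv D.+1 != 0 by rewrite -kD r0 ?leq_subr.
have om0 : omega (pt a q) = rv D.+1 / rv (k a) by rewrite omega_ray ?kD // ltnW.
have om1 : omega (pt a q.+1) = rv D / rv (k a) by rewrite omega_ray.
have up : cell (pt a q) (pt a q) (pt a q.+1) (pt a q.+1) = (1 / rv D.+1)%:C *: u a a.
  by rewrite cell_up // kD.
have nbr y : e y (pt a q.+1) -> y = pt a q \/ ((q.+1 < k a)%N /\ y = pt a q.+2).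
  by rewrite star_edge_sym; apply: star_nbr.
have [lq2|lq2] := boolP (q.+1 < k a)%N; last first.
  have D0 : D = 0%N by rewrite /D; lia.
  case/nbr: xz => [->|[]]; last by rewrite (negbTE lq2).
  case/nbr: x1z => [->|[]]; last by rewrite (negbTE lq2).
  rewrite up scaled_unitaryM // addr0 eqxx scale_scalar_mx [true%:R * _]mul1r -realCM om0 om1 D0.
  rewrite D0 in rD1; rewrite Rpoly0; congr (_%:C%:M); field.
  by rewrite rD1 rka.
have [D' DE] : exists D', D = D'.+1 by exists (k a - q.+2)%N; rewrite /D; lia.
have kD' : (k a - q.+2)%N = D' by move: DE; rewrite /D; lia.
have rD' : rv D' != 0 by rewrite -kD' r0 ?leq_subr.
have om2 : omega (pt a q.+2) = rv D' / rv (k a) by rewrite omega_ray ?kD'.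
have down : cell (pt a q.+2) (pt a q.+2) (pt a q.+1) (pt a q.+1) =
  (- 1 / rv D')%:C *: u a a by rewrite cell_down // kD'.
have neq20 := ray_vertex_neq lq2.
have e0 : e (pt a q) (pt a q.+1) by rewrite star_edge_next.
have e2 : e (pt a q.+2) (pt a q.+1) by rewrite star_edge_sym star_edge_next.
have cross1 : cell (pt a q) (pt a q.+2) (pt a q.+1) (pt a q.+1) = (1 : R)%:C *: u a a.
  by rewrite cell_cross // 1?eq_sym // cell_unitary_same.
have cross2 : cell (pt a q.+2) (pt a q) (pt a q.+1) (pt a q.+1) = (1 : R)%:C *: u a a.
  by rewrite cell_cross // cell_unitary_same.
have addC (c d v : R) : c + d = v -> c%:C%:M + d%:C%:M = v%:C%:M :> 'M[C]_n.
  by move=> <-; rewrite -raddfD -rmorphD.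
have det := Rpoly_det D' lambda; rewrite -DE in det.
case/nbr: xz => [->|[_ ->]]; case/nbr: x1z => [->|[_ ->]].
- rewrite up cross1 !scaled_unitaryM // !scale_scalar_mx -!realCM eqxx [true%:R * _]mul1r.
  apply: addC; rewrite om0 om1 om2.
  have -> : rv D' = (rv D ^+ 2 - 1) / rv D.+1 by rewrite det; field.
  by field; rewrite rD1 rka.
- rewrite up down cross1 cross2 !scaled_unitaryM // !scale_scalar_mx -!realCM.
  rewrite eq_sym (negbTE neq20) mul0r raddf0 -(raddf0 (@scalar_mx C n)).
  rewrite -[0 in RHS]/((0 : R)%:C); apply: addC; rewrite om0 om2.
  by field; rewrite rD1 rka rD'.
- rewrite up down cross1 cross2 !scaled_unitaryM // !scale_scalar_mx -!realCM.
  rewrite (negbTE neq20) mul0r raddf0 -(raddf0 (@scalar_mx C n)).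
  rewrite -[0 in RHS]/((0 : R)%:C); apply: addC; rewrite om0 om2.
  by field; rewrite rD1 rka rD'.
- rewrite down cross2 !scaled_unitaryM // !scale_scalar_mx -!realCM eqxx [true%:R * _]mul1r.
  apply: addC; rewrite om0 om1 om2.
  have -> : rv D.+1 = (rv D ^+ 2 - 1) / rv D' by rewrite det; field.
  by field; rewrite rka rD'.
Qed.
Hypothesis star_unitary : star_block_mx k lambda u \is unitarymx.

(** For x <> y there is one cell, a unitary.  For x = y the claim is the
    unitarity of the given block matrix at the centre, and that of a 2 x 2 real
    matrix elsewhere, by Rpoly_det. *)
Lemma cell_row x y z z1 : ~~ odd (dist x) -> odd (dist z) -> odd (dist z1) ->
  \sum_w cell x y z w *m (cell x y z1 w)^t* =
  [&& z == z1, e x z & e y z]%:R%:M.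
Proof.
move=> ex oz oz1.
have [/andP[xz yz]|nz] := boolP (e x z && e y z); last first.
  rewrite andbF raddf0 big1 // => w _; rewrite cell0 ?mul0mx //.
  by rewrite andbA negb_and nz.
rewrite andbT.
have [/andP[xz1 yz1]|nz1] := boolP (e x z1 && e y z1); last first.
  have -> : z == z1 = false by apply: contraNF nz1 => /eqP <-; rewrite xz yz.
  rewrite raddf0 big1 // => w _; rewrite [cell x y z1 w]cell0 ?adjmx0 ?mulmx0 //.
  by rewrite andbA negb_and nz1.
have [xy|xy] := eqVneq x y; last first.
  have zz1 := star_no_square k_gt0 xz yz xz1 yz1 xy; subst z1.
  rewrite eqxx (bigD1 z) //= big1 ?addr0 => [|w wz]; last first.
    rewrite cell0 ?mul0mx //; apply: contra wz => /and4P[_ _ xw yw].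
    by rewrite (star_no_square k_gt0 xz yz xw yw xy).
  rewrite cellE // scaled_unitaryM ?cell_unitary_unitary // /cell_coef xy.
  by rewrite mulr1.
subst y.
have [xN|[a [p [lp xE]]]] := star_vertexP x.
  subst x; have [a zE] := star_nbr_centre xz; have [b z1E] := star_nbr_centre xz1.
  rewrite zE z1E star_sum_centre // => [|w nw]; last first.
    by rewrite cell0 ?mul0mx // (negbTE nw) !andbF.
  have := star_unitary; rewrite /star_block_mx => /mxblock_unitaryP/(_ a b).
  have -> : (pt a 1 == pt b 1) = (a == b).
    by apply/eqP/eqP => [/(ray_vertex_inj (k_gt0 a) (k_gt0 b))[]|->].
  move=> <-; apply: eq_bigr => c _.
  by rewrite !cell_centre.
have oddp : odd p by move: ex; rewrite xE dist_ray_vertex //= negbK.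
case: p oddp lp xE {ex} => [//|p] _ lp xE.
have lp' := ltnW lp.
have U1 : u a a *m (u a a)^t* = 1%:M by apply/unitarymxP.
rewrite (star_sum_ray (a := a) (p := p.+1)) // => [|w nw]; last first.
  by rewrite cell0 ?mul0mx // xE (negbTE nw) !andbF.
move: xz xz1 {yz yz1}; rewrite xE => xz xz1.
have r0 q : (q <= k a)%N -> rv q != 0 by move=> qk; rewrite gt_eqF ?(r_gt0 qk).
pose D := (k a - p.+2)%N.
have kD : (k a - p.+1)%N = D.+1 by rewrite /D; lia.
have rD : rv D != 0 by apply: r0; apply: leq_subr.
have down : cell (pt a p.+2) (pt a p.+2) (pt a p.+1) (pt a p.+1) =
  (- 1 / rv D)%:C *: u a a := cell_down lp.
have [lp2|lp2] := boolP (p.+2 < k a)%N; last first.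
  have D0 : D = 0%N by rewrite /D; lia.
  case/(star_nbr lp): xz => [->|[]]; last by rewrite (negbTE lp2).
  case/(star_nbr lp): xz1 => [->|[]]; last by rewrite (negbTE lp2).
  rewrite down scaled_unitaryM // addr0 eqxx D0 Rpoly0; congr (_%:C%:M).
  by rewrite divr1 mulrNN mulr1.
have up : cell (pt a p.+2) (pt a p.+2) (pt a p.+3) (pt a p.+3) =
  (1 / rv D)%:C *: u a a := cell_up lp2.
have [D' DE] : exists D', D = D'.+1 by exists (k a - p.+3)%N; rewrite /D; lia.
have kD' : (k a - p.+3)%N = D' by move: DE; rewrite /D; lia.
pose tau := Num.sqrt (rv D' * rv D.+1) / rv D.
have rr : 0 <= rv D' * rv D.+1.
  by rewrite mulr_ge0 // ltW // (@r_gt0 a) // -?kD' -?kD leq_subr.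
have tau2 : tau * tau = 1 - 1 / rv D * (1 / rv D).
  rewrite /tau mulrACA -expr2 (sqr_sqrtr rr).
  have := Rpoly_det D' lambda; rewrite -DE => det.
  have -> : rv D' * rv D.+1 = rv D ^+ 2 - 1 by rewrite det; ring.
  by field.
have rka := r0 _ (leqnn (k a)).
have tauE : Num.sqrt (omega (pt a p.+1) * omega (pt a p.+3)) / omega (pt a p.+2) = tau.
  rewrite !omega_ray ?(ltnW lp) // kD kD' -/D /tau.
  have -> : rv D.+1 / rv (k a) * (rv D' / rv (k a)) =
      rv D' * rv D.+1 * (rv (k a))^-1 ^+ 2 by field.
  rewrite (sqrtrM _ rr) sqrtr_sqr gtr0_norm ?invr_gt0 ?(r_gt0 (leqnn _)) //.
  by field; rewrite rka rD.
have e1 : e (pt a p.+2) (pt a p.+1) by rewrite star_edge_sym star_edge_next.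
have e3 : e (pt a p.+2) (pt a p.+3) by rewrite star_edge_next.
(* tau is the off-diagonal entry of the 2 x 2 matrix around x. *)
have turn1 : cell (pt a p.+2) (pt a p.+2) (pt a p.+1) (pt a p.+3) = tau%:C *: u a a.
  by rewrite cell_turn // 1?eq_sym ?ray_vertex_neq // tauE cell_unitary_ray.
have turn2 : cell (pt a p.+2) (pt a p.+2) (pt a p.+3) (pt a p.+1) = tau%:C *: u a a.
  rewrite cell_turn ?ray_vertex_neq // [omega (pt a p.+3) * _]mulrC tauE.
  by rewrite cell_unitary_ray.
have neq31 := negbTE (ray_vertex_neq lp2).
have addC (c d v : R) : c + d = v -> c%:C%:M + d%:C%:M = v%:C%:M :> 'M[C]_n.
  by move=> <-; rewrite -raddfD -rmorphD.
case/(star_nbr lp): xz => [->|[_ ->]]; case/(star_nbr lp): xz1 => [->|[_ ->]].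
- rewrite down turn1 !scaled_unitaryM // eqxx; apply: addC.
  by rewrite tau2 mulNr mulrNN addrC subrK.
- rewrite down turn1 turn2 up !scaled_unitaryM // eq_sym neq31; apply: addC.
  by rewrite mulNr mulNr mulrC addNr.
- rewrite down turn1 turn2 up !scaled_unitaryM // neq31; apply: addC.
  by rewrite mulNr mulrN mulrC addNr.
- rewrite turn2 up !scaled_unitaryM // eqxx; apply: addC.
  by rewrite tau2 subrK.
Qed.

End StarCells.

(** * Bipartitions *)

Section Bipartitions.

Record bipartition (V : finType) (e : rel V) (r s : nat) (rho : 'I_r -> V)
    (kappa : 'I_s -> V) : Prop := {
  bip_sum : forall (T : nmodType) (f : V -> T),
    \sum_x f x = \sum_i f (rho i) + \sum_j f (kappa j);
  bip_row_inj : injective rho;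
  bip_col_inj : injective kappa;
  bip_disjoint : forall i j, rho i <> kappa j;
  bip_cover : forall x, (exists i, x = rho i) \/ (exists j, x = kappa j);
  bip_row : forall i i', e (rho i) (rho i') = false;
  bip_col : forall j j', e (kappa j) (kappa j') = false }.

Lemma bipartition_swap (V : finType) (e : rel V) r s (rho : 'I_r -> V)
    (kappa : 'I_s -> V) : bipartition e rho kappa -> bipartition e kappa rho.
Proof.
case=> h1 h2 h3 h4 h5 h6 h7; split=> // [T f|i j ij|x].
- by rewrite h1 addrC.
- exact: (h4 j i).
- by case: (h5 x); [right|left].
Qed.

Lemma bipartition_mxP (V : finType) (e : rel V) r s (G : 'M[nat]_(r, s)) :
  symmetric e -> bipartition_mx e G ->
  exists rho kappa, bipartition e rho kappa /\
    forall i j, G i j = e (rho i) (kappa j).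
Proof.
move=> e_sym [sigma [[tau sK tK] eG]].
have s_inj := can_inj sK.
have eGE x y : (e (sigma x) (sigma y) : nat) = block_mx 0 G G^T 0 x y.
  have := congr1 (fun M : 'M_(r + s) => M x y) eG; rewrite mxE => <-.
  by case: (e _ _).
exists (fun i => sigma (lshift s i)), (fun j => sigma (rshift r j)); split.
  split=> [T f|i i' /s_inj/lshift_inj//|j j' /s_inj/rshift_inj//|i j /s_inj/eqP|x|i i'|j j'].
  - by rewrite (reindex sigma) ?big_split_ord //; apply: onW_bij; exists tau.
  - by rewrite eq_lrshift.
  - rewrite -(tK x); case: (splitP (tau x)) => y yE.
      by left; exists y; congr sigma; apply: val_inj.
    by right; exists y; congr sigma; apply: val_inj.
  - have := eGE (lshift s i) (lshift s i'); rewrite block_mxEul mxE.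
    by case: (e _ _).
  - have := eGE (rshift r j) (rshift r j'); rewrite block_mxEdr mxE.
    by case: (e _ _).
by move=> i j; rewrite eGE block_mxEur.
Qed.

Section Glue.
Variables (R : realType) (V : finType) (e : rel V) (r s : nat).
Variables (rho : 'I_r -> V) (kappa : 'I_s -> V).
Variables (f : 'I_r -> R) (g : 'I_s -> R).

Definition glue (x : V) : R :=
  if [pick i | rho i == x] is Some i then f i
  else if [pick j | kappa j == x] is Some j then g j else 0.

Hypothesis bip : bipartition e rho kappa.

Lemma glue_row i : glue (rho i) = f i.
Proof.
rewrite /glue; case: pickP => [l /eqP/(bip_row_inj bip)-> //|].
by move=> /(_ i); rewrite eqxx.
Qed.

Lemma glue_col j : glue (kappa j) = g j.
Proof.
rewrite /glue; case: pickP => [l /eqP/(bip_disjoint bip) //|_].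
case: pickP => [l /eqP/(bip_col_inj bip)-> //|].
by move=> /(_ j); rewrite eqxx.
Qed.

End Glue.

End Bipartitions.

(** * Biunitary connections on a star *)

Section StarBiunitary.
Variable R : realType.
Local Notation C := R[i].
Variables (m : nat) (k : 'I_m -> nat) (lambda : R).
Hypothesis m_ge2 : (2 <= m)%N.
Hypothesis k_gt0 : forall j, (0 < k j)%N.
Local Notation V := (star_vertex k).
Local Notation e := (@star_edge m k).
Local Notation pt := (@ray_vertex m k).
Local Notation omega := (@star_weight R m k lambda).
Hypothesis hlambda : perron_frobenius e lambda.
Variables (r s n : nat) (rho : 'I_r -> V) (kappa : 'I_s -> V).
Hypothesis bip : bipartition e rho kappa.
Local Notation E := (fun i j => e (rho i) (kappa j)).
Variable i0 : 'I_r.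
Hypothesis centre : rho i0 = None.

(** The class alternates along a ray. *)
Lemma parity_class a q : (q <= k a)%N ->
  if odd q then exists j, pt a q = kappa j else exists i, pt a q = rho i.
Proof.
elim: q => [_|q IH lq]; first by exists i0.
have := IH (ltnW lq); rewrite oddS; case: (odd q) => /= -[x xE].
  have [//|[j jE]] := bip_cover bip (pt a q.+1).
  by have := star_edge_next lq; rewrite xE jE (bip_col bip).
have [[i iE]|//] := bip_cover bip (pt a q.+1).
by have := star_edge_next lq; rewrite xE iE (bip_row bip).
Qed.

Lemma vertex_class (x : V) :
  if odd (dist x) then exists j, x = kappa j else exists i, x = rho i.
Proof.
have [->|[a [p [lp ->]]]] := star_vertexP x; first by exists i0.
by rewrite dist_ray_vertex //; apply: parity_class.
Qed.

Lemma odd_row i : odd (dist (rho i)) = false.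
Proof.
have := vertex_class (rho i); case: odd => // -[j /(bip_disjoint bip)].
by [].
Qed.

Lemma odd_col j : odd (dist (kappa j)).
Proof.
have := vertex_class (kappa j); case: odd => // -[l] /esym/(bip_disjoint bip).
by [].
Qed.

Lemma perron_pair_star :
  perron_pair E lambda (fun i => omega (rho i)) (fun j => omega (kappa j)).
Proof.
have eig := perron_weight_eigen k_gt0 m_ge2 hlambda.
have pos x := perron_weight_gt0 k_gt0 m_ge2 hlambda x.
split=> // [|i|j].
- rewrite -(perron_alpha_sum k_gt0 m_ge2 hlambda).
  have a0 : 'I_m := Ordinal (ltnW m_ge2).
  rewrite (bigD1 a0) //= ltr_wpDr ?perron_alpha_gt0 //.
  by apply: sumr_ge0 => a _; rewrite ltW ?perron_alpha_gt0.
- rewrite eig (bip_sum bip) big1 ?add0r // => l _.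
  by rewrite (bip_row bip) mul0r.
- rewrite eig (bip_sum bip) [X in _ + X]big1 ?addr0 => [|l _].
    by apply: eq_bigr => i _; rewrite star_edge_sym.
  by rewrite (bip_col bip) mul0r.
Qed.

Lemma biunitary_of_star (u : 'I_m -> 'I_m -> 'M[C]_n) :
  (forall a b, u a b \is unitarymx) -> star_block_mx k lambda u \is unitarymx ->
  biunitary E (fun i => omega (rho i)) (fun j => omega (kappa j))
    (fun i l j j' => cell lambda u (rho i) (rho l) (kappa j) (kappa j')).
Proof.
move=> uu block.
have r_gt0 a q : (q <= k a)%N -> 0 < (Rpoly R q).[lambda].
  exact: Rpoly_perron_gt0.
split=> [i l j j'|i l j j1|j j' i i1].
- by apply: contraNT => /cell0->.
- have := cell_row k_gt0 r_gt0 uu block (x := rho i) (rho l)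
    (z := kappa j) (z1 := kappa j1).
  rewrite odd_row !odd_col => /(_ isT isT isT).
  rewrite (inj_eq (bip_col_inj bip)) (bip_sum bip) big1 ?add0r // => i' _.
  by rewrite cell0 ?mul0mx // (bip_row bip) !andbF.
- have := cell_col k_gt0 r_gt0 uu (rho i) (rho i1) (z := kappa j) (w := kappa j').
  rewrite !odd_col => /(_ isT isT).
  rewrite (inj_eq (bip_row_inj bip)) (bip_sum bip) [X in _ + X]big1 ?addr0 // => i' _.
  by rewrite cell0 ?mul0mx ?scaler0 // star_edge_sym (bip_col bip) !andbF.
Qed.

Section FromBiunitary.
Variables (lam : R) (phi : 'I_r -> R) (chi : 'I_s -> R).
Variable W : 'I_r -> 'I_r -> 'I_s -> 'I_s -> 'M[C]_n.
Hypothesis pf : perron_pair E lam phi chi.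
Hypothesis WP : biunitary E phi chi W.
Local Notation alpha a := (star_alpha k lambda a).
Local Notation delta a := (star_delta k lambda a).

Lemma first_vertex_col : exists f : 'I_m -> 'I_s, forall a, kappa (f a) = pt a 1.
Proof.
have /fin_all_exists[f fP] : forall a, exists j, pt a 1 = kappa j.
  by move=> a; have := parity_class (k_gt0 a).
by exists f.
Qed.

Local Notation psi := (glue rho kappa phi chi).

Lemma glued_weight_gt0 x : 0 < psi x.
Proof.
have [[l ->]|[j ->]] := bip_cover bip x.
- by rewrite (glue_row phi chi bip) pf.(perron_row_gt0).
- by rewrite (glue_col phi chi bip) pf.(perron_col_gt0).
Qed.

Lemma glued_weight_eigen : eigenfunction e lam psi.
Proof.
move=> x; rewrite (bip_sum bip); have [[l ->]|[j ->]] := bip_cover bip x.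
- rewrite (glue_row phi chi bip) pf.(perron_row) [X in _ = X + _]big1 ?add0r => [|i _].
    by apply: eq_bigr => j _; rewrite (glue_col phi chi bip).
  by rewrite (bip_row bip) mul0r.
- rewrite (glue_col phi chi bip) pf.(perron_col) [X in _ = _ + X]big1 ?addr0 => [|i _].
    by apply: eq_bigr => i _; rewrite (glue_row phi chi bip) star_edge_sym.
  by rewrite (bip_col bip) mul0r.
Qed.

(** A positive eigenfunction can only belong to the largest eigenvalue. *)
Lemma perron_value : lam = lambda.
Proof.
have eig := perron_weight_eigen k_gt0 m_ge2 hlambda.
have pos x := perron_weight_gt0 k_gt0 m_ge2 hlambda x.
exact: positive_eigenfunction_uniq (@star_edge_sym _ _) glued_weight_eigen eig
  glued_weight_gt0 pos None.
Qed.

Lemma first_vertex_weight a j : kappa j = pt a 1 -> chi j = alpha a * phi i0.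
Proof.
move=> jE; have := glued_weight_eigen; rewrite perron_value => eig.
rewrite -(glue_col phi chi bip) jE -(glue_row phi chi bip) centre.
by apply: (star_eigen_alpha k_gt0 _ eig) => b; apply: Rpoly_perron_neq0.
Qed.

(** This is Rpoly_det divided by the square of R_(k a). *)
Lemma star_row_norm a : delta a ^+ 2 = 1 - alpha a * (lambda - alpha a).
Proof.
rewrite /star_delta /star_alpha; have := Rpoly_perron_neq0 k_gt0 m_ge2 hlambda a.
have := k_gt0 a; case: (k a) => // q _ /=.
have := Rpoly_det q lambda; rewrite RpolySS => det r0.
move: (Rpoly R q).[lambda] (Rpoly R q.+1).[lambda] r0 det => x y y0 det.
have -> : 1 - x / y * (lambda - x / y) = (y ^+ 2 - x * (lambda * y - x)) / y ^+ 2.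
  by field.
by rewrite {1}det; field.
Qed.

(** Two rays have only the centre as a common neighbour of their first
    vertices, so conn_col gives the off-diagonal blocks B a b of W at the centre
    the squared scalar alpha_a alpha_b.  Unitarity of the a-th row of blocks
    then leaves 1 - alpha_a (lambda - alpha_a) = delta_a^2 for the diagonal
    block. *)
Lemma star_of_biunitary : exists u : 'I_m -> 'I_m -> 'M[C]_n,
  (forall a b, u a b \is unitarymx) /\ star_block_mx k lambda u \is unitarymx.
Proof.
have [f fE] := first_vertex_col.
have alpha_gt0 a : 0 < alpha a by apply: perron_alpha_gt0.
have delta_gt0 a : 0 < delta a.
  by rewrite divr_gt0 ?(Rpoly_perron_gt0 k_gt0 m_ge2 hlambda (leqnn _)).
have phi0 := pf.(perron_row_gt0) i0.
have f_inj a b : (f a == f b) = (a == b).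
  apply/eqP/eqP => [ab|->//]; have := fE a; rewrite ab fE.
  by case/(ray_vertex_inj (k_gt0 b) (k_gt0 a)).
have Ef a : e (rho i0) (kappa (f a)) by rewrite centre fE star_edge_centre.
pose B a b := W i0 i0 (f a) (f b).
have sum_nbr (F : 'I_s -> 'M[C]_n) : (forall j, ~~ E i0 j -> F j = 0) ->
    \sum_j F j = \sum_a F (f a).
  move=> F0; rewrite (bigID (fun j => E i0 j)) /= [X in _ + X]big1 ?addr0 => [|j /F0//].
  rewrite (reindex_omap f (fun j => ray (kappa j))) => [|j]; last first.
    rewrite centre => /star_nbr_centre[a jE]; rewrite jE ray_ray_vertex //=.
    by congr Some; apply: (bip_col_inj bip); rewrite fE jE.
  by apply: eq_bigl => a; rewrite fE ray_ray_vertex // eqxx andbT centre star_edge_centre.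
have Brow a b : \sum_c B a c *m (B b c)^t* = (a == b)%:R%:M.
  have := WP.(conn_row) i0 i0 (f a) (f b); rewrite sum_nbr => [->|j nj].
    by rewrite !Ef !andbT f_inj.
  have -> : W i0 i0 (f a) j = 0; last by rewrite mul0mx.
  apply/eqP; apply: contraNT nj => /(WP.(conn_supp)) /and4P[_ _ -> _] //.
have Boff a b : a != b -> B a b *m (B a b)^t* = (alpha a * alpha b)%:C%:M.
  move=> ab; have := WP.(conn_col) (f a) (f b) i0 i0.
  rewrite (bigD1 i0) //= [X in _ + X]big1 => [|l li0]; last first.
    suff -> : W i0 l (f a) (f b) = 0 by rewrite mul0mx scaler0.
    apply/eqP; apply: contraNT ab => /(WP.(conn_supp)) /and4P[h1 h2 h3 h4].
    have := star_no_square k_gt0 h1 h2 h3 h4; rewrite (inj_eq (bip_row_inj bip)).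
    by rewrite eq_sym li0 => /(_ isT)/(bip_col_inj bip)/eqP; rewrite f_inj.
  rewrite addr0 eqxx !Ef mul1r -/(B a b) => h.
  have p0 : (phi i0)%:C != 0 by rewrite gt_eqF // ltcR.
  apply: (scalerI p0); rewrite h scale_scalar_mx -realCM; congr (_%:C%:M).
  rewrite (first_vertex_weight (fE a)) (first_vertex_weight (fE b)).
  by field; rewrite gt_eqF.
have Bdiag a : B a a *m (B a a)^t* = (delta a ^+ 2)%:C%:M.
  have := Brow a a; rewrite eqxx (bigD1 a) //= => h.
  have {h} -> : B a a *m (B a a)^t* = 1%:M - \sum_(c | c != a) B a c *m (B a c)^t*.
    by rewrite -h addrK.
  rewrite (eq_bigr (fun c => (alpha a * alpha c)%:C%:M)) => [|c ca]; last first.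
    by rewrite Boff // eq_sym.
  rewrite -raddf_sum -rmorph_sum -mulr_sumr star_row_norm.
  have sumE : \sum_(c | c != a) alpha c = lambda - alpha a.
    apply/eqP; rewrite eq_sym subr_eq addrC.
    by have := perron_alpha_sum k_gt0 m_ge2 hlambda; rewrite (bigD1 a) //= => ->.
  rewrite sumE.
  by rewrite rmorphB raddfB.
pose u a b := (if a == b then (delta a)^-1 else (Num.sqrt (alpha a * alpha b))^-1)%:C *: B a b.
exists u; split=> [a b|].
  apply/unitarymxP; rewrite /u adj_realZ -scalemxAr -scalemxAl scalerA -realCM.
  case: eqVneq => [<-|ab].
    rewrite Bdiag scale_scalar_mx -realCM -expr2 -exprMn mulVf ?expr1n //.
    by rewrite gt_eqF.
  rewrite Boff // scale_scalar_mx -realCM -expr2 exprVn sqr_sqrtr ?mulVf //.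
    by rewrite gt_eqF // mulr_gt0.
  by rewrite mulr_ge0 ?ltW.
rewrite /star_block_mx; apply/mxblock_unitaryP => a b; rewrite -Brow.
have BE c d : (if c == d then (delta c)%:C *: u c c
    else (Num.sqrt (alpha c * alpha d))%:C *: u c d) = B c d.
  rewrite /u eqxx; case: eqVneq => [<-|cd]; rewrite scalerA -realCM divff ?scale1r //.
    by rewrite gt_eqF.
  by rewrite gt_eqF // sqrtr_gt0 mulr_gt0.
by apply: eq_bigr => c _; rewrite !BE.
Qed.

End FromBiunitary.
End StarBiunitary.

(** * Commuting squares on a star *)

Section StarSquares.
Variable R : realType.
Local Notation C := R[i].
Variables (m : nat) (k : 'I_m -> nat) (lambda : R).
Hypothesis m_ge2 : (2 <= m)%N.
Hypothesis k_gt0 : forall j, (0 < k j)%N.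
Local Notation e := (@star_edge m k).
Hypothesis hlambda : perron_frobenius e lambda.
Variable n : nat.
Hypothesis n_gt0 : (0 < n)%N.

Definition has_biunitary (r s : nat) (E : 'I_r -> 'I_s -> bool) : Prop :=
  exists lam phi chi (W : _ -> _ -> _ -> _ -> 'M[C]_n),
    perron_pair E lam phi chi /\ biunitary E phi chi W.

Lemma has_biunitary_swap (r s : nat) (E : 'I_r -> 'I_s -> bool) :
  has_biunitary E -> has_biunitary (fun j i => E i j).
Proof.
move=> [lam [phi [chi [W [pf WP]]]]]; exists lam, chi, phi; eexists; split.
  by case: pf => h1 h2 h3 h4 h5; split.
by apply: biunitary_swap WP; case: pf.
Qed.

Lemma has_biunitary_star (r s : nat) (rho : 'I_r -> star_vertex k)
    (kappa : 'I_s -> star_vertex k) (i0 : 'I_r) :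
  bipartition e rho kappa -> rho i0 = None ->
  has_biunitary (fun i j => e (rho i) (kappa j)) <->
  exists u : 'I_m -> 'I_m -> 'M[C]_n,
    (forall i j, u i j \is unitarymx) /\ star_block_mx k lambda u \is unitarymx.
Proof.
move=> bip centre; split=> [[lam [phi [chi [W [pf WP]]]]]|[u [uu block]]].
  exact (star_of_biunitary m_ge2 k_gt0 hlambda bip centre pf WP).
exists lambda, (fun i => star_weight lambda (rho i)),
  (fun j => star_weight lambda (kappa j)); eexists; split.
  exact (perron_pair_star m_ge2 k_gt0 hlambda bip).
exact (biunitary_of_star m_ge2 k_gt0 hlambda bip centre uu block).
Qed.

Lemma star_connected (T : Type) (F : star_vertex k -> T) :
  (forall x y, e x y -> F x = F y) -> forall x, F x = F None.
Proof.
move=> Fe x; have [->//|[a [p [lp ->]]]] := star_vertexP x.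
suff H q : (q <= k a)%N -> F (ray_vertex k a q) = F None by exact: H.
elim: q => [//|q IH lq]; rewrite -IH ?(ltnW lq) //.
by apply/esym/Fe; rewrite star_edge_next.
Qed.

Lemma star_has_nbr (x : star_vertex k) : exists y, e x y.
Proof.
have [->|[a [p [lp ->]]]] := star_vertexP x.
  have a0 : 'I_m := Ordinal (ltnW m_ge2).
  by exists (ray_vertex k a0 1); rewrite star_edge_centre.
by exists (ray_vertex k a p); rewrite star_edge_sym star_edge_next.
Qed.

Lemma has_biunitary_square (r s : nat) (rho : 'I_r -> star_vertex k)
    (kappa : 'I_s -> star_vertex k) (G : 'M[nat]_(r, s)) :
  bipartition e rho kappa -> (forall i j, G i j = e (rho i) (kappa j)) ->
  has_commuting_square R G n <-> has_biunitary (fun i j => e (rho i) (kappa j)).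
Proof.
move=> bip GE.
have nbr_row i : exists j, e (rho i) (kappa j).
  have [y xy] := star_has_nbr (rho i).
  have [[l lE]|[j jE]] := bip_cover bip y; last by exists j; rewrite -jE.
  by rewrite lE (bip_row bip) in xy.
have nbr_col j : exists i, e (rho i) (kappa j).
  have [y xy] := star_has_nbr (kappa j).
  have [[l lE]|[j' jE]] := bip_cover bip y.
    by exists l; rewrite -lE star_edge_sym.
  by rewrite jE (bip_col bip) in xy.
split=> [sq|[lam [phi [chi [W [pf WP]]]]]]; last first.
  exact: square_of_biunitary GE _ _ _ _ _ _ _ pf WP.
have [i0 _] : exists i, e (rho i) (rho i) = false.
  have [[l lE]|[j _]] := bip_cover bip None; first by exists l; rewrite (bip_row bip).
  by have [l _] := nbr_col j; exists l; rewrite (bip_row bip).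
apply: (biunitary_of_square GE n_gt0 nbr_row nbr_col _ i0 sq) => f g fg i i'.
rewrite -(glue_row f g bip i) -(glue_row f g bip i').
suff glueE x y : e x y -> glue rho kappa f g x = glue rho kappa f g y.
  by rewrite !(star_connected glueE).
have [[l ->]|[j ->]] := bip_cover bip x; have [[l' ->]|[j' ->]] := bip_cover bip y;
  rewrite ?(bip_row bip) ?(bip_col bip) // ?(glue_row f g bip) ?(glue_col f g bip).
- exact: fg.
- by rewrite star_edge_sym => /fg.
Qed.

End StarSquares.

Local Close Scope complex_scope.
Local Close Scope sesquilinear_scope.

Theorem proposition2p10 (R : realType) (m : nat) (hm : (2 <= m)%N)
    (k : 'I_m -> nat) (hk1 : forall j : 'I_m, (1 <= k j)%N)
    (hk : forall i j : 'I_m, (i <= j)%N -> (k i <= k j)%N)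
    (lambda : R) (hlambda : perron_frobenius (@star_edge m k) lambda)
    (r s : nat) (G : 'M[nat]_(r, s))
    (hG : bipartition_mx (@star_edge m k) G)
    (n : nat) (hn : (0 < n)%N) :
  has_commuting_square R G n
  <-> exists u : 'I_m -> 'I_m -> 'M[R[i]]_n,
        (forall i j : 'I_m, u i j \is unitarymx)
        /\ star_block_mx k lambda u \is unitarymx.
Proof.
have [rho [kappa [bip GE]]] := bipartition_mxP (@star_edge_sym m k) hG.
rewrite (has_biunitary_square R hm hk1 hn bip GE).
(* The centre may belong to either class; exchanging the classes reduces the
   second case to the first. *)
have [[i0 centre]|[j0 centre]] := bip_cover bip None.
  by apply: (has_biunitary_star hm hk1 hlambda n bip) (esym centre).
rewrite -(has_biunitary_star hm hk1 hlambda n (bipartition_swap bip) (esym centre)).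
have -> : (fun j i => star_edge (kappa j) (rho i)) =
          (fun j i => star_edge (rho i) (kappa j)).
  by apply/funext => j; apply/funext => l; apply: star_edge_sym.
by split=> /has_biunitary_swap.
Qed.
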